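(* Let $p>2$ and let $\mathbf X\in G\Omega_p(\mathbb R^d)$ be a geometric $p$-rough path on $[0,T]$. Fix $k\ge1$ and $M\in\mathcal L(\mathbb R^d,\mathfrak{so}(k))$, and for each $\lambda\in\mathbb R$ let $Y^\lambda_{[0,T]}$ be the unique solution of the linear rough differential equation $$dY^\lambda_t=Y^\lambda_t(\lambda M)(d\mathbf X_t),\qquad Y^\lambda_0=I_k .$$ Then: (1) For all $t\in[0,T]$, $Y^\lambda_t=\widetilde{\lambda M}(S(\mathbf X)_{0,t})=\sum_{n=0}^\infty\lambda^nM^{\otimes n}(S(\mathbf X)^n_{0,t})=\Phi_{\mathbf X_{[0,t]}}(\lambda M)$. (2) For all $t\in[0,T]$, $Y^\lambda_t\in O(k)$ is an orthogonal matrix. (3) For all $t\in[0,T]$, the mapping $\lambda\mapsto Y^\lambda_t$ is real analytic on $\mathbb R$ and can be extended to a holomorphic function on $\mathbb C$, and the extended function $Y^z_t=\sum_{n=0}^\infty z^nM^{\otimes n}(S(\mathbf X)^n_{0,t})=\widetilde{zM}(S(\mathbf X)_{0,t})$, $z\in\mathbb C$, satisfies the linear rough differential equation $dY^z_t=Y^z_t(zM)(d\mathbf X_t)$, $Y^z_0=I_k$. Moreover, for any $n\ge1$ and $\lambda\in\mathbb R$, the derivative $Y^{\lambda,(n)}_t=\frac{\partial^n}{\partial\lambda^n}Y^\lambda_t$ satisfies $$Y^{\lambda,(n)}_t=n!\int_{\Delta^n_t}\mathrm{Ad}_{Y^\lambda_{s_1}}(M(d\mathbf X_{s_1}))\cdots\mathrm{Ad}_{Y^\lambda_{s_n}}(M(d\mathbf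 X_{s_n}))\;Y^\lambda_t ,$$ where $n!\int_{\Delta^n_t}\mathrm{Ad}_{Y^\lambda_{s_1}}(M(d\mathbf X_{s_1}))\cdots\mathrm{Ad}_{Y^\lambda_{s_n}}(M(d\mathbf X_{s_n}))$ denotes the component $z^n_t$ of the unique solution $(y^0,z^1,\dots,z^n)\in(\mathbb R^{k\times k})^{n+1}$ of the coupled rough differential equation driven by $\mathbf X$ $$dy^0_t=\lambda y^0_tM(d\mathbf X_t),\quad dz^1_t=\mathrm{Ad}_{y^0_t}M(d\mathbf X_t),\quad dz^j_t=j\,z^{j-1}_t\,\mathrm{Ad}_{y^0_t}M(d\mathbf X_t)\ (2\le j\le n),$$ with $y^0_0=I_k$ and $z^j_0=0$ for $1\le j\le n$.
   Context: Tensor algebra. $V=\mathbb R^d$ with Euclidean norm; $T((V))=\prod_{n\ge 0}V^{\otimes n}$; $T^N(V)=\bigoplus_{n=0}^N V^{\otimes n}$; multiplication is $\otimes$; $\|\cdot\|_{\otimes n}$ is the projective tensor norm on $V^{\otimes n}$. Rough paths. A $p$-rough path on $[0,T]$ is a continuous map $\mathbf X:\{(s,t):0\le s\le t\le T\}\to T^{\lfloor p\rfloor}(V)$ with $\mathbf X^0_{s,t}=1$, $\mathbf X_{s,u}\otimes\mathbf X_{u,t}=\mathbf X_{s,t}$ for $s\le u\le t$, and for which there is a control $w$ (continuous, superadditive, vanishing on the diagonal) with $\sup_{1\le n\le\lfloor p\rfloor}\big((n/p)!\,\gamma_p\|\mathbf X^n_{s,t}\|_{\otimes n}\big)^{p/n}\le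 w(s,t)$, where $(n/p)!=\Gamma(n/p+1)$ and $\gamma_p$ depends only on $p$. The $p$-variation distance is $\|\mathbf X;\mathbf Y\|_{p\text{-var};[0,T]}^p=\sum_{n=1}^{\lfloor p\rfloor}\sup_{\mathcal D}\sum_{t_j\in\mathcal D}\|\mathbf X^n_{t_j,t_{j+1}}-\mathbf Y^n_{t_j,t_{j+1}}\|_{\otimes n}^{p/n}$ over dissections $\mathcal D$ of $[0,T]$. The signature path $S(\mathbf X)$ is the unique (Lyons) multiplicative extension of $\mathbf X$ to $T((V))$ satisfying the same bound for all $n\ge 1$. For a continuous bounded variation path $X$, $S(X)^n_{s,t}=\int_{s<s_1<\dots<s_n<t}dX_{s_1}\otimes\cdots\otimes dX_{s_n}$. $G\Omega_p(V)$ is the closure, in $p$-variation distance, of the truncated signatures $S_{\lfloor p\rfloor}(X)=(1,S(X)^1,\dots,S(X)^{\lfloor p\rfloor})$ of continuous bounded variation paths. Rough differential equations. A path $Y$ of finite $p$-variation is a solution of $dY_t=\mathbf V(Y_t)d\mathbf X_t$, $Y_0=y_0$, if there are continuous bounded variation paths $X(m)$ with $\|S_{\lfloor p\rfloor}(X(m));\mathbf X\|_{p\text{-var};[0,T]}\to0$ such that the ordinary differential equations $dY(m)_t=\mathbf V(Y(m)_t)dX(m)_t$, $Y(m)_0=y_0$, have solutions $Y(m)$ converging to $Y$ uniformly on $[0,T]$. The equation $dY_t=Y_t(zM)(d\mathbf X_t)$ uses the vector field $\mathbf V_z(y)(x)=y\,(zM)(x)$. Other notation. $\mathfrak{so}(k)$: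 real antisymmetric $k\times k$ matrices; $O(k)$: orthogonal group; $\mathcal L(\cdot,\cdot)$: linear maps. $\mathrm{Ad}_yM(x)=yM(x)y^{-1}$ for $y\in\mathrm{GL}(k,\mathbb R)$, $x\in\mathbb R^d$. $M^{\otimes n}(z_1\otimes\dots\otimes z_n)=M(z_1)\cdots M(z_n)$, $M^{\otimes0}(1)=I_k$, $\widetilde M(x)=\sum_{n\ge0}M^{\otimes n}(x^n)$, and $\Phi_{\mathbf X_{[0,t]}}(M)=\widetilde M(S(\mathbf X)_{0,t})$. $\Delta^n_t=\{0\le s_1<\dots<s_n\le t\}$. Analyticity and holomorphy are entrywise. *)

(* Defs.v *)
From HB Require Import structures.
From mathcomp Require Import all_boot all_order all_algebra.
From mathcomp Require Import all_classical all_reals all_analysis.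
From mathcomp.real_closed Require Import complex.

Set Implicit Arguments.
Unset Strict Implicit.
Unset Printing Implicit Defensive.

Import Order.TTheory GRing.Theory Num.Theory.
Import numFieldNormedType.Exports.

Local Open Scope classical_set_scope.
Local Open Scope ring_scope.

Section TensorAlgebra.
Variables (R : realType) (d : nat).

(* Coordinates in the standard basis of R^d: the basis tensor                 *)
(* e_{i_1} (x) ... (x) e_{i_n} is indexed by the word i_1 ... i_n.            *)
Definition tensor (n : nat) := {ffun n.-tuple 'I_d -> R}.

(* T((V)): formal series over words of arbitrary length. *)
Definition tensor_series := seq 'I_d -> R.

(* T^N(V): one coordinate for each word of length at most N. *)
Definition trunc_tensor (N : nat) := {ffun N.-bseq 'I_d -> R}.

Definition level (n : nat) (x : tensor_series) : tensor n :=
  [ffun w : n.-tuple 'I_d => x w].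

(* The inclusion of T^N(V) in T((V)). *)
Definition series_of_trunc N (x : trunc_tensor N) : tensor_series :=
  fun w => if insub w is Some v then x v else 0.

Definition trunc_of_series N (x : tensor_series) : trunc_tensor N :=
  [ffun w : N.-bseq 'I_d => x w].

Definition tensor_mul (x y : tensor_series) : tensor_series :=
  fun w => \sum_(i < (size w).+1) x (take i w) * y (drop i w).

Definition trunc_mul N (x y : trunc_tensor N) : trunc_tensor N :=
  trunc_of_series N (tensor_mul (series_of_trunc x) (series_of_trunc y)).

Definition euclid_norm (v : 'rV[R]_d) : R :=
  Num.sqrt (\sum_(i < d) v ord0 i ^+ 2).

Definition pure_tensor n (v : 'I_n -> 'rV[R]_d) : tensor n :=
  [ffun w : n.-tuple 'I_d => \prod_(j < n) v j ord0 (tnth w j)].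

(* The projective norm for the Euclidean norm on R^d.  The scalars c only     *)
(* matter in level 0, where they make this the absolute value on R.           *)
Definition proj_norm n (x : tensor n) : R :=
  inf [set r | exists m (c : 'I_m -> R) (v : 'I_m -> 'I_n -> 'rV[R]_d),
    (forall w, x w = \sum_(l < m) c l * pure_tensor (v l) w) /\
    r = \sum_(l < m) `|c l| * \prod_(j < n) euclid_norm (v l j)].

End TensorAlgebra.

Section Integration.
Variable R : realType.

(* Riemann-Stieltjes integral of f against g on [a, b]: the limit of tagged   *)
(* sums as the mesh tends to 0.                                               *)
Definition is_RS_integral (f g : R -> R) (a b I : R) : Prop :=
  forall eps, 0 < eps -> exists2 delta, 0 < delta &
    forall s, itv_partition a b s ->
    forall xi : nat -> R,
    (forall i, (i < size s)%N ->
       [/\ nth b (a :: s) i <= xi i <= nth b (a :: s) i.+1 &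
           nth b (a :: s) i.+1 - nth b (a :: s) i < delta]) ->
    `|\sum_(0 <= i < size s)
        f (xi i) * (g (nth b (a :: s) i.+1) - g (nth b (a :: s) i)) - I| < eps.

(* Only used for continuous f and continuous g of bounded variation, where    *)
(* the integral exists.                                                       *)
Definition RS_integral (f g : R -> R) (a b : R) : R :=
  xget 0 [set I | is_RS_integral f g a b I].

Definition Gamma (x : R) : R :=
  \int[lebesgue_measure]_(t in `]0, +oo[) (t `^ (x - 1) * expR (- t)).

End Integration.

Section RoughPaths.
Variables (R : realType) (d : nat).

Definition simplex (T : R) : set (R * R) :=
  [set st | 0 <= st.1 <= st.2 /\ st.2 <= T].

Definition is_control (T : R) (w : R -> R -> R) : Prop :=
  [/\ {within simplex T, continuous (fun st : R * R => w st.1 st.2)},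
      forall s t, simplex T (s, t) -> 0 <= w s t,
      forall t, 0 <= t <= T -> w t t = 0 &
      forall s u t, 0 <= s <= u -> u <= t <= T -> w s u + w u t <= w s t].

Definition level_bound (p gamma T : R) (w : R -> R -> R)
    (X : R -> R -> tensor_series R d) (n : nat) : Prop :=
  forall s t, simplex T (s, t) ->
    (Gamma (n%:R / p + 1) * gamma * proj_norm (level n (X s t)))
      `^ (p / n%:R) <= w s t.

Definition is_rough_path (p gamma T : R)
    (X : R -> R -> trunc_tensor R d (Num.truncn p)) : Prop :=
  [/\ forall v, {within simplex T, continuous (fun st : R * R => X st.1 st.2 v)},
      forall s t, simplex T (s, t) -> X s t [bseq] = 1,
      forall s u t, 0 <= s <= u -> u <= t <= T ->
        trunc_mul (X s u) (X u t) = X s t &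
      exists2 w, is_control T w &
        forall n, (1 <= n <= Num.truncn p)%N ->
          level_bound p gamma T w (fun s t => series_of_trunc (X s t)) n].

(* The p-variation distance, valued in [0, +oo]. *)
Definition pvar_dist (p T : R)
    (X Y : R -> R -> trunc_tensor R d (Num.truncn p)) : \bar R :=
  ((\sum_(1 <= n < (Num.truncn p).+1)
    ereal_sup [set
      (\sum_(0 <= j < size s)
        proj_norm
          (level n (series_of_trunc
             (X (nth T (0%R :: s) j) (nth T (0%R :: s) j.+1))) -
           level n (series_of_trunc
             (Y (nth T (0%R :: s) j) (nth T (0%R :: s) j.+1))))
          `^ (p / n%:R))%R%:E | s in itv_partition 0%R T])
  `^ p^-1)%E.

(* S is the signature path S(X).  The control in the bound is existentially   *)
(* quantified, as in the definition of a rough path, so that neither notion   *)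
(* depends on the value of the constant gamma > 0.                            *)
Definition is_signature (p gamma T : R)
    (X : R -> R -> trunc_tensor R d (Num.truncn p))
    (S : R -> R -> tensor_series R d) : Prop :=
  [/\ forall s t, simplex T (s, t) -> S s t [::] = 1,
      forall s u t, 0 <= s <= u -> u <= t <= T ->
        tensor_mul (S s u) (S u t) = S s t,
      forall s t, simplex T (s, t) -> trunc_of_series _ (S s t) = X s t &
      exists2 w, is_control T w &
        forall n, (1 <= n)%N -> level_bound p gamma T w S n].

Definition continuous_BV (T : R) (x : R -> 'rV[R]_d) : Prop :=
  forall i, {within `[0, T], continuous (fun t => x t ord0 i)} /\
            bounded_variation 0 T (fun t => x t ord0 i).

(* The head of the word is the letter of the outermost (last) integration. *)
Fixpoint iterated_integral (x : R -> 'rV[R]_d) (s : R) (w : seq 'I_d) (t : R) : R :=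
  if w is i :: w' then
    RS_integral (iterated_integral x s w') (fun u => x u ord0 i) s t
  else 1.

Definition path_signature (x : R -> 'rV[R]_d) (s t : R) : tensor_series R d :=
  fun w => iterated_integral x s (rev w) t.

Definition trunc_signature N (x : R -> 'rV[R]_d) (s t : R) : trunc_tensor R d N :=
  trunc_of_series N (path_signature x s t).

Definition is_geometric_rough_path (p gamma T : R)
    (X : R -> R -> trunc_tensor R d (Num.truncn p)) : Prop :=
  is_rough_path gamma T X /\
  forall eps : R, 0 < eps -> exists2 x, continuous_BV T x &
    (pvar_dist T (trunc_signature _ x) X < eps%:E)%E.

End RoughPaths.

(* The state space E of a differential equation is a finite-dimensional real  *)
(* vector space presented by its real linear coordinates c : I -> E -> R.     *)
Section DifferentialEquations.
Variables (R : realType) (d : nat) (E : Type) (I : finType) (c : I -> E -> R).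

(* dY_t = V(Y_t) dx_t, Y_0 = y0, in integrated form; V(y) is linear in its    *)
(* second argument, so V(Y) dx = sum_j V(Y)(e_j) dx^j.                        *)
Definition ode_solution (T : R) (V : E -> 'rV[R]_d -> E) (y0 : E)
    (x : R -> 'rV[R]_d) (Y : R -> E) : Prop :=
  forall a : I,
    {within `[0, T], continuous (fun t => c a (Y t))} /\
    forall t, 0 <= t <= T ->
      c a (Y t) = c a y0 +
        \sum_(j < d) RS_integral (fun u => c a (V (Y u) (delta_mx ord0 j)))
                                 (fun u => x u ord0 j) 0 t.

Definition finite_pvar (p T : R) (Y : R -> E) : Prop :=
  forall a : I,
    {within `[0, T], continuous (fun t => c a (Y t))} /\
    has_ubound [set \sum_(0 <= j < size s)
        `|c a (Y (nth T (0 :: s) j.+1)) - c a (Y (nth T (0 :: s) j))| `^ p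
      | s in itv_partition 0 T].

Definition rde_solution (p T : R) (X : R -> R -> trunc_tensor R d (Num.truncn p))
    (V : E -> 'rV[R]_d -> E) (y0 : E) (Y : R -> E) : Prop :=
  finite_pvar p T Y /\
  exists (x : nat -> R -> 'rV[R]_d) (Ym : nat -> R -> E),
    [/\ forall m, continuous_BV T (x m),
        pvar_dist T (trunc_signature _ (x m)) X @[m --> \oo] --> 0%E,
        forall m, ode_solution T V y0 (x m) (Ym m) &
        forall a : I, {uniform `[0, T],
          (fun m t => c a (Ym m t)) @ \oo --> (fun t => c a (Y t))}].

End DifferentialEquations.

Definition mx_coord (R : realType) (k : nat) (a : 'I_k * 'I_k)
    (A : 'M[R]_k) : R := A a.1 a.2.

Definition Cplx (R : realType) : numClosedFieldType := R[i].

Definition to_Cplx (R : realType) : {rmorphism R -> Cplx R} := real_complex R.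

(* Real and imaginary parts of the entries. *)
Definition cmx_coord (R : realType) (k : nat) (a : bool * ('I_k * 'I_k))
    (A : 'M[Cplx R]_k) : R :=
  let z : R[i] := A a.2.1 a.2.2 in
  if a.1 then complex.Re z else complex.Im z.

Definition mxfam_coord (R : realType) (n k : nat) (a : 'I_n * ('I_k * 'I_k))
    (A : 'I_n -> 'M[R]_k) : R := A a.1 a.2.1 a.2.2.

Section MatrixDevelopment.
Variables (R : realType) (d k : nat).

Section Tilde.
(* K is R or the complex numbers, and iota the embedding of R in K. *)
Variables (K : numFieldType) (iota : {rmorphism R -> K}).

Definition linear_field (M : 'rV[R]_d -> 'M[K]_k)
    (y : 'M[K]_k) (x : 'rV[R]_d) : 'M[K]_k := y *m M x.

(* The linear map z_1 (x) ... (x) z_n |-> M(z_1) ... M(z_n), in coordinates. *)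
Definition mx_tensor (M : 'rV[R]_d -> 'M[K]_k) (n : nat) (x : tensor R d n) : 'M[K]_k :=
  \sum_(w : n.-tuple 'I_d)
    iota (x w) *: \big[mulmx/1%:M]_(j < n) M (delta_mx ord0 (tnth w j)).

Definition mx_tilde_series (M : 'rV[R]_d -> 'M[K]_k) (x : tensor_series R d) :=
  series (fun n => mx_tensor M (level n x)).

Definition mx_tilde (M : 'rV[R]_d -> 'M[K]_k) (x : tensor_series R d) : 'M[K]_k :=
  limn (mx_tilde_series M x).

End Tilde.

(* Phi_{X_[0,t]}(M), for S the signature path of X. *)
Definition Phi (S : R -> R -> tensor_series R d) (t : R)
    (M : 'rV[R]_d -> 'M[R]_k) : 'M[R]_k :=
  mx_tilde idfun M (S 0 t).

Definition Ad (y : 'M[R]_k) (M : 'rV[R]_d -> 'M[R]_k) (x : 'rV[R]_d) : 'M[R]_k :=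
  y *m M x *m invmx y.

(* Component 0 is y^0 and component j > 0 is z^j.  The component y^0 solves   *)
(* a linear equation started at the identity, so it stays invertible and the  *)
(* default value of invmx plays no role.                                      *)
Definition coupled_field (n : nat) (lambda : R) (M : 'rV[R]_d -> 'M[R]_k)
    (y : 'I_n.+1 -> 'M[R]_k) (x : 'rV[R]_d) : 'I_n.+1 -> 'M[R]_k :=
  fun j => match val j with
  | 0%N => lambda *: (y ord0 *m M x)
  | 1%N => Ad (y ord0) M x
  | j'.+1 => j'.+1%:R *: (y (inord j') *m Ad (y ord0) M x)
  end.

Definition coupled_init (n : nat) : 'I_n.+1 -> 'M[R]_k :=
  fun j => if j == ord0 then 1%:M else 0.

End MatrixDevelopment.

Definition real_analytic (R : realType) (f : R -> R) : Prop :=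
  forall x0, exists a : nat -> R, exists2 r, 0 < r &
    forall x, `|x - x0| < r ->
      series (fun n => a n * (x - x0) ^+ n) @ \oo --> f x.

Definition holomorphic (R : realType) (f : Cplx R -> Cplx R) : Prop :=
  forall z, derivable (f : (Cplx R)^o -> (Cplx R)^o) z 1.

(* Main.v *)
Require Import Defs.
From HB Require Import structures.
From mathcomp Require Import all_boot all_order all_algebra.
From mathcomp Require Import all_classical all_reals all_analysis.
From mathcomp.real_closed Require Import complex.
From mathcomp Require Import measurable_realfun ring lra.

(* Both sides of the theorem are compared with the series of words            *)
(* sum_n A(S(X)^n_{0,t}) y_0.  For a driver x of bounded variation, the       *)
(* solution of dy = A(y) dx moves over [s, t] like the first floor(p) levels  *)
(* of the signature of x, up to a power theta > 1 of a control: by Chen's     *)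
(* relation the error is almost additive, and repeated halving of the control *)
(* (sewing) makes the constant depend on x only through its p-variation       *)
(* distance to X.  The word series of S(X) is multiplicative and converges by *)
(* the factorial decay, so the solutions converge to it uniformly.            *)
(*                                                                            *)
(* Orthogonality passes to the limit from the approximating equations.  The   *)
(* coefficients M^(n)(S(X)^n_{0,t}) decay faster than any geometric sequence, *)
(* whence the analyticity and the complex extension.  For the derivatives,    *)
(* U_0 = y^0 and U_j = z^j y^0 turn the coupled system into the linear one    *)
(* dU_j = (lambda U_j + j U_{j-1}) M(dX), whose word series is the j-th       *)
(* derivative in lambda of the series of Y^lambda.                            *)

Set Implicit Arguments.
Unset Strict Implicit.
Unset Printing Implicit Defensive.

Import Order.TTheory GRing.Theory Num.Theory.
Import numFieldNormedType.Exports.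

Local Open Scope classical_set_scope.
Local Open Scope ring_scope.

(** * Left-endpoint germs and Riemann-Stieltjes integrals *)

(** Let [dy = A(y) dx] be a linear equation. For a driver of bounded variation, its flow over [s, t]
    sends y to the sum over all words w of the coefficient of w in the signature times A_(w_n) ...
    A_(w_1) y. The same series makes sense for the signature [S] of the rough path: level n is at
    most a control to the power n/p divided by (n/p)!, and the Gamma function beats every geometric
    sequence ([inv_Gamma_small], [sigact_decay]). By Chen's relation its sum [sigop] is a flow
    ([sigop_chen]). The central fact is [rough_convergence]: solutions driven by bounded variation
    paths close to X in p-variation are uniformly close to [sigop A (S 0 t) y0]. Since a solution of
    a rough equation is a limit of such solutions, this gives existence and uniqueness at once
    ([rde_linear_exists], [rde_linear_limit]).

    The estimate must not depend on the total variation of the driver, which may blow up. For N the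
    integer part of p, let R(s, t) be the error made when y_t is replaced by the action on y_s of
    the levels 0, ..., N of the signature of x. Truncation spoils multiplicativity only by a control
    to the power theta = (N + 1)/p > 1, so R is almost additive, and bisection gains a factor of
    about 2 * 2^(-theta) < 1 at each scale ([sewing]). Bounded variation serves only to know
    beforehand that R is at most some constant times that power ([bv_remainder]); this constant
    disappears. [local_remainder] and [rough_apriori_bound] are the resulting uniform bounds, and
    the local errors are then carried to time t by the flow of [S] and added.

    For [dY = Y (lambda M)(dX)] the word series is a power series in lambda with entire
    coefficients. It can be recentred ([entire_real_analytic]), differentiated termwise
    ([derive1n_entire]) and evaluated at complex z, a complex matrix being a real state of double
    size. For bounded variation drivers P P^T has differential 0, so the flow is orthogonal, and
    this passes to the limit. The coupled system is nonlinear, but on orthogonal y^0 the maps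
    [couple] and [uncouple] exchange it with a linear system, to which the theory above applies. The
    words of that system carry the derivatives of lambda^q ([foldl_derivative_field]), which
    identifies its component j with the j-th derivative of Y. *)

Section Increments.
Variable R : realType.
Implicit Types (a b e s t : R) (f g h v : R -> R) (mu nu : R -> R -> R).

(** Uniform continuity replaces continuity for the subspace topology: it restricts freely to
    subintervals and gives one mesh for all partitions. *)
Definition ucont a b f := forall e, 0 < e -> exists2 dl : R, 0 < dl &
  forall s t, a <= s <= b -> a <= t <= b -> `|s - t| < dl -> `|f s - f t| < e.

(** With [v] a total variation function this is how bounded variation enters; a single [v] serves
    all coordinates of a path. *)
Definition dominated a b v g := forall s t, a <= s -> s <= t -> t <= b ->
  `|g t - g s| <= v t - v s.

(* For continuous f, the integral of f against g is the function with germ    *)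
(* f(s) (g(t) - g(s)), and a function is determined by its germ up to a       *)
(* constant.                                                                  *)
Definition tangent a b v f mu := forall e, 0 < e ->
  exists2 dl : R, 0 < dl & forall s t, a <= s -> s <= t -> t <= b -> t - s < dl ->
    `|f t - f s - mu s t| <= e * (v t - v s).

Lemma within_continuous_near (A : set R) f x : A x ->
  {within A, continuous f} -> forall e, 0 < e ->
  exists2 dl : R, 0 < dl & forall u, A u -> `|x - u| < dl -> `|f x - f u| < e.
Proof.
move=> Ax /subspace_continuousP/(_ x Ax) cf e e0.
have [dl /= dl0 H] := cf _ (nbhsx_ballx (f x) e e0).
by exists dl => // u Au xu; exact: (H u xu Au).
Qed.

Lemma within_ucont a b f : {within `[a, b], continuous f} -> ucont a b f.
Proof.
move=> cf e e0.
pose P (dl x : R) := a <= x <= b ->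
  forall u, a <= u <= b -> `|x - u| < dl -> `|f x - f u| < e.
have e20 : 0 < e / 2 by rewrite divr_gt0.
(* Heine's theorem: the covering form of compactness, along the filter of small positive reals,
   yields one [dl] for all points. *)
have /compact_near_coveringP/(_ R (0^'+) P) := @segment_compact R a b.
case=> [x /=|dl /= dl0 H].
  rewrite in_itv/= => xab.
  have [dl dl0 H] := @within_continuous_near `[a, b] f x xab cf _ e20.
  exists (ball x (dl / 2), [set t | 0 < t < dl / 2]) => /=.
    split; first by apply: nbhsx_ballx; rewrite divr_gt0.
    exists (dl / 2); first by rewrite /= divr_gt0.
    by move=> t /= + t0; rewrite sub0r normrN gtr0_norm // => ->; rewrite t0.
  move=> [x' t] /= [xx' /andP[t0 tdl]] x'ab u uab x'u.
  rewrite -ball_normE /= in xx'.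
  have h1 : `|f x - f x'| < e / 2.
    by apply: H; rewrite /= ?in_itv //=; lra.
  have h2 : `|f x - f u| < e / 2.
    apply: H; rewrite /= ?in_itv //=.
    have := ler_normD (x - x') (x' - u); rewrite addrA subrK; lra.
  have := ler_normD (f x' - f x) (f x - f u); rewrite addrA subrK (distrC (f x') (f x)); lra.
exists (dl / 2); first by rewrite divr_gt0.
move=> s t sab tab st.
have := H (dl / 2); rewrite /= sub0r normrN gtr0_norm ?divr_gt0 //.
have -> : dl / 2 < dl by lra.
by move=> /(_ isT isT s); rewrite /= in_itv /=; apply.
Qed.

Lemma ucont_within a b f : ucont a b f -> {within `[a, b], continuous f}.
Proof.
move=> uf; apply/subspace_continuousP => x /=; rewrite in_itv /= => xab.
apply/cvgrPdist_lt => e e0; have [dl dl0 H] := uf e e0.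
exists dl => //= u xu; rewrite in_itv /= => uab; exact: H.
Qed.

Lemma ucont_cst a b (c : R) : ucont a b (cst c).
Proof. by move=> e e0; exists 1 => // s t _ _ _; rewrite subrr normr0. Qed.

Lemma ucontW a b a' b' f : a <= a' -> b' <= b -> ucont a b f -> ucont a' b' f.
Proof.
move=> aa bb uf e /uf [dl dl0 H]; exists dl => // s t sab tab; apply: H; lra.
Qed.

Lemma ucont_bounded a b f : ucont a b f -> exists2 C : R, 0 <= C &
  forall t, a <= t <= b -> `|f t| <= C.
Proof.
move=> uf.
have [|ab] := leP a b; last by exists 0 => // t; lra.
move=> ab; have := continuous_compact (ucont_within uf) (@segment_compact R a b).
move=> /compact_bounded [M [Mr /(_ (`|M| + 1))]] H.
exists (`|M| + 1) => [|t tab]; first by rewrite addr_ge0.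
apply: H; first by have := ler_norm M; lra.
by exists t => //; rewrite /= in_itv.
Qed.

Lemma ucontD a b f g : ucont a b f -> ucont a b g -> ucont a b (fun t => f t + g t).
Proof.
move=> uf ug e e0; have e20 : 0 < e / 2 by rewrite divr_gt0.
have [d1 d10 H1] := uf _ e20; have [d2 d20 H2] := ug _ e20.
exists (Num.min d1 d2) => [|s t sab tab]; first by rewrite lt_min d10.
rewrite lt_min => /andP[/H1-/(_ sab tab) h1 /H2-/(_ sab tab) h2].
have := ler_normD (f s - f t) (g s - g t); rewrite (_ : f s - f t + _ = f s + g s - (f t + g t)); first lra.
ring.
Qed.

Lemma ucontM a b f g : ucont a b f -> ucont a b g -> ucont a b (fun t => f t * g t).
Proof.
move=> uf ug e e0.
have [C C0 HC] := ucont_bounded uf; have [D D0 HD] := ucont_bounded ug.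
have e20 : 0 < e / (C + D + 1) by rewrite divr_gt0 //; lra.
have [d1 d10 H1] := uf _ e20; have [d2 d20 H2] := ug _ e20.
exists (Num.min d1 d2) => [|s t sab tab]; first by rewrite lt_min d10.
rewrite lt_min => /andP[/H1-/(_ sab tab) h1 /H2-/(_ sab tab) h2].
rewrite (_ : _ - _ = (f s - f t) * g t + f s * (g s - g t)); last by ring.
apply: (le_lt_trans (ler_normD _ _)); rewrite !normrM.
have k1 := HC s sab; have k2 := HD t tab.
have : `|f s - f t| * `|g t| + `|f s| * `|g s - g t| <= e / (C + D + 1) * (D + C).
  rewrite mulrDr lerD //; first by rewrite ler_pM // ltW.
  by rewrite mulrC ler_pM // ltW.
move=> /le_lt_trans; apply.
rewrite mulrAC -mulrA -ltr_pdivlMl // mulVf ?gt_eqF // ltr_pdivrMr; lra.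
Qed.

Lemma ucont_sum a b (I : Type) (r : seq I) (P : pred I) (F : I -> R -> R) :
  (forall i, ucont a b (F i)) -> ucont a b (fun t => \sum_(i <- r | P i) F i t).
Proof.
move=> H; elim: r => [|i r IH].
  by move=> e e0; exists 1 => // s t _ _ _; rewrite !big_nil subrr normr0.
have [Pi|Pi] := boolP (P i).
  by under eq_fun do rewrite big_cons Pi; exact: ucontD.
by under eq_fun do rewrite big_cons (negbTE Pi).
Qed.

Lemma ucontZ a b (c : R) f : ucont a b f -> ucont a b (fun t => c * f t).
Proof. by apply: ucontM; exact: ucont_cst. Qed.

Lemma dominated_mono a b v g s t : dominated a b v g -> a <= s -> s <= t -> t <= b ->
  v s <= v t.
Proof. by move=> dg sa st tb; rewrite -subr_ge0 (le_trans _ (dg _ _ sa st tb)). Qed.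

Lemma dominatedW a b a' b' v g : a <= a' -> b' <= b -> dominated a b v g ->
  dominated a' b' v g.
Proof. by move=> aa bb dg s t s1 st t1; apply: dg; lra. Qed.

Lemma dominated_ucont a b v g : ucont a b v -> dominated a b v g -> ucont a b g.
Proof.
move=> uv dg e e0; have [dl dl0 H] := uv e e0; exists dl => // s t sab tab st.
have := H _ _ sab tab st; have [lst|/ltW lst] := leP s t.
  by rewrite distrC (distrC (g s)); apply: le_lt_trans;
     apply: le_trans (ler_norm _); apply: dg; lra.
by apply: le_lt_trans; apply: le_trans (ler_norm _); apply: dg; lra.
Qed.

(** A chain of steps of length [dl / 2] adds up the local estimates while the increments of [v]
    telescope; then [e] tends to 0. This mean value principle underlies all bounds and uniqueness
    statements for germs. *)
Lemma local_to_global a b v h (G : R) : a <= b ->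
  (forall s t, a <= s -> s <= t -> t <= b -> v s <= v t) ->
  (forall e, 0 < e -> exists2 dl : R, 0 < dl &
    forall s t, a <= s -> s <= t -> t <= b -> t - s < dl ->
    `|h t - h s| <= (G + e) * (v t - v s)) ->
  `|h b - h a| <= G * (v b - v a).
Proof.
move=> ab vm H; apply/ler_addgt0Pr => e e0.
have e10 : 0 < e / (v b - v a + 1).
  by rewrite divr_gt0 //; have := vm a b (lexx _) ab (lexx _); lra.
have [dl dl0 Hd] := H _ e10.
set G' := G + _ in Hd.
have main n : forall t, a <= t -> t <= b -> t - a <= n%:R * (dl / 2) ->
    `|h t - h a| <= G' * (v t - v a).
  elim: n => [|n IH] t at1 tb tn.
    rewrite mul0r in tn; have -> : t = a by lra.
    by rewrite !subrr normr0 mulr0.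
  have [small|big] := ltP (t - a) dl; first exact: Hd.
  have := IH (t - dl / 2); have := Hd (t - dl / 2) t.
  rewrite -[n.+1]addn1 natrD in tn.
  have -> : t - (t - dl / 2) < dl by lra.
  move=> h1 h2.
  have {}h1 : `|h t - h (t - dl / 2)| <= G' * (v t - v (t - dl / 2)).
    by apply: h1 => //; lra.
  have {}h2 : `|h (t - dl / 2) - h a| <= G' * (v (t - dl / 2) - v a).
    by apply: h2; lra.
  have := ler_normD (h t - h (t - dl / 2)) (h (t - dl / 2) - h a).
  rewrite addrA subrK; move: h1 h2; rewrite !mulrBr; lra.
have [n nP] : exists n, b - a <= n%:R * (dl / 2).
  exists (Num.truncn ((b - a) / (dl / 2))).+1.
  rewrite -ler_pdivrMr ?divr_gt0 //.
  by apply: ltW; apply: truncnS_gt.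
apply: (le_trans (main n b ab (lexx _) nP)).
rewrite /G' mulrDl lerD2l mulrAC -mulrA -ler_pdivlMl // mulVf ?gt_eqF //.
by rewrite ler_pdivrMr; have := vm a b (lexx _) ab (lexx _); lra.
Qed.

End Increments.

Section Tangent.
Variable R : realType.
Implicit Types (a b c e s t : R) (f g h v : R -> R) (mu nu : R -> R -> R).

Lemma telescope_nat (w : nat -> R) n :
  \sum_(0 <= i < n) (w i.+1 - w i) = w n - w 0.
Proof. by rewrite telescope_sumr. Qed.

Lemma tangentW a b a' b' v f mu : a <= a' -> b' <= b ->
  tangent a b v f mu -> tangent a' b' v f mu.
Proof.
move=> aa bb H e /H [dl dl0 K]; exists dl => // s t s1 st t1; apply: K => //; lra.
Qed.

Lemma tangent_le a b v f mu (C : R) : a <= b -> 0 <= C ->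
  (forall s t, a <= s -> s <= t -> t <= b -> v s <= v t) ->
  tangent a b v f mu ->
  (forall s t, a <= s -> s <= t -> t <= b -> `|mu s t| <= C * (v t - v s)) ->
  forall s t, a <= s -> s <= t -> t <= b -> `|f t - f s| <= C * (v t - v s).
Proof.
move=> ab C0 vm tf mC s t s1 st t1; apply: local_to_global => //.
  by move=> ? ? ? ? ?; apply: vm; lra.
move=> e /tf [dl dl0 H]; exists dl => // x y sx xy yt xyd.
have := H x y ltac:(lra) xy ltac:(lra) xyd; have := mC x y ltac:(lra) xy ltac:(lra).
have := ler_normD (f y - f x - mu x y) (mu x y); rewrite subrK mulrDl; lra.
Qed.

(** The difference of the two functions has germ 0, so [local_to_global] with constant 0 makes it
    constant. *)
Lemma tangent_eq a b v f g mu : a <= b ->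
  (forall s t, a <= s -> s <= t -> t <= b -> v s <= v t) ->
  tangent a b v f mu -> tangent a b v g mu -> f a = g a ->
  forall t, a <= t <= b -> f t = g t.
Proof.
move=> ab vm tf tg fga t /andP[at1 tb].
have : `|(f t - g t) - (f a - g a)| <= 0 * (v t - v a).
  apply: (@local_to_global R a t v (fun t => f t - g t)) => //.
    by move=> ? ? ? ? ?; apply: vm; lra.
  move=> e e0; have e20 : 0 < e / 2 by rewrite divr_gt0.
  have [d1 d10 H1] := tf _ e20; have [d2 d20 H2] := tg _ e20.
  exists (Num.min d1 d2) => [|x y sx xy yt]; first by rewrite lt_min d10.
  rewrite lt_min => /andP[/H1-/(_ sx xy) h1 /H2-/(_ sx xy) h2].
  have := h1 ltac:(lra); have := h2 ltac:(lra).
  have := ler_normB (f y - f x - mu x y) (g y - g x - mu x y).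
  rewrite [X in `|X| <= _](_ : _ = f y - g y - (f x - g x)); last by ring.
  lra.
rewrite fga subrr subr0 mul0r normr_le0 subr_eq0 => /eqP //.
Qed.

Lemma tangentD a b v f g mu nu : tangent a b v f mu -> tangent a b v g nu ->
  tangent a b v (fun t => f t + g t) (fun s t => mu s t + nu s t).
Proof.
move=> tf tg e e0; have e20 : 0 < e / 2 by rewrite divr_gt0.
have [d1 d10 H1] := tf _ e20; have [d2 d20 H2] := tg _ e20.
exists (Num.min d1 d2) => [|x y sx xy yt]; first by rewrite lt_min d10.
rewrite lt_min => /andP[/H1-/(_ sx xy yt) h1 /H2-/(_ sx xy yt) h2].
have := ler_normD (f y - f x - mu x y) (g y - g x - nu x y).
rewrite [X in `|X| <= _](_ : _ = f y + g y - (f x + g x) - (mu x y + nu x y)); last by ring.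
lra.
Qed.

Lemma tangentZ a b v c f mu : tangent a b v f mu ->
  tangent a b v (fun t => c * f t) (fun s t => c * mu s t).
Proof.
move=> tf e e0; have e20 : 0 < e / (`|c| + 1) by rewrite divr_gt0 // ltr_wpDl.
have [dl dl0 H] := tf _ e20; exists dl => // x y sx xy yt xyd.
rewrite -!mulrBr normrM.
have h := H x y sx xy yt xyd.
apply: (@le_trans _ _ ((`|c| + 1) * `|f y - f x - mu x y|)).
  by apply: ler_wpM2r => //; lra.
apply: (le_trans (ler_wpM2l _ h)); first by rewrite addr_ge0.
by rewrite mulrA [_ * (e / _)]mulrC divfK // gt_eqF // ltr_wpDl.
Qed.

Lemma tangent_cst a b v c : (forall s t, a <= s -> s <= t -> t <= b -> v s <= v t) ->
  tangent a b v (cst c) (fun _ _ => 0).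
Proof.
move=> vm e e0; exists 1 => // s t s1 st t1 _; rewrite /= !subrr normr0.
by apply: mulr_ge0; [exact: ltW|rewrite subr_ge0 vm].
Qed.

Lemma tangent_sum a b v (I : Type) (r : seq I) (F : I -> R -> R) (mu : I -> R -> R -> R) :
  (forall s t, a <= s -> s <= t -> t <= b -> v s <= v t) ->
  (forall i, tangent a b v (F i) (mu i)) ->
  tangent a b v (fun t => \sum_(i <- r) F i t) (fun s t => \sum_(i <- r) mu i s t).
Proof.
move=> vm H; elim: r => [|i r IH].
  move=> e /(tangent_cst 0 vm) [dl dl0 K]; exists dl => // s t s1 st t1 std.
  by have := K s t s1 st t1 std; rewrite !big_nil.
move=> e /(tangentD (H i) IH) [dl dl0 K]; exists dl => // s t s1 st t1 std.
by have := K s t s1 st t1 std; rewrite !big_cons.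
Qed.

Lemma eq_tangent a b v f mu nu :
  (forall s t, a <= s -> s <= t -> t <= b -> mu s t = nu s t) ->
  tangent a b v f mu -> tangent a b v f nu.
Proof.
move=> E H e /H [dl dl0 K]; exists dl => // s t s1 st t1 std.
by rewrite -E //; exact: K.
Qed.

(** Leibniz rule. The cross term [(f y - f x) * (g y - g x)] is negligible against [v]: one factor
    is uniformly small, the other is at most [D] times the increment of [v]. *)
Lemma tangentM a b v f g mu nu (C D : R) : a <= b -> 0 <= C -> 0 <= D ->
  (forall s t, a <= s -> s <= t -> t <= b -> v s <= v t) -> ucont a b v ->
  (forall s t, a <= s -> s <= t -> t <= b -> `|mu s t| <= C * (v t - v s)) ->
  (forall s t, a <= s -> s <= t -> t <= b -> `|nu s t| <= D * (v t - v s)) ->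
  tangent a b v f mu -> tangent a b v g nu ->
  tangent a b v (fun t => f t * g t) (fun s t => mu s t * g s + f s * nu s t).
Proof.
move=> ab C0 D0 vm uv mC nD tf tg.
have fC := tangent_le ab C0 vm tf mC; have gD := tangent_le ab D0 vm tg nD.
have df : dominated a b (fun t => C * v t) f.
  by move=> s t s1 st t1; rewrite -mulrBr; exact: fC.
have dg : dominated a b (fun t => D * v t) g.
  by move=> s t s1 st t1; rewrite -mulrBr; exact: gD.
have [F F0 HF] := ucont_bounded (dominated_ucont (ucontZ C uv) df).
have [G G0 HG] := ucont_bounded (dominated_ucont (ucontZ D uv) dg).
move=> e e0; set K := F + G + D + 1.
have K0 : 0 < K by rewrite /K; lra.
have eK : 0 < e / K by rewrite divr_gt0.
have [d1 d10 H1] := tf _ eK; have [d2 d20 H2] := tg _ eK.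
have [d3 d30 H3] := dominated_ucont (ucontZ C uv) df eK.
exists (Num.min d1 (Num.min d2 d3)) => [|x y ax xy yb].
  by rewrite !lt_min d10 d20.
rewrite !lt_min => /and3P[/H1-/(_ ax xy yb) h1 /H2-/(_ ax xy yb) h2 d3xy].
have h3 : `|f y - f x| < e / K.
  by apply: H3; try lra; rewrite ger0_norm //; lra.
have hF := HF x ltac:(lra); have hG := HG x ltac:(lra); have hD := gD x y ax xy yb.
have V0 : 0 <= v y - v x by rewrite subr_ge0 vm.
rewrite [X in `|X| <= _](_ : _ = (f y - f x - mu x y) * g x + f x * (g y - g x - nu x y)
  + (f y - f x) * (g y - g x)); last by ring.
apply: (le_trans (ler_normD _ _)); apply: (le_trans (lerD (ler_normD _ _) (lexx _))).
rewrite !normrM.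
have k1 : `|f y - f x - mu x y| * `|g x| <= e / K * (v y - v x) * G by rewrite ler_pM.
have k2 : `|f x| * `|g y - g x - nu x y| <= F * (e / K * (v y - v x)) by rewrite ler_pM.
have k3 : `|f y - f x| * `|g y - g x| <= e / K * (v y - v x) * D.
  by rewrite -mulrA (mulrC _ D) ler_pM // ltW.
have k4 : 0 <= e / K * (v y - v x) by apply: mulr_ge0 => //; exact: ltW.
have -> : e * (v y - v x) = e / K * (v y - v x) * K.
  by rewrite mulrAC divfK // gt_eqF.
set q := e / K * (v y - v x) in k1 k2 k3 k4 *; rewrite {1}/K.
have := mulr_ge0 k4 F0; lra.
Qed.

End Tangent.

Section RiemannStieltjes.
Variable R : realType.
Implicit Types (a b c e s t : R) (f g h v F : R -> R).

(** Compactness of [[- C, C]]. One ultrafilter serves all times at once, so the limits keep every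
    relation between values at different times. *)
Lemma ultra_bounded_cvg (U : set_system nat) (u : nat -> R) (C : R) :
  UltraFilter U -> (forall n, `|u n| <= C) -> exists l : R, u @ U --> l.
Proof.
move=> UU uC; have PU : ProperFilter U by exact: ultra_proper.
have FU : ProperFilter (u @ U) by apply: fmap_proper_filter.
have [|l [_ lP]] := @segment_compact R (- C) C (u @ U) FU.
  by rewrite /fmap /=; apply: filterE => n /=; rewrite in_itv /= -ler_norml.
exists l => V Vl; have [//|UV] := in_ultra_setVsetC (u @^-1` V) UU.
by have [x []] := lP (~` V) V UV Vl.
Qed.

Lemma step_sum_le a b v g (c k : nat -> R) n (K : R) : dominated a b v g ->
  (forall i, a <= c i <= b) -> (forall i, c i <= c i.+1) ->
  (forall i, (i < n)%N -> c i < c i.+1 -> `|k i| <= K) ->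
  `|\sum_(0 <= i < n) k i * (g (c i.+1) - g (c i))| <= K * (v (c n) - v (c 0)).
Proof.
move=> dg cab cm kK.
rewrite -(@telescope_nat _ (fun i => v (c i))) mulr_sumr.
apply: (le_trans (ler_norm_sum _ _ _)); rewrite big_nat [leRHS]big_nat.
apply: ler_sum => i /= ni; rewrite normrM.
have := cab i; have := cab i.+1 => c1 c0.
have := cm i; rewrite le_eqVlt => /orP[/eqP <-|cc].
  by rewrite !subrr normr0 !mulr0.
by apply: ler_pM => //; [exact: kK|apply: dg; lra].
Qed.

(* Left-endpoint sums on uniform grids, integrated up to t, are additive in t  *)
(* by construction; a pointwise limit along an ultrafilter keeps additivity    *)
(* and the local estimate, so no comparison of two partitions is needed.       *)
Lemma tangent_primitive a b v f g : a <= b -> ucont a b f -> dominated a b v g ->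
  exists F, tangent a b v F (fun s t => f s * (g t - g s)).
Proof.
move=> ab uf dg.
pose h n : R := (b - a) / n.+1%:R.
pose tau n i : R := a + i%:R * h n.
have h0 n : 0 <= h n by apply: divr_ge0 => //; lra.
have tau_mono n i : tau n i <= tau n i.+1.
  by rewrite lerD2l ler_wpM2r // ler_nat.
have taua n i : a <= tau n i by rewrite lerDl mulr_ge0.
have tau_S n i : tau n i.+1 = tau n i + h n.
  by rewrite /tau -[i.+1]addn1 natrD mulrDl mul1r addrA.
have taub n i : (i <= n.+1)%N -> tau n i <= b.
  move=> ni; rewrite -lerBrDl /h mulrA ler_pdivrMr // mulrC.
  by apply: ler_wpM2l; [lra|rewrite ler_nat].
have taubE n : tau n n.+1 = b.
  by rewrite /tau /h mulrA mulrAC divff ?pnatr_eq0 // mul1r addrC subrK.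
pose I n t := \sum_(0 <= i < n.+1)
  f (tau n i) * (g (Num.min t (tau n i.+1)) - g (Num.min t (tau n i))).
have [M M0 HM] := ucont_bounded uf.
have Ib n t : a <= t <= b -> `|I n t| <= M * (v b - v a).
  move=> /andP[at1 tb].
  apply: (@le_trans _ _ (M * (v (Num.min t (tau n n.+1)) - v (Num.min t (tau n 0))))).
    apply: (step_sum_le (c := fun i => Num.min t (tau n i)) dg).
    - by move=> i; rewrite le_min at1 taua ge_min tb.
    - by move=> i; rewrite le_min ge_min lexx /= ge_min tau_mono orbT.
    - by move=> i ni _; apply: HM; rewrite taua taub // ltnW.
  have -> : tau n 0 = a by rewrite /tau mul0r addr0.
  rewrite taubE (min_idPl tb) (min_idPr at1); apply: ler_wpM2l => //.
  by rewrite lerD2r (dominated_mono dg).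
have [U [UU sU]] := @ultraFilterLemma nat \oo _.
have PU : ProperFilter U by exact: ultra_proper.
pose F t : R := lim ((fun n => I n t) @ U).
have FP t : a <= t <= b -> (fun n => I n t) @ U --> F t.
  move=> tab; have [l /cvgP //] := ultra_bounded_cvg UU (fun n => Ib n t tab).
exists F => e e0; have [dl dl0 Hd] := uf e e0.
exists (dl / 2) => [|s t s1 st t1 std]; first by rewrite divr_gt0.
have hsmall : \forall n \near U, h n < dl / 2.
  apply: sU; exists (Num.truncn ((b - a) / (dl / 2))).+1 => // n /= nn.
  rewrite /h ltr_pdivrMr // mulrC -ltr_pdivrMr ?divr_gt0 //.
  apply: (lt_le_trans (truncnS_gt _)); rewrite ler_nat; exact: (leq_trans nn).
have cF : (fun n => `|I n t - I n s - f s * (g t - g s)|) @ U -->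
    `|F t - F s - f s * (g t - g s)|.
  apply: cvg_norm; apply: cvgB; last exact: cvg_cst.
  by apply: cvgB; apply: FP; lra.
apply: (cvgr_to_le cF); near=> n.
have hn : h n < dl / 2 by near: n.
(* The grid clipped to [[s, t]]: [I n t - I n s] becomes a sum over the clipped cells. *)
pose c i := Num.max s (Num.min t (tau n i)).
have cab i : a <= c i <= b.
  by rewrite /c le_max s1 ge_max ge_min t1 (le_trans st t1).
have cm i : c i <= c i.+1.
  rewrite /c ge_max !le_max lexx /=; apply/orP; right.
  by rewrite le_min !ge_min lexx tau_mono orbT.
have clip x : g (Num.min t x) - g (Num.min s x) = g (Num.max s (Num.min t x)) - g s.
  have [xs|] := boolP (x <= s).
    rewrite (min_idPr xs) (min_idPr (le_trans xs st)) (max_idPl xs); ring.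
  rewrite -ltNge => xs; rewrite (min_idPl (ltW xs)) (max_idPr _) //.
  by rewrite le_min st ltW.
have c0 : c 0 = s.
  rewrite /c /tau mul0r addr0 (min_idPr _); last lra.
  by rewrite (max_idPl _).
have cn : c n.+1 = t.
  by rewrite /c taubE (min_idPl t1) (max_idPr st).
rewrite (_ : _ - _ = \sum_(0 <= i < n.+1)
  (f (tau n i) - f s) * (g (c i.+1) - g (c i))); last first.
  rewrite /I -sumrB; under [RHS]eq_bigr do rewrite mulrBl.
  rewrite [RHS]sumrB -(mulr_sumr _ _ _ (f s)) (@telescope_nat _ (fun i => g (c i))) c0 cn.
  congr (_ - _); apply: eq_bigr => i _; rewrite -mulrBr; congr (_ * _).
  have := clip (tau n i.+1); have := clip (tau n i); rewrite -/(c i) -/(c i.+1).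
  lra.
rewrite -{2}c0 -{1}cn; apply: (step_sum_le dg) => // i ni ci.
apply: ltW; apply: Hd; first by rewrite taua taub // ltnW.
  lra.
(* A cell that survives the clipping meets [[s, t]], so its left end, even if it lies before [s], is
   within [dl] of [s]. *)
have tit : tau n i < t.
  rewrite ltNge; apply/negP => H; move: ci; rewrite /c (min_idPl H).
  by rewrite (min_idPl (le_trans H (tau_mono n i))) ltxx.
have sti : s < tau n i.+1.
  rewrite ltNge; apply/negP => H; move: ci; rewrite /c.
  have H' := le_trans (tau_mono n i) H.
  rewrite (min_idPr (le_trans H st)) (min_idPr (le_trans H' st)).
  by rewrite (max_idPl H) (max_idPl H') ltxx.
rewrite tau_S in sti; rewrite ltr_norml; lra.
Unshelve. all: by end_near. Qed.

Lemma fine_partition dl a b : 0 < dl -> a <= b -> exists2 s : seq R, itv_partition a b s &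
  forall i, (i < size s)%N -> nth b (a :: s) i.+1 - nth b (a :: s) i < dl.
Proof.
move=> dl0.
have main n : forall a, a <= b -> b - a <= n%:R * (dl / 2) ->
  exists2 s : seq R, itv_partition a b s &
  forall i, (i < size s)%N -> nth b (a :: s) i.+1 - nth b (a :: s) i < dl.
  elim: n => [|n IH] {}a ab nab.
    rewrite mul0r in nab; have -> : a = b by lra.
    by exists [::] => //; split => //=.
  have [ba|ba] := leP b (a + dl / 2).
    have [->|anb] := eqVneq a b; first by exists [::] => //; split => //=.
    exists [:: b]; first by split => //=; rewrite andbT lt_neqAle anb.
    by move=> [|i] //= _; lra.
  rewrite -[n.+1]addn1 natrD in nab.
  have [||s [s1 s2] sP] := IH (a + dl / 2); try lra.
  exists (a + dl / 2 :: s) => [|[|i] /= si].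
  - by split => //=; rewrite s1 andbT; lra.
  - lra.
  - exact: sP.
move=> ab; apply: (main (Num.truncn ((b - a) / (dl / 2))).+1 a ab).
by rewrite -ler_pdivrMr ?divr_gt0 //; apply: ltW; apply: truncnS_gt.
Qed.

Lemma itv_partition_sorted a b (s : seq R) i : itv_partition a b s -> (i < size s)%N ->
  [/\ a <= nth b (a :: s) i, nth b (a :: s) i <= nth b (a :: s) i.+1 &
     nth b (a :: s) i.+1 <= b].
Proof.
move=> ps si; split.
- by apply: itv_partition_nth_ge => //; rewrite ltnS ltnW.
- by case: ps => /pathP/(_ i si)/ltW.
- by apply: itv_partition_nth_le.
Qed.

Lemma telescope_partition (G : R -> R) a b (s : seq R) : itv_partition a b s ->
  \sum_(0 <= i < size s) (G (nth b (a :: s) i.+1) - G (nth b (a :: s) i)) = G b - G a.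
Proof.
move=> [_ /eqP sb]; rewrite (telescope_nat (fun i => G (nth b (a :: s) i))) /=.
by have := nth_last b (a :: s) => /= ->; rewrite sb.
Qed.

Lemma RS_integral_unique a b f g (I J : R) : a <= b ->
  is_RS_integral f g a b I -> is_RS_integral f g a b J -> I = J.
Proof.
move=> ab HI HJ; apply/eqP; rewrite -subr_eq0 -normr_le0; apply/ler_addgt0Pr => e e0.
have e20 : 0 < e / 2 by rewrite divr_gt0.
have [d1 d10 H1] := HI _ e20; have [d2 d20 H2] := HJ _ e20.
have [s sP sd] := @fine_partition (Num.min d1 d2) a b ltac:(by rewrite lt_min d10) ab.
have K i : (i < size s)%N -> nth b (a :: s) i <= nth b (a :: s) i <= nth b (a :: s) i.+1.
  by move=> si; have [_ h _] := itv_partition_sorted sP si; rewrite lexx.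
have := H1 s sP (nth b (a :: s)) _; have := H2 s sP (nth b (a :: s)) _.
set S := \sum_(_ <= _ < _) _ => h2 h1.
have {}h1 : `|S - I| < e / 2.
  by apply: h1 => i si; split; [exact: K|have := sd i si; rewrite lt_min => /andP[]].
have {}h2 : `|S - J| < e / 2.
  by apply: h2 => i si; split; [exact: K|have := sd i si; rewrite lt_min => /andP[]].
have := ler_normB (S - J) (S - I).
rewrite [X in `|X| <= _](_ : _ = I - J); last by ring.
lra.
Qed.

(** Uniform continuity of [f] moves an arbitrary tag to the left end of its cell at a cost small
    against [v], and the increments of [F] telescope. *)
Lemma tangent_is_RS a b v f g F : a <= b -> ucont a b f -> dominated a b v g ->
  tangent a b v F (fun s t => f s * (g t - g s)) -> is_RS_integral f g a b (F b - F a).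
Proof.
move=> ab uf dg tF e e0; set K := v b - v a + 1.
have K0 : 0 < K by have := dominated_mono dg (lexx a) ab (lexx b); rewrite /K; lra.
have eK : 0 < e / (2 * K) by rewrite divr_gt0 // mulr_gt0.
have [d1 d10 H1] := tF _ eK; have [d2 d20 H2] := uf _ eK.
exists (Num.min d1 d2) => [|s sP xi xiP]; first by rewrite lt_min d10.
rewrite -(telescope_partition F sP) -sumrB.
apply: (@le_lt_trans _ _ (e / K * (v b - v a))); last first.
  by rewrite mulrAC ltr_pdivrMr // ltr_pM2l // /K ltrDl.
rewrite -(telescope_partition v sP) mulr_sumr.
apply: (le_trans (ler_norm_sum _ _ _)); rewrite big_nat [leRHS]big_nat.
apply: ler_sum => i /= si; have [s1 s2 s3] := itv_partition_sorted sP si.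
have [xi1 xi2] := xiP i si; move: xi2.
set x := nth b _ i in s1 s2 xi1 *; set y := nth b _ i.+1 in s2 s3 xi1 *.
rewrite lt_min => /andP[/H1-/(_ s1 s2 s3) h1 yx].
have h2 : `|f (xi i) - f x| < e / (2 * K).
  by apply: H2; try lra; rewrite ger0_norm; lra.
have h3 := dg x y s1 s2 s3.
rewrite (_ : _ - _ = (f (xi i) - f x) * (g y - g x) - (F y - F x - f x * (g y - g x)));
  last by ring.
apply: (le_trans (ler_normB _ _)); rewrite normrM.
have -> : e / K = e / (2 * K) + e / (2 * K).
  by field; rewrite gt_eqF.
rewrite mulrDl; apply: lerD => //; apply: ler_pM => //; exact: ltW.
Qed.

Lemma RS_integralE a b v f g F : a <= b -> ucont a b f -> dominated a b v g ->
  tangent a b v F (fun s t => f s * (g t - g s)) -> RS_integral f g a b = F b - F a.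
Proof.
move=> ab uf dg tF; have H := tangent_is_RS ab uf dg tF.
apply: (RS_integral_unique ab _ H).
by rewrite /RS_integral; case: xgetP => [y -> //|/(_ (F b - F a))/(_ H)].
Qed.

(** The integral exists, so the default of [xget] never occurs, and as a function of its upper end
    it is a primitive of the germ. Integrals are handled through this germ from here on. *)
Lemma RS_integral_tangent a b v f g : a <= b -> ucont a b f -> dominated a b v g ->
  tangent a b v (RS_integral f g a) (fun s t => f s * (g t - g s)).
Proof.
move=> ab uf dg; have [F tF] := tangent_primitive ab uf dg.
have E t : a <= t -> t <= b -> RS_integral f g a t = F t - F a.
  move=> at1 tb; apply: (RS_integralE (v := v)) => //.
  - exact: ucontW uf.
  - exact: dominatedW dg.
  - exact: tangentW tF.
move=> e /tF [dl dl0 H]; exists dl => // s t s1 st t1 std.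
rewrite !E //; try lra; rewrite [X in `|X| <= _](_ : _ = F t - F s - f s * (g t - g s));
  last by ring.
exact: H.
Qed.

Lemma RS_integral_xx a f g : RS_integral f g a a = 0.
Proof.
have P1 s : a <= s <= a -> s = a by move=> /andP[? ?]; apply/eqP; rewrite eq_le; lra.
rewrite (RS_integralE (v := fun=> `|g a|) (F := cst 0)) ?subrr //.
- by move=> e e0; exists 1 => // s t /P1 -> /P1 ->; rewrite !subrr normr0.
- move=> s t s1 st ta; have -> : s = a by apply: P1; lra.
  by have -> : t = a by [apply: P1; lra]; rewrite !subrr normr0.
- move=> e e0; exists 1 => // s t s1 st ta _; have -> : s = a by apply: P1; lra.
  by have -> : t = a by [apply: P1; lra]; rewrite !subrr mulr0 subrr normr0 mulr0.
Qed.

End RiemannStieltjes.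

Section BoundedVariation.
Variable R : realType.
Implicit Types (a b s t T : R) (g v : R -> R).

Lemma bounded_variation_dominated a b g : a < b -> {within `[a, b], continuous g} ->
  bounded_variation a b g ->
  dominated a b (fun t => fine (total_variation a t g)) g /\
  ucont a b (fun t => fine (total_variation a t g)).
Proof.
move=> ab cg bg; split; last first.
  by apply: within_ucont; exact: total_variation_continuous.
have fint t : a <= t -> t <= b -> total_variation a t g \is a fin_num.
  by move=> at1 tb; apply/bounded_variationP => //; exact: (bounded_variationl at1 tb bg).
move=> s t s1 st t1.
have st_fin : total_variation s t g \is a fin_num.
  apply/bounded_variationP => //; apply: (bounded_variationr s1 st).
  by apply: (bounded_variationl _ t1 bg); exact: le_trans st.
rewrite (total_variationD _ s1 st) fineD ?fint // ?(le_trans st) // addrAC subrr add0r.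
by rewrite -lee_fin fineK // total_variation_ge.
Qed.

(** The total variations of the coordinates are added, to have one function for all of them; they
    are continuous because the path is. *)
Lemma continuous_BV_dominated d T (x : R -> 'rV[R]_d) : 0 < T -> continuous_BV T x ->
  exists2 v : R -> R, ucont 0 T v &
  (forall s t, 0 <= s -> s <= t -> t <= T -> v s <= v t) /\
  forall i, dominated 0 T v (fun t => x t ord0 i).
Proof.
move=> T0 bx.
pose w i t := fine (total_variation 0 t (fun r => x r ord0 i)).
have wP i : dominated 0 T (w i) (fun t => x t ord0 i) /\ ucont 0 T (w i).
  by have [cx bvx] := bx i; exact: bounded_variation_dominated.
exists (fun t => \sum_i w i t); first by apply: ucont_sum => i; exact: (wP i).2.
split=> [s t s1 st t1|i s t s1 st t1].
  by apply: ler_sum => i _; apply: dominated_mono (wP i).1 s1 st t1.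
apply: (le_trans ((wP i).1 s t s1 st t1)); rewrite -sumrB (bigD1 i) //= lerDl.
by apply: sumr_ge0 => j _; rewrite subr_ge0; apply: dominated_mono (wP j).1 s1 st t1.
Qed.

End BoundedVariation.

(** * Signatures of paths of bounded variation *)

Section PathSignature.
Variables (R : realType) (d : nat) (T : R) (x : R -> 'rV[R]_d) (v : R -> R).
Hypotheses (v_ucont : ucont 0 T v)
  (v_mono : forall s t, 0 <= s -> s <= t -> t <= T -> v s <= v t)
  (x_dom : forall i, dominated 0 T v (fun t => x t ord0 i)).
Implicit Types (s t u : R) (w : seq 'I_d).

Local Notation J := (iterated_integral x).

(** A joint induction: continuity and boundedness of the inner integral are what make the outer one
    exist. Both claims follow from the Lipschitz estimate [lip] against [v]. *)
Lemma iterated_integral_props s w : 0 <= s <= T ->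
  ucont s T (J s w) /\
  forall t, s <= t -> t <= T -> `|J s w t| <= (v t - v s) ^+ size w.
Proof.
move=> /andP[s0 sT]; elim: w => [|i w [IHu IHb]] /=.
  by split; [exact: ucont_cst|move=> t st tT; rewrite normr1 expr0].
have ds : dominated s T v (fun t => x t ord0 i) := dominatedW s0 (lexx T) (x_dom i).
have us : ucont s T v := ucontW s0 (lexx T) v_ucont.
have tJ := RS_integral_tangent sT IHu ds.
have key t s' t' : s <= t -> t <= T -> s <= s' -> s' <= t' -> t' <= t ->
    `|J s w s' * (x t' ord0 i - x s' ord0 i)| <= (v t - v s) ^+ size w * (v t' - v s').
  move=> st tT s1 st1 t1; rewrite normrM ler_pM //.
    apply: (le_trans (IHb s' s1 _)); first lra.
    by apply: lerXn2r; rewrite ?nnegrE ?lerD2r ?subr_ge0 ?v_mono //; lra.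
  by apply: x_dom; lra.
have lip t : s <= t -> t <= T -> forall s' t', s <= s' -> s' <= t' -> t' <= t ->
  `|J s (i :: w) t' - J s (i :: w) s'| <= (v t - v s) ^+ size w * (v t' - v s').
  move=> st tT; apply: (tangent_le st _ _ (tangentW (lexx s) tT tJ)).
  - by rewrite exprn_ge0 // subr_ge0 v_mono.
  - by move=> s' t' *; apply: v_mono; lra.
  - by move=> s' t' *; apply: key.
split.
  apply: (dominated_ucont (ucontZ ((v T - v s) ^+ size w) us)).
  by move=> s' t' *; rewrite -mulrBr; apply: (lip T).
move=> t st tT; have := lip t st tT s t (lexx s) st (lexx t).
by rewrite /= RS_integral_xx subr0 exprSr.
Qed.

Lemma iterated_integral_tangent s i w : 0 <= s <= T ->
  tangent s T v (J s (i :: w)) (fun r t => J s w r * (x t ord0 i - x r ord0 i)).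
Proof.
move=> sT; have [uJ _] := iterated_integral_props w sT.
case/andP: sT => s0 sT.
by apply: RS_integral_tangent => //; exact: dominatedW (x_dom i).
Qed.

(** Induction on the word. As functions of [t] on [[u, T]], both sides have the germ of the
    outermost integral, and they agree at [t = u], where all integrals from [u] vanish; the term
    [k = 0] is the constant in [K]. *)
Lemma iterated_integral_chen w s u t : 0 <= s -> s <= u -> u <= t -> t <= T ->
  J s w t = \sum_(k < (size w).+1) J u (take k w) t * J s (drop k w) u.
Proof.
move=> s0 su.
elim: w t => [|i w IH] t ut tT; first by rewrite big_ord1 mulr1.
have uT : u <= T by lra.
have suT : 0 <= s <= T by lra.
have uuT : 0 <= u <= T by lra.
pose K r := J s (i :: w) u + \sum_(k < (size w).+1) J s (drop k w) u * J u (i :: take k w) r.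
transitivity (K t); last first.
  rewrite [RHS]big_ord_recl; congr (_ + _); first by rewrite /= mul1r.
  by apply: eq_bigr => k _; rewrite mulrC.
have vm : forall s t, u <= s -> s <= t -> t <= T -> v s <= v t.
  by move=> *; apply: v_mono => //; lra.
apply: (@tangent_eq _ u T v _ _ (fun r t => J s w r * (x t ord0 i - x r ord0 i))) => //.
- exact: tangentW (iterated_integral_tangent i w suT).
- apply: eq_tangent; last first.
    apply: tangentD; first exact: tangent_cst.
    apply: tangent_sum => // k; apply: tangentZ.
    exact: (iterated_integral_tangent i (take k w) uuT).
  move=> r r' ur rr r'T /=; rewrite add0r (IH r) //; last lra.
  by rewrite mulr_suml; apply: eq_bigr => k _; rewrite mulrA (mulrC (J s _ _)).
- rewrite /K big1 ?addr0 // => k _.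
  by rewrite /= RS_integral_xx mulr0.
- by rewrite ut.
Qed.

Lemma path_signature_chen s u t w : 0 <= s -> s <= u -> u <= t -> t <= T ->
  tensor_mul (path_signature x s u) (path_signature x u t) w = path_signature x s t w.
Proof.
move=> s0 su ut tT; rewrite /tensor_mul /path_signature (iterated_integral_chen _ s0 su ut tT).
(* [path_signature] reverses words, so prefixes become suffixes and the place of the cut is
   reflected. *)
rewrite (reindex_inj rev_ord_inj) /= size_rev; apply: eq_bigr => k _.
rewrite subSS rev_take rev_drop.
have -> : (size w - (size w - k) = k)%N by rewrite subKn // -ltnS.
exact: mulrC.
Qed.

Lemma path_signature_nil s t : path_signature x s t [::] = 1.
Proof. by []. Qed.

Lemma path_signature1 s t i : 0 <= s -> s <= t -> t <= T ->
  path_signature x s t [:: i] = x t ord0 i - x s ord0 i.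
Proof.
move=> s0 st tT; rewrite /path_signature /=.
apply: (RS_integralE (v := v) (F := fun r => x r ord0 i)) => //.
- exact: ucont_cst.
- exact: dominatedW (x_dom i).
- move=> e e0; exists 1 => // s' t' s1 st' t1 _; rewrite mul1r subrr normr0.
  by apply: mulr_ge0; [exact: ltW|rewrite subr_ge0 v_mono //; lra].
Qed.

Lemma path_signature_le s t w : 0 <= s -> s <= t -> t <= T ->
  `|path_signature x s t w| <= (v t - v s) ^+ size w.
Proof.
move=> s0 st tT; rewrite /path_signature -(size_rev w).
have [|_ H] := @iterated_integral_props s (rev w); first by lra.
exact: H.
Qed.

End PathSignature.

(** * Linear differential equations *)

Section StateNorm.
Variables (R : realType) (I : finType).
Implicit Types y z : {ffun I -> R}.

Definition nrm y : R := \sum_a `|y a|.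

Lemma nrm_ge0 y : 0 <= nrm y.
Proof. exact: sumr_ge0. Qed.

Lemma nrm_coord y a : `|y a| <= nrm y.
Proof. by rewrite /nrm (bigD1 a) //= lerDl sumr_ge0. Qed.

Lemma nrm_le y (C : R) : (forall a, `|y a| <= C) -> nrm y <= #|I|%:R * C.
Proof.
move=> H; apply: (le_trans (ler_sum _ (fun a _ => H a))).
by rewrite sumr_const mulr_natl.
Qed.

Lemma nrmD y z : nrm (y + z) <= nrm y + nrm z.
Proof. by rewrite -big_split; apply: ler_sum => a _; rewrite ffunE ler_normD. Qed.

Lemma nrmN y : nrm (- y) = nrm y.
Proof. by apply: eq_bigr => a _; rewrite ffunE normrN. Qed.

Lemma nrmB y z : nrm (y - z) <= nrm y + nrm z.
Proof. by rewrite -(nrmN z) nrmD. Qed.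

Lemma nrmZ (c : R) y : nrm (c *: y) = `|c| * nrm y.
Proof. by rewrite mulr_sumr; apply: eq_bigr => a _; rewrite ffunE normrM. Qed.

Lemma nrm0 : nrm 0 = 0.
Proof. by rewrite /nrm big1 // => a _; rewrite ffunE normr0. Qed.

Lemma nrm_sum (J : Type) (r : seq J) (P : pred J) (F : J -> {ffun I -> R}) :
  nrm (\sum_(i <- r | P i) F i) <= \sum_(i <- r | P i) nrm (F i).
Proof.
elim/big_ind2: _ => [|y1 c1 y2 c2 h1 h2|//]; first by rewrite nrm0.
by apply: (le_trans (nrmD _ _)); exact: lerD.
Qed.

Lemma nrm_eq0 y : nrm y <= 0 -> y = 0.
Proof.
move=> H; apply/ffunP => a; rewrite ffunE; apply/eqP.
by rewrite -normr_le0 (le_trans (nrm_coord y a)).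
Qed.

Lemma linear_bounded (A : {linear {ffun I -> R} -> {ffun I -> R}}) :
  exists2 C : R, 0 <= C & forall y, nrm (A y) <= C * nrm y.
Proof.
pose e b : {ffun I -> R} := [ffun a => (a == b)%:R].
exists (\sum_b nrm (A (e b))); first by apply: sumr_ge0 => b _; exact: nrm_ge0.
move=> y; have {1}-> : y = \sum_b y b *: e b.
  apply/ffunP => a; rewrite sum_ffunE (bigD1 a) //= !ffunE eqxx.
  rewrite big1 ?addr0 => [|b ba]; first by rewrite /GRing.scale /= mulr1.
  by rewrite !ffunE eq_sym (negbTE ba) /GRing.scale /= mulr0.
rewrite linear_sum; apply: (le_trans (nrm_sum _ _ _)).
rewrite mulr_suml; apply: ler_sum => b _; rewrite linearZ nrmZ mulrC.
by apply: ler_wpM2l; [exact: nrm_ge0|exact: nrm_coord].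
Qed.

Lemma linear_bounded_all d (A : 'I_d -> {linear {ffun I -> R} -> {ffun I -> R}}) :
  exists2 C : R, 0 <= C & forall j y, nrm (A j y) <= C * nrm y.
Proof.
have /choice [C HC] : forall j, exists C : R, 0 <= C /\ forall y, nrm (A j y) <= C * nrm y.
  by move=> j; have [C C0 H] := linear_bounded (A j); exists C.
exists (\sum_j C j); first by apply: sumr_ge0 => j _; exact: (HC j).1.
move=> j y; apply: (le_trans ((HC j).2 y)); apply: ler_wpM2r; first exact: nrm_ge0.
by rewrite (bigD1 j) //= lerDl; apply: sumr_ge0 => i _; exact: (HC i).1.
Qed.

End StateNorm.

Section Picard.
Variable R : realType.

(** An arbitrary majorant [Phi] takes the place of the multiple of [v] in [tangent_le]; the
    exponential weight of the Picard iteration needs this generality. *)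
Lemma tangent_increment_le a b (v f Phi : R -> R) (mu : R -> R -> R) : a <= b ->
  (forall s t, a <= s -> s <= t -> t <= b -> v s <= v t) ->
  (forall s t, a <= s -> s <= t -> t <= b -> `|mu s t| <= Phi t - Phi s) ->
  tangent a b v f mu -> `|f b - f a| <= Phi b - Phi a.
Proof.
move=> ab vm muP tf.
have Pm s t : a <= s -> s <= t -> t <= b -> Phi s <= Phi t.
  by move=> *; rewrite -subr_ge0; apply: le_trans (muP _ _ _ _ _) => //.
apply/ler_addgt0Pr => e e0.
set K := v b - v a + 1.
have K0 : 0 < K by have := vm a b (lexx _) ab (lexx _); rewrite /K; lra.
have eK : 0 < e / K by rewrite divr_gt0.
have : `|f b - f a| <= 1 * ((Phi b + e / K * v b) - (Phi a + e / K * v a)).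
  apply: (@local_to_global _ a b (fun t => Phi t + e / K * v t)) => //.
    move=> s t *; apply: lerD; first exact: Pm.
    by apply: ler_wpM2l; [exact: ltW|exact: vm].
  move=> e' e'0; have [dl dl0 H] := tf _ eK; exists dl => // s t s1 st t1 std.
  have := H s t s1 st t1 std; have := muP s t s1 st t1.
  have := ler_normD (f t - f s - mu s t) (mu s t); rewrite subrK.
  move=> h1 h2 h3; apply: (@le_trans _ _ (1 * (Phi t + e / K * v t - (Phi s + e / K * v s)))).
    by rewrite mul1r; lra.
  apply: ler_wpM2r; last lra.
  by rewrite subr_ge0 lerD ?Pm // ler_wpM2l ?vm // ltW.
move=> /le_trans; apply; rewrite mul1r.
have : e / K * (v b - v a) <= e.
  by rewrite mulrAC ler_pdivrMr // ler_pM2l // /K; lra.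
lra.
Qed.

(** Since the germs are uniformly Cauchy relative to [v], [tangent_le] applied to [Fn n - Fn N]
    bounds its increments at all scales, so one mesh chosen for a single [N] serves the limit. *)
Lemma tangent_lim a b (v F : R -> R) (mu : R -> R -> R) (Fn : nat -> R -> R)
    (mun : nat -> R -> R -> R) : a <= b ->
  (forall s t, a <= s -> s <= t -> t <= b -> v s <= v t) ->
  (forall n, tangent a b v (Fn n) (mun n)) ->
  (forall t, a <= t <= b -> Fn n t @[n --> \oo] --> F t) ->
  (forall s t, a <= s -> s <= t -> t <= b -> mun n s t @[n --> \oo] --> mu s t) ->
  (forall e, 0 < e -> exists N, forall n, (N <= n)%N -> forall s t,
     a <= s -> s <= t -> t <= b -> `|mun n s t - mun N s t| <= e * (v t - v s)) ->
  tangent a b v F mu.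
Proof.
move=> ab vm tFn cF cmu unif e e0.
have e30 : 0 < e / 3 by rewrite divr_gt0.
have [N HN] := unif _ e30; have [dl dl0 H] := tFn N _ e30.
exists dl => // s t s1 st t1 std.
have := H s t s1 st t1 std.
suff : `|(F t - F s - mu s t) - (Fn N t - Fn N s - mun N s t)| <= 2 * (e / 3) * (v t - v s).
  have := ler_normD (F t - F s - mu s t - (Fn N t - Fn N s - mun N s t)) (Fn N t - Fn N s - mun N s t).
  rewrite subrK; lra.
have cl : `|(Fn n t - Fn n s - mun n s t) - (Fn N t - Fn N s - mun N s t)| @[n --> \oo] -->
    `|(F t - F s - mu s t) - (Fn N t - Fn N s - mun N s t)|.
  apply: cvg_norm; apply: cvgB; last exact: cvg_cst.
  apply: cvgB; last exact: cmu.
  by apply: cvgB; apply: cF; lra.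
apply: (cvgr_to_le cl); exists N => // n /= nN.
have h1 := HN n nN s t s1 st t1.
have h2 : `|(Fn n t - Fn N t) - (Fn n s - Fn N s)| <= e / 3 * (v t - v s).
  apply: (@tangent_le _ a b v (fun t => Fn n t - Fn N t) (fun s t => mun n s t - mun N s t)) => //.
  - exact: ltW.
  - have := tangentD (tFn n) (tangentZ (-1) (tFn N)).
    move=> tD e' /tD [d1 d10 H1]; exists d1 => // x y ax xy yb xyd.
    by have := H1 x y ax xy yb xyd; rewrite !mulN1r.
  - by move=> *; exact: HN.
have := ler_normB (Fn n t - Fn N t - (Fn n s - Fn N s)) (mun n s t - mun N s t).
rewrite [X in `|X| <= _](_ : _ = (Fn n t - Fn n s - mun n s t) - (Fn N t - Fn N s - mun N s t));
  last by ring.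
lra.
Qed.

Lemma geometric_cvg (u : nat -> R) (C : R) :
  (forall n, `|u n.+1 - u n| <= C * 2^-1 ^+ n) ->
  exists2 l : R, u @ \oo --> l & forall n, `|l - u n| <= C * 2 * 2^-1 ^+ n.
Proof.
move=> H.
have C0 : 0 <= C by have := H 0; rewrite expr0 mulr1; exact: le_trans.
have ps n m : (n <= m)%N -> `|u m - u n| <= C * 2 * (2^-1 ^+ n - 2^-1 ^+ m).
  elim: m => [|m IH].
    by rewrite leqn0 => /eqP ->; rewrite !subrr normr0 mulr0.
  rewrite leq_eqVlt => /orP[/eqP ->|]; first by rewrite !subrr normr0 mulr0.
  rewrite ltnS => /IH h; have := H m; have := ler_normD (u m.+1 - u m) (u m - u n).
  rewrite addrA subrK [2^-1 ^+ m.+1]exprS => h1 h2.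
  have : C * 2 * (2^-1 ^+ n - 2^-1 ^+ m) + C * 2^-1 ^+ m =
    C * 2 * (2^-1 ^+ n - 2^-1 * 2^-1 ^+ m) by field.
  lra.
have psb n m : (n <= m)%N -> `|u m - u n| <= C * 2 * 2^-1 ^+ n.
  move=> /ps /le_trans; apply; apply: ler_wpM2l; first lra.
  by rewrite gerBl exprn_ge0.
have cu : cvgn u.
  pose w n := u n.+1 - u n.
  have cw : cvgn (series w).
    apply: normed_cvg; apply: (@series_le_cvg _ _ (fun n => C * 2^-1 ^+ n)).
    - by move=> n /=.
    - by move=> n; rewrite mulr_ge0 // exprn_ge0.
    - by move=> n /=; exact: H.
    - apply: (@is_cvg_geometric_series R C 2^-1).
      by rewrite ger0_norm; lra.
  have -> : u = (fun n => series w n + u 0%N).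
    by apply/funext => n; rewrite /series /= telescope_nat subrK.
  by apply: is_cvgD => //; exact: is_cvg_cst.
exists (limn u) => // n.
have cl : `|u m - u n| @[m --> \oo] --> `|limn u - u n|.
  by apply: cvg_norm; apply: cvgB => //; exact: cvg_cst.
by apply: (cvgr_to_le cl); exists n => // m /= /psb.
Qed.

End Picard.

Lemma cvg_finite_sum (K : numFieldType) (V : normedModType K) (U : Type) (F : set_system U)
    (J : Type) (r : seq J) (f : J -> U -> V) (l : J -> V) : Filter F ->
  (forall j, f j x @[x --> F] --> l j) ->
  \sum_(j <- r) f j x @[x --> F] --> \sum_(j <- r) l j.
Proof.
move=> FF H; elim: r => [|j r IH].
  by under eq_fun do rewrite big_nil; rewrite big_nil; exact: cvg_cst.
by under eq_fun do rewrite big_cons; rewrite big_cons; exact: cvgD.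
Qed.

Lemma geometric_small (R : realType) (C e : R) : 0 < e ->
  exists N, forall n, (N <= n)%N -> C * 2^-1 ^+ n <= e.
Proof.
move=> e0.
have h : C * 2^-1 ^+ n @[n --> \oo] --> C * 0.
  by apply: cvgMl_tmp; apply: cvg_expr; rewrite ger0_norm; lra.
rewrite mulr0 in h; have [N _ HN] := cvgr_le _ h _ e0.
by exists N => n Nn; exact: HN.
Qed.

Section LinearODE.
Variables (R : realType) (d : nat) (I : finType) (T : R) (x : R -> 'rV[R]_d) (v : R -> R).
Hypotheses (T_ge0 : 0 <= T) (v_ucont : ucont 0 T v)
  (v_mono : forall s t, 0 <= s -> s <= t -> t <= T -> v s <= v t)
  (x_dom : forall i, dominated 0 T v (fun t => x t ord0 i)).
Variable A : 'I_d -> {linear {ffun I -> R} -> {ffun I -> R}}.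
Implicit Types (s t : R) (y : R -> {ffun I -> R}).

Definition driven y (f : 'I_d -> R -> {ffun I -> R}) := forall a,
  ucont 0 T (fun t => y t a) /\
  tangent 0 T v (fun t => y t a)
    (fun s t => \sum_j f j s a * (x t ord0 j - x s ord0 j)).

Definition linear_ode (y0 : {ffun I -> R}) y :=
  y 0 = y0 /\ driven y (fun j s => A j (y s)).

Lemma increment_sum_le (f : 'I_d -> R) (C : R) s t : 0 <= s -> s <= t -> t <= T ->
  (forall j, `|f j| <= C) ->
  `|\sum_j f j * (x t ord0 j - x s ord0 j)| <= d%:R * C * (v t - v s).
Proof.
move=> s0 st tT fC; apply: (le_trans (ler_norm_sum _ _ _)).
apply: (@le_trans _ _ (\sum_(j < d) C * (v t - v s))).
  by apply: ler_sum => j _; rewrite normrM; apply: ler_pM => //; exact: x_dom.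
by rewrite sumr_const card_ord -mulrA mulr_natl.
Qed.

Lemma ucont_linear (B : {linear {ffun I -> R} -> {ffun I -> R}}) y a :
  (forall b, ucont 0 T (fun t => y t b)) -> ucont 0 T (fun t => B (y t) a).
Proof.
move=> uy e e0; have [C C0 HC] := linear_bounded B.
have eK : 0 < e / (C + 1) by rewrite divr_gt0 //; lra.
have un : ucont 0 T (fun t => \sum_b `|y t b|).
  apply: ucont_sum => b e' e'0; have [dl dl0 H] := uy b e' e'0; exists dl => // s t sT tT st.
  by apply: le_lt_trans (H s t sT tT st); rewrite ler_dist_dist.
have /choice [dl dlP] : forall b, exists dl : R, 0 < dl /\ forall s t, 0 <= s <= T -> 0 <= t <= T ->
    `|s - t| < dl -> `|y s b - y t b| < e / (C + 1) / (#|I|%:R + 1).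
  move=> b; have [|dl dl0 H] := uy b (e / (C + 1) / (#|I|%:R + 1)); last by exists dl.
  by rewrite divr_gt0 // ltr_wpDl.
exists (\big[Num.min/1]_b dl b).
  by elim/big_ind: _ => // [p q p0 q0|b _]; [rewrite lt_min p0|exact: (dlP b).1].
move=> s t sT tT st.
rewrite (_ : B (y s) a - B (y t) a = B (y s - y t) a); last by rewrite linearB !ffunE.
apply: (le_lt_trans (nrm_coord _ _)); apply: (le_lt_trans (HC _)).
have h : nrm (y s - y t) <= #|I|%:R * (e / (C + 1) / (#|I|%:R + 1)).
  apply: nrm_le => b; rewrite !ffunE; apply: ltW; apply: (dlP b).2 => //.
  by apply: (lt_le_trans st); rewrite (bigD1 b) //= ge_min lexx.
have h2 : #|I|%:R * (e / (C + 1) / (#|I|%:R + 1)) <= e / (C + 1).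
  rewrite mulrCA; apply: ler_piMr; first exact: ltW.
  by rewrite ler_pdivrMr ?ltr_wpDl // mul1r lerDl.
have h3 : nrm (y s - y t) <= e / (C + 1) := le_trans h h2.
apply: (@le_lt_trans _ _ (C * (e / (C + 1)))); first by apply: ler_wpM2l.
by rewrite mulrCA gtr_pMr // ltr_pdivrMr; lra.
Qed.

Lemma driven_integral (y0 : {ffun I -> R}) (f : 'I_d -> R -> {ffun I -> R}) :
  (forall j a, ucont 0 T (fun t => f j t a)) ->
  driven (fun t => [ffun a => y0 a + \sum_j RS_integral (fun s => f j s a) (fun s => x s ord0 j) 0 t]) f.
Proof.
move=> uf a.
have tf : tangent 0 T v
    (fun t => y0 a + \sum_j RS_integral (fun s => f j s a) (fun s => x s ord0 j) 0 t)
    (fun s t => \sum_j f j s a * (x t ord0 j - x s ord0 j)).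
  apply: eq_tangent; last first.
    apply: tangentD; first exact: tangent_cst.
    by apply: tangent_sum => // j; apply: RS_integral_tangent.
  by move=> s t *; rewrite /= add0r.
have E : (fun t => [ffun a => y0 a + \sum_j RS_integral (fun s => f j s a)
    (fun s => x s ord0 j) 0 t] a) =
    (fun t => y0 a + \sum_j RS_integral (fun s => f j s a) (fun s => x s ord0 j) 0 t).
  by apply/funext => t; rewrite ffunE.
split; last by rewrite E.
rewrite E; have /choice [C HC] : forall j, exists C : R, 0 <= C /\ forall t, 0 <= t <= T -> `|f j t a| <= C.
  by move=> j; have [C C0 H] := ucont_bounded (uf j a); exists C.
apply: (@dominated_ucont _ 0 T (fun t => d%:R * (\sum_j C j) * v t)); first exact: ucontZ.
move=> s t s0 st tT; rewrite -mulrBr.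
apply: (tangent_le T_ge0 _ v_mono tf) => //.
  by apply: mulr_ge0 => //; apply: sumr_ge0 => j _; exact: (HC j).1.
move=> p q p0 pq qT; apply: increment_sum_le => // j.
apply: (le_trans ((HC j).2 p _)); first by rewrite p0 (le_trans pq).
by rewrite (bigD1 j) //= lerDl; apply: sumr_ge0 => i _; exact: (HC i).1.
Qed.

(** Picard iteration, started at 0 so that the first iterate is the constant [y0]. The limit
    satisfies the equation by [tangent_lim]. *)
Lemma linear_ode_exists (y0 : {ffun I -> R}) : exists y, linear_ode y0 y.
Proof.
have [L L0 HL] := linear_bounded_all A.
pose Y := fix Y n : R -> {ffun I -> R} := if n is m.+1 then
  fun t => [ffun a => y0 a + \sum_j RS_integral (fun s => A j (Y m s) a) (fun s => x s ord0 j) 0 t]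
  else fun=> 0.
pose f n j s := if n is m.+1 then A j (Y m s) else 0.
have Yd n : driven (Y n) (f n).
  elim: n => [|n IH] /=.
    move=> a; split.
      by move=> e e0; exists 1 => // s t _ _ _; rewrite !ffunE subrr normr0.
    move=> e e0; exists 1 => // s t s0 st tT _; rewrite !ffunE subrr sub0r normrN.
    rewrite big1 => [|j _]; last by rewrite mul0r.
    by rewrite normr0; apply: mulr_ge0; [exact: ltW|rewrite subr_ge0 v_mono].
  by apply: driven_integral => j a; apply: ucont_linear => b; exact: (IH b).1.
have Y0 n : Y n.+1 0 = y0.
  by apply/ffunP => a; rewrite /= ffunE big1 ?addr0 // => j _; rewrite RS_integral_xx.
(* In the norm weighted by [E] the Picard map contracts by [#|I| * d * L / K], which is at most one
   half. *)
pose K := 2 * (#|I|%:R * (d%:R * L) + 1).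
have dL0 : 0 <= d%:R * L by rewrite mulr_ge0.
have IdL0 : 0 <= #|I|%:R * (d%:R * L) by rewrite mulr_ge0.
have K0 : 0 < K by rewrite /K; lra.
(* An exponential weight makes the Picard map a contraction on all of [0, T]. *)
pose E t := nrm y0 * expR (K * (v t - v 0)).
have Em s t : 0 <= s -> s <= t -> t <= T -> E s * (v t - v s) <= K^-1 * (E t - E s).
  move=> s0 st tT; rewrite /E -mulrBr mulrCA -mulrA.
  apply: ler_wpM2l; first exact: nrm_ge0.
  rewrite [K * (v t - v 0)](_ : _ = K * (v s - v 0) + K * (v t - v s)); last by ring.
  rewrite expRD -{3}(mulr1 (expR (K * (v s - v 0)))) -mulrBr mulrCA.
  apply: ler_wpM2l; first exact: expR_ge0.
  rewrite mulrC ler_pdivlMr //; have := expR_ge1Dx (K * (v t - v s)).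
  by rewrite [_ * K]mulrC; lra.
have E_ge0 t : 0 <= E t by rewrite mulr_ge0 ?expR_ge0 ?nrm_ge0.
have diffE n : forall t, 0 <= t <= T -> nrm (Y n.+1 t - Y n t) <= 2^-1 ^+ n * E t.
  elim: n => [|n IH] t /andP[t0 tT].
    rewrite expr0 mul1r (_ : _ - _ = y0).
      rewrite /E ler_peMr ?nrm_ge0 // -[leLHS]expR0 ler_expR.
      by apply: mulr_ge0; [exact: ltW|rewrite subr_ge0 v_mono].
    apply/ffunP => a; rewrite /= !ffunE subr0 big1 ?addr0 // => j _.
    have := @RS_integralE R 0 t v (fun s => A j 0 a) (fun s => x s ord0 j) (cst 0).
    move=> -> //=; first by rewrite subrr.
    - exact: ucont_cst.
    - exact: dominatedW (x_dom j).
    - move=> e e0; exists 1 => // p q p0 pq qt _; have -> : A j 0 a = 0 by rewrite linear0 ffunE.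
      rewrite mul0r !subrr normr0.
      by apply: mulr_ge0; [exact: ltW|rewrite subr_ge0 v_mono //; lra].
  have coord a : `|(Y n.+2 t - Y n.+1 t) a| <= (d%:R * L) * 2^-1 ^+ n * K^-1 * E t.
    rewrite [X in `|X| <= _](_ : _ = Y n.+2 t a - Y n.+1 t a); last by rewrite !ffunE.
    have := (@tangent_increment_le _ 0 t v (fun t => Y n.+2 t a - Y n.+1 t a)
      (fun t => (d%:R * L) * 2^-1 ^+ n * K^-1 * E t)
      (fun s t => \sum_j (A j (Y n.+1 s - Y n s)) a * (x t ord0 j - x s ord0 j))).
    rewrite !Y0 subrr subr0 => H.
    apply: (@le_trans _ _ ((d%:R * L) * 2^-1 ^+ n * K^-1 * E t - (d%:R * L) * 2^-1 ^+ n * K^-1 * E 0)).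
      apply: H => //.
      - by move=> *; apply: v_mono => //; lra.
      - move=> p q p0 pq qt; rewrite -mulrBr.
        apply: (le_trans (@increment_sum_le (fun j => A j (Y n.+1 p - Y n p) a)
          (L * (2^-1 ^+ n * E p)) p q p0 pq _ _)); first lra.
          move=> j; apply: (le_trans (nrm_coord _ _)); apply: (le_trans (HL _ _)).
          by apply: ler_wpM2l => //; apply: IH; lra.
        rewrite [leLHS](_ : _ = (d%:R * L) * 2^-1 ^+ n * (E p * (v q - v p))); last by ring.
        rewrite -[leRHS]mulrA; apply: ler_wpM2l; last by apply: Em => //; lra.
        by rewrite mulr_ge0 // exprn_ge0.
      - apply: (@tangentW _ 0 T) => //.
        have := tangentD (Yd n.+2 a).2 (tangentZ (-1) (Yd n.+1 a).2).
        move=> tD e /tD [dl dl0 K1]; exists dl => // p q p0 pq qT pqd.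
        have := K1 p q p0 pq qT pqd; rewrite !mulN1r -sumrB /f.
        congr (`|_ - _| <= _); apply: eq_bigr => j _.
        by rewrite linearB !ffunE; ring.
    rewrite gerBl; apply: mulr_ge0 => //.
    by rewrite !mulr_ge0 ?exprn_ge0 ?invr_ge0 ?(ltW K0).
  apply: (le_trans (nrm_le coord)).
  rewrite exprS [leLHS](_ : _ = (#|I|%:R * (d%:R * L) * K^-1) * (2^-1 ^+ n * E t)); last by ring.
  rewrite -[leRHS]mulrA; apply: ler_wpM2r; first by rewrite mulr_ge0 // exprn_ge0.
  by rewrite ler_pdivrMr // /K; lra.
have ET t : 0 <= t <= T -> E t <= E T.
  move=> /andP[t0 tT]; apply: ler_wpM2l; first exact: nrm_ge0.
  by rewrite ler_expR; apply: ler_wpM2l; [exact: ltW|rewrite lerD2r v_mono].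
have diff n t : 0 <= t <= T -> nrm (Y n.+1 t - Y n t) <= E T * 2^-1 ^+ n.
  move=> tT; apply: (le_trans (diffE n t tT)); rewrite mulrC ler_wpM2r ?exprn_ge0 //.
  exact: ET.
have /choice [yl ylP] : forall ta : R * I, exists l : R, 0 <= ta.1 <= T ->
    (fun n => Y n ta.1 ta.2) @ \oo --> l /\ forall n, `|l - Y n ta.1 ta.2| <= E T * 2 * 2^-1 ^+ n.
  move=> [t a] /=; have [tT|_] := boolP (0 <= t <= T); last by exists 0.
  have [|l l1 l2] := @geometric_cvg _ (fun n => Y n t a) (E T); last by exists l.
  move=> n; apply: le_trans (diff n t tT).
  apply: le_trans (nrm_coord (Y n.+1 t - Y n t) a).
  by rewrite [X in _ <= `|X|](_ : _ = Y n.+1 t a - Y n t a) //; rewrite !ffunE.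
pose y t := [ffun a => yl (t, a)].
have ylim t a : 0 <= t <= T -> (fun n => Y n t a) @ \oo --> y t a.
  by move=> /(ylP (t, a)) [+ _]; rewrite ffunE.
have ydist n t : 0 <= t <= T -> nrm (y t - Y n t) <= #|I|%:R * (E T * 2 * 2^-1 ^+ n).
  move=> tT; apply: nrm_le => a; rewrite !ffunE.
  by have [_ /(_ n)] := ylP (t, a) tT.
have cvgA j t a : 0 <= t <= T -> A j (Y n t) a @[n --> \oo] --> A j (y t) a.
  move=> tT; apply/cvgrPdist_le => e e0.
  have [N HN] := geometric_small (L * (#|I|%:R * (E T * 2))) e0.
  exists N => // n /= /HN; apply: le_trans.
  rewrite [X in `|X| <= _](_ : _ = A j (y t - Y n t) a); last by rewrite linearB !ffunE.
  apply: (le_trans (nrm_coord _ _)); apply: (le_trans (HL _ _)).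
  by rewrite -mulrA -mulrA; apply: ler_wpM2l => //; exact: ydist.
have tyl a : tangent 0 T v (fun t => y t a) (fun s t => \sum_j A j (y s) a * (x t ord0 j - x s ord0 j)).
  apply: (@tangent_lim _ _ _ _ _ _ (fun n t => Y n.+1 t a)
    (fun n s t => \sum_j A j (Y n s) a * (x t ord0 j - x s ord0 j))) => //.
  - by move=> n; exact: (Yd n.+1 a).2.
  - by move=> t tT; have := ylim t a tT; rewrite -(cvg_shiftS (fun n => Y n t a)).
  - move=> s t s0 st tT; apply: cvg_finite_sum => j; apply: cvgMr_tmp.
    by apply: cvgA; rewrite s0 (le_trans st).
  - move=> e e0.
    have [N HN] := geometric_small (d%:R * (L * (2 * (#|I|%:R * (E T * 2))))) e0.
    exists N => n Nn s t s0 st tT; rewrite -sumrB.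
    have sT : 0 <= s <= T by rewrite s0 (le_trans st).
    under eq_bigr do rewrite -mulrBl.
    apply: (le_trans (@increment_sum_le (fun j => A j (Y n s) a - A j (Y N s) a)
      (L * (2 * (#|I|%:R * (E T * 2)) * 2^-1 ^+ N)) s t s0 st tT _)).
      move=> j; rewrite [X in `|X| <= _](_ : _ = A j (Y n s - Y N s) a); last by rewrite linearB !ffunE.
      apply: (le_trans (nrm_coord _ _)); apply: (le_trans (HL _ _)).
      apply: ler_wpM2l => //.
      have -> : Y n s - Y N s = (y s - Y N s) - (y s - Y n s).
        by apply/ffunP => b; rewrite !ffunE; ring.
      apply: (le_trans (nrmB _ _)).
      have h1 := ydist N s sT; have h2 := ydist n s sT.
      have h3 : #|I|%:R * (E T * 2 * 2^-1 ^+ n) <= #|I|%:R * (E T * 2 * 2^-1 ^+ N).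
        apply: ler_wpM2l => //; apply: ler_wpM2l; first by rewrite mulr_ge0.
        by apply: ler_wiXn2l => //; lra.
      lra.
    apply: ler_wpM2r; first by rewrite subr_ge0 v_mono.
    by apply: le_trans (HN N (leqnn _)); rewrite !mulrA.
exists y; split.
  apply/ffunP => a; have T0 : 0 <= (0 : R) <= T by rewrite lexx.
  have c0 : (fun n => Y n.+1 0 a) @ \oo --> y 0 a by rewrite (cvg_shiftS (fun n => Y n 0 a)); exact: ylim.
  have E0 : (fun n => Y n.+1 0 a) = cst (y0 a) by apply/funext => n; rewrite Y0.
  by rewrite E0 in c0; have := cvg_lim (@Rhausdorff R) c0; rewrite lim_cst // => <-.
move=> a; split=> //.
apply: (@dominated_ucont _ 0 T (fun t => d%:R * (L * (#|I|%:R * (E T * 2))) * v t)); first exact: ucontZ.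
move=> s t s0 st tT; rewrite -mulrBr.
apply: (tangent_le T_ge0 _ v_mono (tyl a)) => //.
  by do 3 apply: mulr_ge0 => //; apply: mulr_ge0.
move=> p q p0 pq qT; apply: increment_sum_le => // j.
apply: (le_trans (nrm_coord _ _)); apply: (le_trans (HL _ _)); apply: ler_wpM2l => //.
have := ydist 0%N p; rewrite p0 (le_trans pq) // => /(_ isT).
by rewrite subr0 expr0 mulr1.
Qed.

End LinearODE.

(** * Action of a signature on the states *)

Section WordSums.
Variable d : nat.
Implicit Types (n m : nat) (w : seq 'I_d).

(** Recursion on the first letter makes the splitting of words in [wsum_cat] immediate; [wsum_tuple]
    links it to the sums over tuples in [mx_tensor]. *)
Fixpoint wsum (V : nmodType) n (F : seq 'I_d -> V) : V :=
  if n is m.+1 then \sum_(j < d) wsum m (fun w => F (j :: w)) else F [::].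

Lemma eq_wsum (V : nmodType) n (F G : seq 'I_d -> V) :
  (forall w, size w = n -> F w = G w) -> wsum n F = wsum n G.
Proof.
elim: n F G => [|n IH] F G FG /=; first exact: FG.
by apply: eq_bigr => j _; apply: IH => w sw; apply: FG; rewrite /= sw.
Qed.

Lemma wsum_cat (V : nmodType) n m (F : seq 'I_d -> V) :
  wsum (n + m) F = wsum n (fun u => wsum m (fun w => F (u ++ w))).
Proof. by elim: n F => [|n IH] F //=; apply: eq_bigr => j _; rewrite IH. Qed.

Lemma wsum_additive (V W : nmodType) n (f : {additive V -> W}) (F : seq 'I_d -> V) :
  f (wsum n F) = wsum n (fun w => f (F w)).
Proof.
elim: n F => [|n IH] F //=.
by rewrite raddf_sum; apply: eq_bigr => j _; rewrite IH.
Qed.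

Lemma wsum_sum (V : nmodType) n (J : Type) (r : seq J) (F : J -> seq 'I_d -> V) :
  wsum n (fun w => \sum_(i <- r) F i w) = \sum_(i <- r) wsum n (F i).
Proof.
elim: n F => [|n IH] F //=.
by under eq_bigr do rewrite IH; rewrite exchange_big.
Qed.

Lemma wsum_tuple (V : nmodType) n (F : seq 'I_d -> V) :
  wsum n F = \sum_(w : n.-tuple 'I_d) F w.
Proof.
elim: n F => [|n IH] F /=.
  rewrite (big_pred1 [tuple]) // => w; rewrite !inE.
  by rewrite (tuple0 w) eqxx.
under eq_bigr do rewrite IH.
rewrite pair_big /= (reindex (fun w : n.+1.-tuple 'I_d => (thead w, [tuple of behead w]))) /=.
  by apply: eq_bigr => w _; rewrite {3}(tuple_eta w).
exists (fun jw : 'I_d * n.-tuple 'I_d => [tuple of jw.1 :: jw.2]) => [w _|[j w] _] /=.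
  by rewrite -tuple_eta.
by congr (_, _); apply/val_inj.
Qed.

End WordSums.

Section SignatureAction.
Variables (R : realType) (d : nat) (I : finType).
Variable A : 'I_d -> {linear {ffun I -> R} -> {ffun I -> R}}.
Implicit Types (n m : nat) (w : seq 'I_d) (y z : {ffun I -> R}) (Z : tensor_series R d).

(** The first letter acts first, since it belongs to the innermost integration. *)
Definition act w y := foldl (fun y j => A j y) y w.

Lemma act_is_linear w : linear (act w).
Proof. by elim: w => [|j w IH] c y z //=; rewrite linearP IH. Qed.

HB.instance Definition _ w := GRing.isLinear.Build R {ffun I -> R} {ffun I -> R} _ (act w) (act_is_linear w).

Lemma act_cat u w y : act (u ++ w) y = act w (act u y).
Proof. exact: foldl_cat. Qed.

Definition sigact Z n y := wsum n (fun w => Z w *: act w y).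

Lemma sigact_is_linear Z n : linear (sigact Z n).
Proof.
move=> c y z; rewrite /sigact.
rewrite (@eq_wsum _ _ n _ (fun w => \sum_(b : bool)
  if b then c *: (Z w *: act w y) else Z w *: act w z)); last first.
  by move=> w _; rewrite big_bool /= linearP scalerDr !scalerA (mulrC c).
by rewrite wsum_sum big_bool /= -(wsum_additive n (GRing.scale c)).
Qed.

HB.instance Definition _ Z n := GRing.isLinear.Build R {ffun I -> R} {ffun I -> R} _ (sigact Z n) (sigact_is_linear Z n).

Lemma sigact0 Z y : Z [::] = 1 -> sigact Z 0 y = y.
Proof. by move=> Z0; rewrite /sigact /= Z0 scale1r. Qed.

Lemma sigact1 Z y : sigact Z 1 y = \sum_j Z [:: j] *: A j y.
Proof. by []. Qed.

Lemma eq_sigact Z Z' n y : (forall w, size w = n -> Z w = Z' w) ->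
  sigact Z n y = sigact Z' n y.
Proof. by move=> H; apply: eq_wsum => w /H ->. Qed.

Lemma sigact_sub Z Z' n y : sigact Z n y - sigact Z' n y = sigact (fun w => Z w - Z' w) n y.
Proof.
rewrite /sigact [RHS](@eq_wsum _ _ n _ (fun w => \sum_(b : bool)
  if b then Z w *: act w y else - (Z' w *: act w y))).
  by rewrite wsum_sum big_bool /= -(wsum_additive n -%R).
by move=> w _; rewrite big_bool /= scalerBl.
Qed.

(** Cut at position [i], a word factors both in the coefficient and in the action, because [act]
    turns concatenation into composition. *)
Lemma sigact_chen Z1 Z2 n y :
  sigact (tensor_mul Z1 Z2) n y = \sum_(i < n.+1) sigact Z2 (n - i) (sigact Z1 i y).
Proof.
rewrite {1}/sigact (@eq_wsum _ _ n _ (fun w => \sum_(i < n.+1)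
  (Z1 (take i w) * Z2 (drop i w)) *: act w y)); last first.
  by move=> w sw; rewrite /tensor_mul scaler_suml sw.
rewrite wsum_sum; apply: eq_bigr => -[i ni] _ /=.
rewrite -{1}(subnKC (n := n) (m := i)) // wsum_cat.
rewrite [sigact Z1 i y]/sigact (wsum_additive i (sigact Z2 (n - i))).
apply: eq_wsum => u su; apply: eq_wsum => w _.
by rewrite -su take_size_cat // drop_size_cat // act_cat linearZ /= scalerA mulrC.
Qed.

Lemma nrm_wsum n (F : seq 'I_d -> {ffun I -> R}) (C : R) :
  (forall w, size w = n -> nrm (F w) <= C) -> nrm (wsum n F) <= d%:R ^+ n * C.
Proof.
elim: n F => [|n IH] F H /=; first by rewrite expr0 mul1r; exact: H.
apply: (le_trans (nrm_sum _ _ _)).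
apply: (@le_trans _ _ (\sum_(j < d) d%:R ^+ n * C)).
  by apply: ler_sum => j _; apply: IH => w sw; apply: H; rewrite /= sw.
by rewrite sumr_const card_ord exprS -mulrA mulr_natl.
Qed.

Variable L : R.
Hypotheses (L_ge0 : 0 <= L) (A_le : forall j y, nrm (A j y) <= L * nrm y).

Lemma nrm_act w y : nrm (act w y) <= L ^+ size w * nrm y.
Proof.
elim: w y => [|j w IH] y /=; first by rewrite expr0 mul1r.
apply: (le_trans (IH _)); rewrite exprSr -mulrA.
by apply: ler_wpM2l => //; rewrite exprn_ge0.
Qed.

Lemma nrm_sigact Z n y (c : R) : 0 <= c -> (forall w, size w = n -> `|Z w| <= c) ->
  nrm (sigact Z n y) <= c * (d%:R * L) ^+ n * nrm y.
Proof.
move=> c0 H; have -> : c * (d%:R * L) ^+ n * nrm y = d%:R ^+ n * (c * (L ^+ n * nrm y)).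
  by rewrite exprMn; ring.
apply: nrm_wsum => w sw; rewrite nrmZ; apply: ler_pM => //; first exact: nrm_ge0.
  exact: H.
by rewrite -sw; exact: nrm_act.
Qed.

End SignatureAction.

Lemma sum_triangle (V : nmodType) (a : nat -> nat -> V) m :
  \sum_(i < m) \sum_(j < m - i) a i j = \sum_(n < m) \sum_(i < n.+1) a i (n - i)%N.
Proof.
elim: m => [|m IH]; first by rewrite !big_ord0.
rewrite big_ord_recr [RHS]big_ord_recr /= subSnn big_ord1 -IH big_ord_recr /= subnn addrA.
rewrite -big_split; congr (_ + _); apply: eq_bigr => i _ /=.
by rewrite subSn ?big_ord_recr // ltnW.
Qed.

(** What remains of the square of indices is where the total degree [i + j] is at least [m]: exactly
    the terms that truncation drops from a product. *)
Lemma sum_square (V : zmodType) (a : nat -> nat -> V) m :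
  \sum_(i < m) \sum_(j < m) a i j - \sum_(n < m) \sum_(i < n.+1) a i (n - i)%N =
  \sum_(i < m) \sum_(j < i) a i (m - i + j)%N.
Proof.
rewrite -sum_triangle -sumrB; apply: eq_bigr => i _.
have im := subnK (ltnW (ltn_ord i)).
have -> : \sum_(j < m) a i j = \sum_(j < m - i + i) a i j by rewrite im.
by rewrite big_split_ord /= addrAC subrr add0r.
Qed.

(** * The full word series as a multiplicative operator *)

Section FullSignatureAction.
Variables (R : realType) (d : nat) (I : finType).
Variable A : 'I_d -> {linear {ffun I -> R} -> {ffun I -> R}}.
Variables (L : R) (kap : nat -> R) (Om : R).
Hypotheses (L_ge0 : 0 <= L) (A_le : forall j y, nrm (A j y) <= L * nrm y).
Hypotheses (kap_ge0 : forall n, 0 <= kap n) (Om_ge0 : 0 <= Om).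
Hypothesis kap_small : forall r : R, 0 <= r -> exists C : R, forall n, kap n * r ^+ n <= C.
Implicit Types (n m : nat) (w : seq 'I_d) (y z : {ffun I -> R}) (Z : tensor_series R d) (om : R).

Local Notation sigact := (sigact A).

(** In the application [kap n] is the inverse of [gamma] times (n/p)! for positive [n], and [om] is
    the root of order p of an increment of the control. *)
Definition sig_bounded Z om :=
  [/\ 0 <= om <= Om, Z [::] = 1 & forall w, `|Z w| <= kap (size w) * om ^+ size w].

Definition psum Z n y := \sum_(i < n) sigact Z i y.

Definition sigop Z y : {ffun I -> R} := [ffun a => limn (fun n => psum Z n y a)].

Lemma psumB Z n y z : psum Z n (y - z) = psum Z n y - psum Z n z.
Proof. by rewrite -sumrB; apply: eq_bigr => i _; rewrite linearB. Qed.

(** The factor [om ^+ k] is kept as smallness in time, the other powers of [om] are bounded through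
    [Om], and the decay of [kap] beats [(4 * r) ^+ n]. Of the rate 1/4, one factor 1/2 is later
    spent on summation and the other survives as a rate of convergence. *)
Lemma sigact_decay : exists2 C : R, 0 <= C & forall Z om k n y,
  sig_bounded Z om -> (k <= n)%N -> nrm (sigact Z n y) <= C * om ^+ k * 4^-1 ^+ n * nrm y.
Proof.
set r := d%:R * L * (Om + 1).
have q0 : 0 <= d%:R * L by rewrite mulr_ge0.
have r0 : 0 <= r by rewrite /r mulr_ge0 // addr_ge0.
have r40 : 0 <= 4 * r by rewrite mulr_ge0.
have [C HC] := kap_small r40.
have C0 : 0 <= C by apply: le_trans (HC 0); rewrite expr0 mulr1.
exists C => // Z om k n y [/andP[om0 omO] _ HZ] kn.
have h : forall w, size w = n -> `|Z w| <= kap n * om ^+ n by move=> w <-.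
apply: (le_trans (nrm_sigact L_ge0 A_le y _ h)).
  by rewrite mulr_ge0 // exprn_ge0.
apply: ler_wpM2r; first exact: nrm_ge0.
have -> : om ^+ n = om ^+ k * om ^+ (n - k) by rewrite -exprD subnKC.
rewrite [leLHS](_ : _ = om ^+ k * (kap n * (om ^+ (n - k) * (d%:R * L) ^+ n))); last by ring.
rewrite [leRHS](_ : _ = om ^+ k * (C * 4^-1 ^+ n)); last by ring.
apply: ler_wpM2l; first by rewrite exprn_ge0.
have : om ^+ (n - k) * (d%:R * L) ^+ n <= r ^+ n.
  have -> : r ^+ n = (d%:R * L) ^+ n * (Om + 1) ^+ n by rewrite /r -exprMn.
  rewrite mulrC; apply: ler_wpM2l; first by rewrite exprn_ge0.
  apply: (@le_trans _ _ ((Om + 1) ^+ (n - k))); last first.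
    by apply: ler_weXn2l; [lra|exact: leq_subr].
  by apply: lerXn2r; rewrite ?nnegrE; lra.
move=> /(ler_wpM2l (kap_ge0 n)) /le_trans; apply.
have := HC n; rewrite exprMn => h2.
by rewrite exprVn ler_pdivlMr ?exprn_gt0 // [leLHS]mulrC mulrCA.
Qed.

Lemma expr4 n : (4^-1 : R) ^+ n = 2^-1 ^+ n * 2^-1 ^+ n.
Proof. by rewrite -exprMn; congr (_ ^+ _); field. Qed.

(** A geometric series bounds the tail. The case [k = 0] gives the rate of convergence, while
    [k = m = N.+1] gives a tail of the same order in time as the first omitted level. *)
Lemma sigop_approx : exists2 C : R, 0 <= C & forall Z om k m y,
  sig_bounded Z om -> (k <= m)%N ->
  (forall a, (fun n => psum Z n y a) @ \oo --> sigop Z y a) /\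
  nrm (sigop Z y - psum Z m y) <= C * om ^+ k * 2^-1 ^+ m * nrm y.
Proof.
have [C C0 HC] := sigact_decay.
exists (#|I|%:R * (C * 2)); first by rewrite !mulr_ge0.
move=> Z om k m y bZ km; have [/andP[om0 omO] _ _] := bZ.
have main a : (fun n => psum Z n y a) @ \oo --> sigop Z y a /\
    `|sigop Z y a - psum Z m y a| <= C * om ^+ k * 2^-1 ^+ m * nrm y * 2.
  have [|l l1 l2] := @geometric_cvg _ (fun n => psum Z (n + m) y a) (C * om ^+ k * 2^-1 ^+ m * nrm y).
    move=> n; rewrite /psum addSn big_ord_recr /= ffunE addrAC subrr add0r.
    apply: (le_trans (nrm_coord _ _)).
    apply: (le_trans (HC Z om k (n + m)%N y bZ (leq_trans km (leq_addl _ _)))).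
    rewrite [leRHS]mulrAC; apply: ler_wpM2r; first exact: nrm_ge0.
    rewrite -!mulrA; apply: ler_wpM2l => //; apply: ler_wpM2l; first by rewrite exprn_ge0.
    rewrite mulrC -exprD expr4 ler_piMr ?exprn_ge0 //.
    by apply: exprn_ile1; lra.
  have l3 : (fun n => psum Z n y a) @ \oo --> l by rewrite -(cvg_shiftn m).
  have -> : sigop Z y a = l by rewrite ffunE; exact: (cvg_lim (@Rhausdorff R) l3).
  by split=> //; have := l2 0%N; rewrite add0n expr0 mulr1.
split=> [a|]; first exact: (main a).1.
rewrite [leRHS](_ : _ = #|I|%:R * (C * om ^+ k * 2^-1 ^+ m * nrm y * 2)); last by ring.
by apply: nrm_le => a; have [_] := main a; rewrite !ffunE.
Qed.

Lemma sigop_cvg Z om y a : sig_bounded Z om ->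
  (fun n => psum Z n y a) @ \oo --> sigop Z y a.
Proof. by have [C _ H] := sigop_approx => /(H Z om 0%N 0%N y)/(_ isT) []. Qed.

Lemma sigopB Z om y z : sig_bounded Z om -> sigop Z (y - z) = sigop Z y - sigop Z z.
Proof.
move=> bZ; apply/ffunP => a.
have -> : (sigop Z y - sigop Z z) a = sigop Z y a - sigop Z z a by rewrite !ffunE.
have c1 := @sigop_cvg Z om (y - z) a bZ.
have c2 : (fun n => psum Z n (y - z) a) @ \oo --> sigop Z y a - sigop Z z a.
  have -> : (fun n => psum Z n (y - z) a) = (fun n => psum Z n y a - psum Z n z a).
    by apply/funext => n; rewrite psumB !ffunE.
  by apply: cvgB; apply: sigop_cvg bZ.
by rewrite -(cvg_lim (@Rhausdorff R) c1) (cvg_lim (@Rhausdorff R) c2).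
Qed.

Lemma psum_bounded : exists2 C : R, 0 <= C & forall Z om n y,
  sig_bounded Z om -> nrm (psum Z n y) <= C * nrm y.
Proof.
have [C C0 HC] := sigact_decay.
exists (C * 2); first by rewrite mulr_ge0.
move=> Z om n y bZ; rewrite /psum.
suff : nrm (\sum_(i < n) sigact Z i y) <= C * (2 - 2 * 2^-1 ^+ n) * nrm y.
  move=> /le_trans; apply; apply: ler_wpM2r; first exact: nrm_ge0.
  by apply: ler_wpM2l => //; rewrite gerBl mulr_ge0 // exprn_ge0.
elim: n => [|n IH]; first by rewrite big_ord0 nrm0 expr0 mulr1 subrr mulr0 mul0r.
rewrite big_ord_recr /=; apply: (le_trans (nrmD _ _)).
have := HC Z om 0%N n y bZ (leq0n _); rewrite expr0 mulr1 exprS => h.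
have h4 : C * 4^-1 ^+ n * nrm y <= C * 2^-1 ^+ n * nrm y.
  apply: ler_wpM2r; first exact: nrm_ge0.
  apply: ler_wpM2l => //; rewrite expr4 ler_piMr ?exprn_ge0 //.
  by apply: exprn_ile1; lra.
apply: (le_trans (lerD IH (le_trans h h4))).
by rewrite -mulrDl -mulrDr ler_wpM2r ?nrm_ge0 // ler_wpM2l //; lra.
Qed.

Lemma sigop_bounded : exists2 C : R, 0 <= C & forall Z om y,
  sig_bounded Z om -> nrm (sigop Z y) <= C * nrm y.
Proof.
have [C1 C10 H1] := psum_bounded; have [C2 C20 H2] := sigop_approx.
exists (C2 + C1); first by rewrite addr_ge0.
move=> Z om y bZ; have [_] := H2 Z om 0%N 0%N y bZ (leqnn _).
rewrite !expr0 !mulr1 => h; have := H1 Z om 0%N y bZ.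
have := nrmD (sigop Z y - psum Z 0 y) (psum Z 0 y); rewrite subrK mulrDl; lra.
Qed.

Lemma psum_chen Z1 Z2 m y : psum Z2 m (psum Z1 m y) - psum (tensor_mul Z1 Z2) m y =
  \sum_(i < m) \sum_(j < i) sigact Z2 (m - i + j) (sigact Z1 i y).
Proof.
rewrite -(sum_square (fun i j => sigact Z2 j (sigact Z1 i y))); congr (_ - _).
  by rewrite exchange_big; apply: eq_bigr => j _; rewrite linear_sum.
by apply: eq_bigr => n _; exact: sigact_chen.
Qed.

(** Truncated actions compose up to terms of total degree at least [n], which sum to [O(2^-n)];
    hence the limits compose exactly. *)
Lemma sigop_chen Z1 Z2 Z om1 om2 om y : sig_bounded Z1 om1 -> sig_bounded Z2 om2 ->
  sig_bounded Z om -> (forall w, tensor_mul Z1 Z2 w = Z w) ->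
  sigop Z2 (sigop Z1 y) = sigop Z y.
Proof.
move=> b1 b2 b H.
have [C C0 HC] := sigop_approx; have [D D0 HD] := psum_bounded.
have [F F0 HF] := sigop_bounded; have [G G0 HG] := sigact_decay.
set K := C * (F * nrm y) + D * (C * nrm y) + G * G * nrm y * 4 + C * nrm y.
have key n : nrm (sigop Z2 (sigop Z1 y) - sigop Z y) <= K * 2^-1 ^+ n.
  set q : R := 2^-1 ^+ n.
  have q0 : 0 <= q by rewrite exprn_ge0.
  rewrite (_ : _ - _ = (sigop Z2 (sigop Z1 y) - psum Z2 n (sigop Z1 y)) +
    psum Z2 n (sigop Z1 y - psum Z1 n y) +
    (psum Z2 n (psum Z1 n y) - psum (tensor_mul Z1 Z2) n y) - (sigop Z y - psum Z n y)); last first.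
    rewrite psumB (_ : psum (tensor_mul _ _) n y = psum Z n y).
      by apply/ffunP => a; rewrite !ffunE; ring.
    by apply: eq_bigr => i _; apply: eq_sigact => w _.
  apply: (le_trans (nrmB _ _)); apply: (le_trans (lerD (nrmD _ _) (lexx _))).
  apply: (le_trans (lerD (lerD (nrmD _ _) (lexx _)) (lexx _))).
  have h1 : nrm (sigop Z2 (sigop Z1 y) - psum Z2 n (sigop Z1 y)) <= C * (F * nrm y) * q.
    have [_] := HC Z2 om2 0%N n (sigop Z1 y) b2 (leq0n _).
    rewrite expr0 mulr1 => /le_trans; apply; rewrite mulrAC; apply: ler_wpM2r => //.
    by apply: ler_wpM2l => //; exact: HF b1.
  have h2 : nrm (psum Z2 n (sigop Z1 y - psum Z1 n y)) <= D * (C * nrm y) * q.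
    apply: (le_trans (HD _ _ _ _ b2)); rewrite -mulrA; apply: ler_wpM2l => //.
    have [_] := HC Z1 om1 0%N n y b1 (leq0n _).
    by rewrite expr0 mulr1 mulrAC.
  have h4 : nrm (sigop Z y - psum Z n y) <= C * nrm y * q.
    have [_] := HC Z om 0%N n y b (leq0n _).
    by rewrite expr0 mulr1 mulrAC.
  have h3 : nrm (psum Z2 n (psum Z1 n y) - psum (tensor_mul Z1 Z2) n y) <= G * G * nrm y * 4 * q.
    rewrite psum_chen.
    have t i j : (i < n)%N -> (j < i)%N -> nrm (sigact Z2 (n - i + j) (sigact Z1 i y)) <=
        G * G * nrm y * q * (2^-1 ^+ i * 2^-1 ^+ j).
      move=> ni ji.
      have := HG Z2 om2 0%N (n - i + j)%N (sigact Z1 i y) b2 (leq0n _).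
      have := HG Z1 om1 0%N i y b1 (leq0n _); rewrite expr0 !mulr1 => k1 k2.
      apply: (le_trans k2).
      have g0 m : 0 <= G * 4^-1 ^+ m by rewrite mulr_ge0 // exprn_ge0 // invr_ge0.
      apply: (le_trans (ler_wpM2l (g0 _) k1)).
      rewrite [leLHS](_ : _ = G * G * nrm y * (4^-1 ^+ (n - i + j) * 4^-1 ^+ i)); last by ring.
      rewrite -[leRHS]mulrA; apply: ler_wpM2l; first by rewrite !mulr_ge0 ?nrm_ge0.
      (* The total degree is [n + j]. Half of the decay contains the rate [q]; the rest is spent on
         summability in [j] and in [i <= n]. *)
      have -> : 4^-1 ^+ (n - i + j) * 4^-1 ^+ i = q * (2^-1 ^+ j * 2^-1 ^+ (n + j)) :> R.
        by rewrite -[LHS]exprD addnAC subnK ?(ltnW ni) // expr4 exprD -/q -[LHS]mulrA.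
      apply: ler_wpM2l => //; rewrite [leRHS]mulrC; apply: ler_wpM2l; first by rewrite exprn_ge0.
      by apply: ler_wiXn2l; [lra|lra|rewrite (leq_trans (ltnW ni)) // leq_addr].
    apply: (le_trans (nrm_sum _ _ _)).
    apply: (@le_trans _ _ (\sum_(i < n) \sum_(j < i) G * G * nrm y * q * (2^-1 ^+ i * 2^-1 ^+ j))).
      by apply: ler_sum => i _; apply: (le_trans (nrm_sum _ _ _)); apply: ler_sum => j _; exact: t.
    rewrite [leRHS](_ : _ = G * G * nrm y * q * 4); last by ring.
    under eq_bigr do rewrite -mulr_sumr -mulr_sumr.
    rewrite -mulr_sumr; apply: ler_wpM2l; first by rewrite !mulr_ge0 ?nrm_ge0.
    have g m : \sum_(i < m) (2^-1 : R) ^+ i <= 2.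
      suff : \sum_(i < m) (2^-1 : R) ^+ i <= 2 - 2 * 2^-1 ^+ m.
        have : (0 : R) <= 2^-1 ^+ m by rewrite exprn_ge0.
        lra.
      elim: m => [|m IH]; first by rewrite big_ord0 expr0; lra.
      by rewrite big_ord_recr /= exprS; lra.
    apply: (@le_trans _ _ (\sum_(i < n) (2^-1 : R) ^+ i * 2)).
      by apply: ler_sum => i _; apply: ler_wpM2l => //; rewrite exprn_ge0.
    by rewrite -mulr_suml; have := g n; lra.
  rewrite /K; lra.
apply/eqP; rewrite -subr_eq0; apply/eqP; apply: nrm_eq0.
apply/ler_addgt0Pr => e e0; rewrite add0r.
by have [N HN] := geometric_small K e0; apply: (le_trans (key N)); exact: HN.
Qed.

End FullSignatureAction.

(** * Rough drivers *)

Section Sewing.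
Variable R : realType.
Implicit Types (a b s t u : R) (U : R -> R).

(** [U] is only monotone and may jump, so no single point need halve its increment. Two points less
    than [dl] apart are taken around the supremum of the times that use at most half of it. *)
Lemma half_split U s t dl : 0 < dl -> s <= t ->
  (forall x y, s <= x -> x <= y -> y <= t -> U x <= U y) ->
  exists u1 u2, [/\ s <= u1, u1 <= u2, u2 <= t, u2 - u1 < dl &
    U u1 - U s <= (U t - U s) / 2 /\ U t - U u2 <= (U t - U s) / 2].
Proof.
move=> dl0 st Um; have Ust := Um s t (lexx s) st (lexx t).
pose E := [set u | s <= u <= t /\ U u - U s <= (U t - U s) / 2].
have Es : E s by rewrite /E /= lexx st; split => //; lra.
have hE : has_sup E.
  by split; [exists s|exists t => u [/andP[]]].
have [u1 [/andP[su1 u1t] Uu1] u1s] := sup_adherent (divr_gt0 dl0 (ltr0n R 2)) hE.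
have dl40 : 0 < dl / 4 by lra.
have u1sup : u1 <= sup E by apply: ub_le_sup; [exact: hE.2|split; rewrite ?su1].
exists u1, (Num.min t (sup E + dl / 4)).
have minle : Num.min t (sup E + dl / 4) <= sup E + dl / 4 by rewrite ge_min lexx orbT.
split => //; first by rewrite le_min u1t; lra.
- by rewrite ge_min lexx.
- lra.
split => //; have [tE|tE] := leP t (sup E + dl / 4); first by lra.
rewrite leNgt; apply/negP => H.
have : sup E + dl / 4 <= sup E.
  apply: ub_le_sup; first exact: hE.2.
  by split; lra.
lra.
Qed.

(* Each half of U carries the factor 2^-theta < 1/2, so that the a priori     *)
(* bound K improves geometrically to one that does not depend on K.           *)
Lemma sewing a b (U : R -> R) (Rm : R -> R -> R) (theta eps C K kappa : R) :
  0 <= theta -> 0 <= eps <= 1 -> 0 <= C -> 0 <= K ->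
  (1 + (1 + eps) ^+ 2) * (2^-1 `^ theta) <= kappa -> kappa < 1 ->
  (forall s t, a <= s -> s <= t -> t <= b -> U s <= U t) ->
  (forall s u t, a <= s -> s <= u -> u <= t -> t <= b ->
     Rm s t <= Rm u t + (1 + eps) * Rm s u + C * (U t - U s) `^ theta) ->
  (forall s t, a <= s -> s <= t -> t <= b -> Rm s t <= K * (U t - U s) `^ theta) ->
  (forall e, 0 < e -> exists2 dl : R, 0 < dl & forall s t, a <= s -> s <= t -> t <= b ->
     t - s < dl -> Rm s t <= e) ->
  forall s t, a <= s -> s <= t -> t <= b ->
    Rm s t <= 3 * C / (1 - kappa) * (U t - U s) `^ theta.
Proof.
move=> th0 /andP[e0 e1] C0 K0 kP k1 Um sub rough small.
set G := 3 * C / (1 - kappa).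
have kp0 : 0 <= (2^-1 : R) `^ theta by exact: powR_ge0.
have k0 : 0 <= kappa.
  by apply: le_trans kP; apply: mulr_ge0 => //; rewrite addr_ge0 // exprn_ge0 //; lra.
have G0 : 0 <= G by rewrite /G; apply: divr_ge0; lra.
have main n : forall s t, a <= s -> s <= t -> t <= b ->
    Rm s t <= (kappa ^+ n * K + G) * (U t - U s) `^ theta.
  elim: n => [|n IH] s t as_ st tb.
    apply: (le_trans (rough s t as_ st tb)); apply: ler_wpM2r; first exact: powR_ge0.
    by rewrite expr0 mul1r lerDl.
  set P := (U t - U s) `^ theta.
  have P0 : 0 <= P by exact: powR_ge0.
  set B := kappa ^+ n * K + G.
  have B0 : 0 <= B by rewrite addr_ge0 // mulr_ge0 // exprn_ge0.
  apply/ler_addgt0Pr => e2 e20.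
  have [dl dl0 Hdl] := small (e2 / 2) (divr_gt0 e20 (ltr0n R 2)).
  have [|u1 [u2 [su1 u12 u2t du [U1 U2]]]] := half_split dl0 st (U := U).
    by move=> *; apply: Um => //; lra.
  have as1 : a <= u1 by lra.
  have as2 : a <= u2 by lra.
  have ust := Um s t as_ st tb.
  have half z : 0 <= z -> z <= (U t - U s) / 2 -> z `^ theta <= 2^-1 `^ theta * P.
    move=> z0 zh; rewrite -powRM //; last lra.
    by apply: ge0_ler_powR; rewrite ?nnegrE //; lra.
  (* The interval is cut at [u2], then [[s, u2]] at [u1]. The outer pieces carry at most half of [U]
     each, the middle one is short enough to contribute at most [e2], and the two defects cost at
     most [3 * C * P]. *)
  have h1 : Rm s t <= Rm u2 t + (1 + eps) * Rm s u2 + C * P by apply: sub => //; lra.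
  have h2 : Rm s u2 <= Rm u1 u2 + (1 + eps) * Rm s u1 + C * P.
    apply: (le_trans (sub s u1 u2 as_ su1 u12 _)); first lra.
    rewrite lerD2l; apply: ler_wpM2l => //; apply: ge0_ler_powR => //; rewrite ?nnegrE ?subr_ge0.
    - by apply: Um => //; lra.
    - exact: ust.
    - by rewrite lerD2r; apply: Um => //; lra.
  have h3 : Rm u1 u2 <= e2 / 2 by apply: Hdl => //; lra.
  have h4 : Rm u2 t <= B * (2^-1 `^ theta * P).
    apply: (le_trans (IH u2 t _ _ _)) => //; apply: ler_wpM2l => //; apply: half => //.
    by rewrite subr_ge0; apply: Um.
  have h5 : Rm s u1 <= B * (2^-1 `^ theta * P).
    apply: (le_trans (IH s u1 _ _ _)) => //; first lra.
    apply: ler_wpM2l => //; apply: half => //.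
    by rewrite subr_ge0; apply: Um => //; lra.
  have h6 : (1 + eps) * Rm s u2 <= (1 + eps) * (e2 / 2 + (1 + eps) * (B * (2^-1 `^ theta * P)) + C * P).
    apply: ler_wpM2l; first lra.
    have : (1 + eps) * Rm s u1 <= (1 + eps) * (B * (2^-1 `^ theta * P)) by apply: ler_wpM2l => //; lra.
    lra.
  have h7 : (1 + (1 + eps) ^+ 2) * (2^-1 `^ theta) * (B * P) <= kappa * (B * P).
    by apply: ler_wpM2r => //; rewrite mulr_ge0.
  have h8 : eps * (C * P) <= C * P by rewrite ler_piMl // mulr_ge0.
  have h9 : eps * (e2 / 2) <= e2 / 2 by rewrite ler_piMl //; lra.
  have Gk : kappa * G + 3 * C = G.
    by rewrite /G; field; rewrite gt_eqF // subr_gt0.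
  have -> : (kappa ^+ n.+1 * K + G) * P = kappa * (B * P) + 3 * C * P.
    by rewrite -{1}Gk /B exprS; ring.
  have E : (1 + (1 + eps) ^+ 2) * (2^-1 `^ theta) * (B * P) =
    B * (2^-1 `^ theta * P) + (1 + eps) * ((1 + eps) * (B * (2^-1 `^ theta * P))) by ring.
  move: h6; rewrite !(mulrDr (1 + eps) (_ + _)) (mulrDr (1 + eps) (e2 / 2)) => h6.
  lra.
move=> s t as_ st tb; set P := (U t - U s) `^ theta.
have c : (kappa ^+ n * K + G) * P @[n --> \oo] --> (0 * K + G) * P.
  apply: cvgMr_tmp; apply: cvgD; last exact: cvg_cst.
  by apply: cvgMr_tmp; apply: cvg_expr; rewrite ger0_norm.
rewrite mul0r add0r in c.
apply/ler_addgt0Pr => e e00.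
have /(_ _ (G * P + e)) := cvgr_le _ c; rewrite ltrDl => /(_ e00) [n _ Hn].
by apply: (le_trans (main n s t as_ st tb)); apply: Hn => /=.
Qed.

End Sewing.

(** * Remainder for a single driver of bounded variation *)

Section BVRemainder.
Variables (R : realType) (d : nat) (I : finType) (T : R) (x : R -> 'rV[R]_d) (v : R -> R).
Hypotheses (T_ge0 : 0 <= T) (v_ucont : ucont 0 T v)
  (v_mono : forall s t, 0 <= s -> s <= t -> t <= T -> v s <= v t)
  (x_dom : forall i, dominated 0 T v (fun t => x t ord0 i)).
Variable A : 'I_d -> {linear {ffun I -> R} -> {ffun I -> R}}.
Variables (y0 : {ffun I -> R}) (y : R -> {ffun I -> R}).
Hypothesis y_ode : linear_ode T x v A y0 y.

Lemma linear_ode_bounded : exists2 C : R, 0 <= C & forall t, 0 <= t <= T -> nrm (y t) <= C.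
Proof.
have /choice [C HC] : forall a, exists C : R, forall t, 0 <= t <= T -> `|y t a| <= C.
  by move=> a; have [C _ H] := ucont_bounded (y_ode.2 a).1; exists C.
exists (\sum_a C a); last by move=> t tT; apply: ler_sum => a _; exact: HC.
apply: sumr_ge0 => a _; apply: le_trans (HC a 0 _) => //; by rewrite lexx.
Qed.

(** The first order expansion is already exact up to the square of [v], and each level from 2 on is
    of that order too; [N.+2] ensures that levels 0 and 1 are present. [K] depends on the driver and
    only supplies the a priori bound for [sewing]. *)
Lemma bv_remainder N : exists2 K : R, 0 <= K & forall s t, 0 <= s -> s <= t -> t <= T ->
  nrm (y t - psum A (path_signature x s t) N.+2 (y s)) <= K * (v t - v s) ^+ 2.
Proof.
have [L L0 HL] := linear_bounded_all A; have [C C0 HC] := linear_ode_bounded.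
set q := d%:R * L; have q0 : 0 <= q by rewrite mulr_ge0.
set I1 : R := #|I|%:R.
have I0 : 0 <= I1 by exact: ler0n.
have lip s t : 0 <= s -> s <= t -> t <= T -> nrm (y t - y s) <= I1 * (q * C * (v t - v s)).
  move=> s0 st tT; apply: nrm_le => a.
  have -> : (y t - y s) a = y t a - y s a by rewrite !ffunE.
  apply: (tangent_le T_ge0 _ v_mono (y_ode.2 a).2) => //; first by rewrite mulr_ge0.
  move=> p r p0 pr rT; rewrite /q -mulrA.
  apply: (le_trans (@increment_sum_le _ d T x v x_dom (fun j => A j (y p) a) (L * C) p r p0 pr rT _)); last by rewrite !mulrA.
  move=> j; apply: (le_trans (nrm_coord _ _)); apply: (le_trans (HL _ _)).
  by apply: ler_wpM2l => //; apply: HC; rewrite p0 (le_trans pr).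
have first s t : 0 <= s -> s <= t -> t <= T ->
    nrm (y t - y s - \sum_j (x t ord0 j - x s ord0 j) *: A j (y s)) <=
    I1 * (q * (I1 * (q * C)) * (v t - v s) ^+ 2).
  move=> s0 st tT; apply: nrm_le => a.
  have -> : (y t - y s - \sum_j (x t ord0 j - x s ord0 j) *: A j (y s)) a =
      (y t a - \sum_j A j (y s) a * x t ord0 j) - (y s a - \sum_j A j (y s) a * x s ord0 j).
    rewrite !ffunE sum_ffunE.
    rewrite (eq_bigr (fun j => A j (y s) a * x t ord0 j - A j (y s) a * x s ord0 j)); last first.
      by move=> j _; rewrite ffunE /GRing.scale /=; ring.
    by rewrite sumrB; ring.
  set c := q * _.
  have -> : c * (v t - v s) ^+ 2 = (c * (v t - v s)) * (v t - v s) by ring.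
  have c0 : 0 <= c by rewrite !mulr_ge0.
  (* [y] minus its linear part: the germ of [z] has the coefficients [A j (y p - y s)], already of
     order [v]. *)
  pose z r := y r a - \sum_j A j (y s) a * x r ord0 j.
  apply: (@tangent_le _ s t v z (fun p r => \sum_j (A j (y p - y s) a) * (x r ord0 j - x p ord0 j))) => //.
  - by rewrite mulr_ge0 // subr_ge0 v_mono.
  - by move=> *; apply: v_mono => //; lra.
  - move=> e /(tangentW s0 tT (y_ode.2 a).2) [dl dl0 H]; exists dl => // p r sp pr rt pd.
    have := H p r sp pr rt pd; congr (`|_| <= _).
    rewrite /z; have -> : \sum_j (A j (y p - y s)) a * (x r ord0 j - x p ord0 j) =
      \sum_j (A j (y p)) a * (x r ord0 j - x p ord0 j) -
      (\sum_j A j (y s) a * x r ord0 j - \sum_j A j (y s) a * x p ord0 j).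
      by rewrite -!sumrB; apply: eq_bigr => j _; rewrite linearB !ffunE; ring.
    by ring.
  - move=> p r sp pr rt.
    apply: (le_trans (@increment_sum_le _ d T x v x_dom _ (L * (I1 * (q * C * (v t - v s)))) p r _ _ _ _)) => //; try lra.
      move=> j; apply: (le_trans (nrm_coord _ _)); apply: (le_trans (HL _ _)).
      apply: ler_wpM2l => //; apply: (le_trans (lip s p _ _ _)) => //; first lra.
      apply: ler_wpM2l => //; apply: ler_wpM2l; first by rewrite mulr_ge0.
      by rewrite lerD2r v_mono //; lra.
    by rewrite /c /q le_eqVlt; apply/orP; left; apply/eqP; ring.
set V := v T - v 0.
have V0 : 0 <= V by rewrite subr_ge0 v_mono.
exists (I1 * (q * (I1 * (q * C))) + \sum_(i < N) V ^+ i * q ^+ i.+2 * C).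
  apply: addr_ge0; first by rewrite !mulr_ge0.
  by apply: sumr_ge0 => i _; do 2 apply: mulr_ge0 => //; exact: exprn_ge0.
move=> s t s0 st tT.
have sT : 0 <= s <= T by rewrite s0 (le_trans st).
set Z := path_signature x s t.
have -> : y t - psum A Z N.+2 (y s) =
    (y t - y s - \sum_j (x t ord0 j - x s ord0 j) *: A j (y s)) -
    \sum_(i < N) sigact A Z i.+2 (y s).
  have E1 : sigact A Z 1 (y s) = \sum_j (x t ord0 j - x s ord0 j) *: A j (y s).
    by rewrite sigact1; apply: eq_bigr => j _; rewrite /Z (path_signature1 v_mono x_dom).
  by rewrite /psum 2!big_ord_recl sigact0 // -E1 !opprD !addrA.
apply: (le_trans (nrmB _ _)); rewrite mulrDl; apply: lerD; first by rewrite -mulrA; exact: first.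
apply: (le_trans (nrm_sum _ _ _)); rewrite mulr_suml; apply: ler_sum => i _.
have D0 : 0 <= v t - v s by rewrite subr_ge0 v_mono.
have DV : v t - v s <= V.
  by rewrite /V; have := @v_mono t T; have := @v_mono 0 s; lra.
apply: (le_trans (@nrm_sigact _ _ _ A L L0 HL Z i.+2 (y s) ((v t - v s) ^+ i.+2) _ _)).
- by rewrite exprn_ge0.
- by move=> w sw; rewrite -sw; apply: (path_signature_le v_ucont v_mono x_dom).
- rewrite -/q -[i.+2]addn2 exprD [leLHS](_ : _ = (v t - v s) ^+ i * q ^+ i.+2 * nrm (y s) * (v t - v s) ^+ 2); last by rewrite addn2; ring.
  apply: ler_wpM2r; first by rewrite exprn_ge0.
  rewrite addn2; apply: ler_pM; [|exact: nrm_ge0| |exact: HC].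
    by rewrite mulr_ge0 // exprn_ge0.
  apply: ler_wpM2r; first by rewrite exprn_ge0.
  by apply: lerXn2r; rewrite ?nnegrE.
Qed.

End BVRemainder.

(** * Truncated signatures as almost multiplicative maps *)

Section TruncatedAction.
Variables (R : realType) (d : nat) (I : finType).
Variable A : 'I_d -> {linear {ffun I -> R} -> {ffun I -> R}}.
Variables (L K1 : R) (N : nat).
Hypotheses (L_ge0 : 0 <= L) (A_le : forall j y, nrm (A j y) <= L * nrm y) (K1_ge0 : 0 <= K1).
Implicit Types (y : {ffun I -> R}) (Z : tensor_series R d) (om : R).

Definition level_le Z om := forall w, (size w <= N)%N -> `|Z w| <= K1 * om ^+ size w.

Let Ca := K1 * (1 + d%:R * L) ^+ N.

Lemma level_const_ge0 : 0 <= Ca.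
Proof. by rewrite mulr_ge0 // exprn_ge0 // addr_ge0 // mulr_ge0. Qed.

Lemma sigact_level Z om n y : 0 <= om -> level_le Z om -> (n <= N)%N ->
  nrm (sigact A Z n y) <= Ca * om ^+ n * nrm y.
Proof.
move=> om0 HZ nN.
have h w : size w = n -> `|Z w| <= K1 * om ^+ n by move=> sw; rewrite -sw; apply: HZ; rewrite sw.
have q0 : 0 <= d%:R * L by rewrite mulr_ge0.
apply: (le_trans (nrm_sigact L_ge0 A_le y _ h)); first by rewrite mulr_ge0 // exprn_ge0.
apply: ler_wpM2r; first exact: nrm_ge0.
rewrite /Ca mulrAC; apply: ler_wpM2r; first by rewrite exprn_ge0.
apply: ler_wpM2l => //; apply: (@le_trans _ _ ((1 + d%:R * L) ^+ n)).
  by apply: lerXn2r; rewrite ?nnegrE ?addr_ge0 // lerDr.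
by apply: ler_weXn2l => //; rewrite lerDl.
Qed.

(** Every level from 1 on carries a power of [om]; this is the source of the factor [1 + eps] in
    [sewing]. *)
Lemma psum_near_id Z om y : 0 <= om <= 1 -> Z [::] = 1 -> level_le Z om ->
  nrm (psum A Z N.+1 y - y) <= N%:R * Ca * om * nrm y.
Proof.
move=> /andP[om0 om1] Z0 HZ.
rewrite /psum big_ord_recl sigact0 // addrAC subrr add0r.
apply: (le_trans (nrm_sum _ _ _)).
apply: (@le_trans _ _ (\sum_(i < N) Ca * om * nrm y)).
  apply: ler_sum => i _; apply: (le_trans (sigact_level y om0 HZ _)); first exact: ltn_ord.
  apply: ler_wpM2r; first exact: nrm_ge0.
  apply: ler_wpM2l; first exact: level_const_ge0.
  by rewrite exprS ler_piMr // exprn_ile1.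
by rewrite sumr_const card_ord -[_ *+ N]mulr_natl !mulrA.
Qed.

(** The terms lost to truncation have total degree at least [N.+1] ([psum_chen]), which for [N] the
    integer part of [p] is a power [theta > 1] of the control. *)
Lemma psum_almost_mult Z1 Z2 om y : 0 <= om <= 1 -> level_le Z1 om -> level_le Z2 om ->
  nrm (psum A Z2 N.+1 (psum A Z1 N.+1 y) - psum A (tensor_mul Z1 Z2) N.+1 y) <=
  N.+1%:R ^+ 2 * Ca ^+ 2 * om ^+ N.+1 * nrm y.
Proof.
move=> /andP[om0 om1] H1 H2; rewrite psum_chen.
set B := Ca ^+ 2 * om ^+ N.+1 * nrm y.
have B0 : 0 <= B.
  apply: mulr_ge0; last exact: nrm_ge0.
  by apply: mulr_ge0; apply: exprn_ge0 => //; exact: level_const_ge0.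
have t i j : (i <= N)%N -> (j < i)%N -> nrm (sigact A Z2 (N.+1 - i + j) (sigact A Z1 i y)) <= B.
  move=> iN ji; have jN : (N.+1 - i + j <= N)%N.
    by rewrite subSn // addSn -addnS -{2}(subnK iN) leq_add2l.
  apply: (le_trans (sigact_level _ om0 H2 jN)).
  have Co n : 0 <= Ca * om ^+ n by rewrite mulr_ge0 ?level_const_ge0 // exprn_ge0.
  apply: (le_trans (ler_wpM2l (Co _) (sigact_level y om0 H1 iN))).
  rewrite [leLHS](_ : _ = Ca ^+ 2 * (om ^+ (N.+1 - i + j) * om ^+ i) * nrm y); last by ring.
  apply: ler_wpM2r; first exact: nrm_ge0.
  apply: ler_wpM2l; first by rewrite exprn_ge0 // level_const_ge0.
  rewrite -exprD addnAC subnK; last exact: (leq_trans iN).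
  by apply: ler_wiXn2l => //; rewrite leq_addr.
apply: (le_trans (nrm_sum _ _ _)).
apply: (@le_trans _ _ (\sum_(i < N.+1) N.+1%:R * B)).
  apply: ler_sum => i _; apply: (le_trans (nrm_sum _ _ _)).
  apply: (@le_trans _ _ (\sum_(j < i) B)).
    by apply: ler_sum => j _; apply: t => //; rewrite -ltnS.
  rewrite sumr_const card_ord -[B *+ _]mulr_natl; apply: ler_wpM2r => //.
  by rewrite ler_nat ltnW.
by rewrite sumr_const card_ord -[_ *+ N.+1]mulr_natl mulrA -expr2 /B !mulrA.
Qed.

Lemma psum_close Z Z' om y : 0 <= om <= 1 -> Z [::] = Z' [::] ->
  (forall w, (1 <= size w <= N)%N -> `|Z w - Z' w| <= om ^+ size w) ->
  nrm (psum A Z N.+1 y - psum A Z' N.+1 y) <= N%:R * (1 + d%:R * L) ^+ N * om * nrm y.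
Proof.
move=> /andP[om0 om1] Z0 H; have q0 : 0 <= d%:R * L by rewrite mulr_ge0.
rewrite /psum -sumrB big_ord_recl (_ : _ - _ = 0) ?add0r; last first.
  by rewrite /sigact /= Z0 subrr.
apply: (le_trans (nrm_sum _ _ _)).
apply: (@le_trans _ _ (\sum_(i < N) (1 + d%:R * L) ^+ N * om * nrm y)); last first.
  by rewrite sumr_const card_ord -[_ *+ N]mulr_natl !mulrA.
apply: ler_sum => i _; rewrite sigact_sub.
have h w : size w = bump 0 i -> `|Z w - Z' w| <= om.
  move=> sw; apply: (le_trans (H w _)); first by rewrite sw /bump /= add1n ltn_ord.
  by rewrite sw /bump /= add1n exprS ler_piMr // exprn_ile1.
apply: (le_trans (nrm_sigact L_ge0 A_le y om0 h)).
apply: ler_wpM2r; first exact: nrm_ge0.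
rewrite mulrC; apply: ler_wpM2r => //; apply: (@le_trans _ _ ((1 + d%:R * L) ^+ bump 0 i)).
  by apply: lerXn2r; rewrite ?nnegrE ?addr_ge0 // lerDr.
by apply: ler_weXn2l; [rewrite lerDl|rewrite /bump /= add1n ltn_ord].
Qed.

End TruncatedAction.

(** * Estimates uniform in the driver *)

Section RoughDriver.
Variables (R : realType) (d : nat) (T p : R) (N : nat).
Hypotheses (T_gt0 : 0 < T) (p_gt2 : 2 < p) (N_gt0 : (0 < N)%N) (Np : N%:R <= p < N.+1%:R).
Variables (S : R -> R -> tensor_series R d) (W : R -> R) (kap : nat -> R).

Definition pinc (U : R -> R) s t : R := (U t - U s) `^ p^-1.

Hypotheses (W_ucont : ucont 0 T W)
  (W_mono : forall s t, 0 <= s -> s <= t -> t <= T -> W s <= W t)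
  (kap_ge0 : forall n, 0 <= kap n)
  (kap_small : forall r : R, 0 <= r -> exists C : R, forall n, kap n * r ^+ n <= C)
  (S_nil : forall s t, 0 <= s -> s <= t -> t <= T -> S s t [::] = 1)
  (S_chen : forall s u t, 0 <= s -> s <= u -> u <= t -> t <= T ->
     tensor_mul (S s u) (S u t) = S s t)
  (S_le : forall s t w, 0 <= s -> s <= t -> t <= T ->
     `|S s t w| <= kap (size w) * pinc W s t ^+ size w).

(* D measures the distance between the levels 1, ..., N of S and of the       *)
(* signature of x.  It also dominates a small multiple of v, which turns the  *)
(* remainder O((v t - v s)^2) of a driver of bounded variation into the a     *)
(* priori bound needed for sewing.                                            *)
Record driver_near (rho : R) (x : R -> 'rV[R]_d) (v D : R -> R) : Prop := DriverNear {
  near_ucont : ucont 0 T v;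
  near_mono : forall s t, 0 <= s -> s <= t -> t <= T -> v s <= v t;
  near_dom : forall i, dominated 0 T v (fun t => x t ord0 i);
  near_incr : forall s t, 0 <= s -> s <= t -> t <= T -> D s <= D t;
  near_small : D T - D 0 <= rho;
  near_eta : exists2 eta : R, 0 < eta & forall s t, 0 <= s -> s <= t -> t <= T ->
    eta * (v t - v s) <= D t - D s;
  near_close : forall s t w, 0 <= s -> s <= t -> t <= T -> (1 <= size w <= N)%N ->
    `|path_signature x s t w - S s t w| <= pinc D s t ^+ size w }.

Lemma pinc_ge0 (U : R -> R) s t : 0 <= pinc U s t.
Proof. exact: powR_ge0. Qed.

Lemma p_gt0 : 0 < p.
Proof. exact: lt_trans p_gt2. Qed.

Lemma pinc_le (U V : R -> R) s t s' t' : 0 <= U t - U s -> U t - U s <= V t' - V s' ->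
  pinc U s t <= pinc V s' t'.
Proof.
move=> h1 h2; have p0 := p_gt0; rewrite /pinc; apply: ge0_ler_powR; rewrite ?nnegrE //.
  by rewrite invr_ge0 ltW.
exact: le_trans h2.
Qed.

(** The order in the control of the first level that truncation omits. *)
Definition theta : R := p^-1 * N.+1%:R.

Lemma pinc_theta (U : R -> R) s t : pinc U s t ^+ N.+1 = (U t - U s) `^ theta.
Proof. by rewrite /theta powRrM powR_mulrn // powR_ge0. Qed.

Lemma theta_gt1 : 1 < theta.
Proof.
have p0 := p_gt0; case/andP: Np => _ h.
by rewrite /theta mulrC ltr_pdivlMr // mul1r.
Qed.

(** Makes the quadratic bound of [bv_remainder] at least as strong as a power [theta], up to a
    constant. *)
Lemma theta_le2 : theta <= 2.
Proof.
have p0 := p_gt0; case/andP: Np => h _.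
have E : N.+1%:R = N%:R + 1 :> R by rewrite natr1.
have p2 := p_gt2; rewrite /theta mulrC ler_pdivrMr // E; lra.
Qed.

Lemma half_theta : (2^-1 : R) `^ theta < 2^-1.
Proof.
have th := theta_gt1.
have -> : theta = 1 + (theta - 1) by ring.
rewrite powRD; last by apply/implyP => _; rewrite invr_eq0 pnatr_eq0.
rewrite powRr1 // -[ltRHS]mulr1 ltr_pM2l //.
have E1 : 1 `^ (theta - 1) = 1 :> R by rewrite powR1.
rewrite -[ltRHS]E1; apply: gt0_ltr_powR; rewrite ?nnegrE //; lra.
Qed.

Variables (I : finType) (A : 'I_d -> {linear {ffun I -> R} -> {ffun I -> R}}).

(* The constants depend only on S and A: the driver enters through D.         *)
Lemma local_remainder : exists2 om0 : R, 0 < om0 <= 1 & exists2 C : R, 0 <= C &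
  forall (rho : R) x v D (y0 : {ffun I -> R}) (y : R -> {ffun I -> R}) (a b : R),
  driver_near rho x v D -> linear_ode T x v A y0 y ->
  0 <= a -> a <= b -> b <= T -> pinc (fun t => W t + D t) a b <= om0 ->
  (forall t, a <= t <= b -> nrm (y t) <= 2 * nrm (y a)) /\
  forall s t Y, (forall r, a <= r <= b -> nrm (y r) <= Y) -> a <= s -> s <= t -> t <= b ->
    nrm (y t - psum A (path_signature x s t) N.+1 (y s)) <=
    C * Y * ((W t + D t) - (W s + D s)) `^ theta.
Proof.
have [L L0 HL] := linear_bounded_all A.
pose K1 := 1 + \sum_(n < N.+1) kap n.
have kapK n : (n <= N)%N -> kap n + 1 <= K1.
  move=> nN; rewrite addrC lerD2l (bigD1 (Ordinal (n:=N.+1) (m:=n) nN)) //= lerDl.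
  exact: sumr_ge0.
have K10 : 0 <= K1 by rewrite addr_ge0 // sumr_ge0.
pose Ca := K1 * (1 + d%:R * L) ^+ N.
have Ca0 : 0 <= Ca by exact: level_const_ge0.
pose h : R := 2^-1 `^ theta.
have h_lt : h < 2^-1 := half_theta.
have h_ge : 0 <= h := powR_ge0 _ _.
(* As [h < 1/2], this choice keeps [kappa] below 1, because [(1 + eps) ^+ 2 <= 1 + 3 * eps]. *)
pose eps : R := (1 - 2 * h) / 4.
pose kappa : R := (1 + (1 + eps) ^+ 2) * h.
have eps0 : 0 < eps by rewrite /eps; lra.
have eps1 : eps <= 4^-1 by rewrite /eps; lra.
have kappa1 : kappa < 1.
  rewrite /kappa; apply: (@le_lt_trans _ _ ((2 + 3 * eps) * h)).
    apply: ler_wpM2r => //; nra.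
  rewrite /eps; nra.
pose Cc := N.+1%:R ^+ 2 * Ca ^+ 2.
have Cc0 : 0 <= Cc by rewrite mulr_ge0 // exprn_ge0.
pose C := 3 * Cc / (1 - kappa).
have C0 : 0 <= C by rewrite /C; apply: divr_ge0; lra.
(* The second bound puts the truncated action within [eps] of the identity; the third makes the
   remainder at most a quarter of the bound on [y]. *)
pose om0 := Num.min 1 (Num.min (eps / (N%:R * Ca + 1)) (4^-1 / (C + 1))).
have NCa : 0 <= N%:R * Ca by rewrite mulr_ge0.
have om0_gt : 0 < om0 by rewrite !lt_min ltr01 !divr_gt0 //; lra.
have om01 : om0 <= 1 by rewrite ge_min lexx.
have om0e : N%:R * Ca * om0 <= eps.
  apply: (@le_trans _ _ ((N%:R * Ca + 1) * om0)); first by apply: ler_wpM2r; lra.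
  by rewrite mulrC -ler_pdivlMr; [rewrite !ge_min lexx orbT|lra].
have om0C : C * om0 <= 4^-1.
  apply: (@le_trans _ _ ((C + 1) * om0)); first by apply: ler_wpM2r; lra.
  by rewrite mulrC -ler_pdivlMr; [rewrite !ge_min lexx !orbT|lra].
exists om0; first by rewrite om0_gt.
exists C => // rho x v D y0 y a b dn yo a0 ab bT abom.
have [vu vm xd Dm Dr [eta eta0 Heta] close] := dn.
pose U t := W t + D t.
have Um s t : 0 <= s -> s <= t -> t <= T -> U s <= U t.
  by move=> *; apply: lerD; [exact: W_mono|exact: Dm].
have Uinc s' s t t' : a <= s' -> s' <= s -> s <= t -> t <= t' -> t' <= b ->
    0 <= (U t' - U s') - (U t - U s).
  move=> as' s's st tt' t'b.
  have s'0 : 0 <= s' := le_trans a0 as'.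
  have s0 : 0 <= s := le_trans s'0 s's.
  have t'T : t' <= T := le_trans t'b bT.
  have tT : t <= T := le_trans tt' t'T.
  have h1 := Um s' s s'0 s's (le_trans st tT).
  have h2 := Um t t' (le_trans s0 st) tt' t'T.
  have -> : U t' - U s' - (U t - U s) = (U t' - U t) + (U s - U s') by ring.
  by rewrite addr_ge0 // subr_ge0.
have omU s t : a <= s -> s <= t -> t <= b -> 0 <= pinc U s t <= om0.
  move=> as_ st tb; rewrite pinc_ge0 (le_trans _ abom) //; apply: pinc_le.
    by rewrite subr_ge0; apply: Um => //; [exact: le_trans as_|exact: le_trans bT].
  by rewrite -/(U t) -/(U s) -/(U b) -/(U a) -subr_ge0; exact: Uinc.
have lev s t s' t' : a <= s' -> s' <= s -> s <= t -> t <= t' -> t' <= b ->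
    level_le K1 N (path_signature x s t) (pinc U s' t').
  move=> as' s's st tt' t'b w wN.
  have s0 : 0 <= s := le_trans a0 (le_trans as' s's).
  have tT : t <= T := le_trans tt' (le_trans t'b bT).
  have [/size0nil ->|w0] := eqVneq (size w) 0%N.
    by rewrite path_signature_nil normr1 expr0 mulr1 lerDl sumr_ge0.
  have := close s t w s0 st tT; rewrite lt0n w0 wN => /(_ isT) h1.
  have h2 := S_le w s0 st tT.
  have p1 : pinc D s t ^+ size w <= pinc U s' t' ^+ size w.
    apply: lerXn2r; rewrite ?nnegrE ?pinc_ge0 //; apply: pinc_le; first by rewrite subr_ge0 Dm.
    apply: (@le_trans _ _ (U t - U s)); last by rewrite -subr_ge0; exact: Uinc.
    rewrite -subr_ge0 (_ : _ - _ = W t - W s); last by rewrite /U; ring.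
    by rewrite subr_ge0 W_mono.
  have p2 : pinc W s t ^+ size w <= pinc U s' t' ^+ size w.
    apply: lerXn2r; rewrite ?nnegrE ?pinc_ge0 //; apply: pinc_le; first by rewrite subr_ge0 W_mono.
    apply: (@le_trans _ _ (U t - U s)); last by rewrite -subr_ge0; exact: Uinc.
    rewrite -subr_ge0 (_ : _ - _ = D t - D s); last by rewrite /U; ring.
    by rewrite subr_ge0 Dm.
  have p3 : kap (size w) * pinc W s t ^+ size w <= kap (size w) * pinc U s' t' ^+ size w.
    exact: ler_wpM2l.
  have p4 : (kap (size w) + 1) * pinc U s' t' ^+ size w <= K1 * pinc U s' t' ^+ size w.
    by apply: ler_wpM2r; [rewrite exprn_ge0 // pinc_ge0|exact: kapK].
  have := ler_normD (path_signature x s t w - S s t w) (S s t w); rewrite subrK.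
  move=> /le_trans; apply; apply: le_trans p4; rewrite mulrDl mul1r addrC.
  by apply: lerD; [exact: le_trans h2 _|exact: le_trans h1 _].
have smallE s t z : a <= s -> s <= t -> t <= b ->
    nrm (psum A (path_signature x s t) N.+1 z - z) <= eps * nrm z.
  move=> as_ st tb; have /andP[z0 z1] := omU s t as_ st tb.
  apply: (le_trans (psum_near_id L0 HL K10 z _ _ (lev s t s t _ _ _ _ _))) => //.
    by rewrite z0 (le_trans z1).
  apply: ler_wpM2r; first exact: nrm_ge0.
  by apply: le_trans om0e; apply: ler_wpM2l.
have normE s t z : a <= s -> s <= t -> t <= b ->
    nrm (psum A (path_signature x s t) N.+1 z) <= (1 + eps) * nrm z.
  move=> as_ st tb; have := nrmD (psum A (path_signature x s t) N.+1 z - z) z.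
  by rewrite subrK; have := smallE s t z as_ st tb; lra.
have rem Y : (forall r, a <= r <= b -> nrm (y r) <= Y) -> forall s t, a <= s -> s <= t -> t <= b ->
    nrm (y t - psum A (path_signature x s t) N.+1 (y s)) <= C * Y * (U t - U s) `^ theta.
  move=> HY.
  have Y0 : 0 <= Y by apply: le_trans (HY a _); rewrite ?nrm_ge0 // lexx.
  have [K K0 HK] := @bv_remainder _ d I T x v (ltW T_gt0) vu vm xd A y0 y yo N.-1.
  have N2 : N.-1.+2 = N.+1 by rewrite prednK.
  rewrite N2 in HK.
  pose Vt := v T - v 0 + 1.
  have Vt0 : 0 < Vt by rewrite ltr_wpDl // subr_ge0; exact: vm (lexx 0) (ltW T_gt0) (lexx T).
  have th1 := theta_gt1; have th2 := theta_le2.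
  have -> : C * Y = 3 * (Cc * Y) / (1 - kappa) by rewrite /C; ring.
  (* The a priori constant: [(v t - v s) ^+ 2] is scaled by [Vt], lowered to the power [theta], and
     compared with [D] through [eta]. However large it is for this driver, it does not enter the
     conclusion. *)
  apply: (@sewing _ a b U (fun s t => nrm (y t - psum A (path_signature x s t) N.+1 (y s)))
    theta eps (Cc * Y) (K * Vt ^+ 2 * (eta * Vt)^-1 `^ theta) kappa) => //.
  - exact: le_trans ler01 (ltW th1).
  - by rewrite ltW //= (le_trans eps1) // invf_le1 // ler1n.
  - by rewrite mulr_ge0.
  - apply: mulr_ge0; last exact: powR_ge0.
    by rewrite mulr_ge0 // exprn_ge0 // ltW.
  - by move=> s t as_ st tb; apply: Um => //; [exact: le_trans as_|exact: le_trans bT].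
  - move=> s u t as_ su ut tb.
    have s0 : 0 <= s := le_trans a0 as_.
    have tT : t <= T := le_trans tb bT.
    have ub : u <= b := le_trans ut tb.
    have au : a <= u := le_trans as_ su.
    have st : s <= t := le_trans su ut.
    have ch : psum A (tensor_mul (path_signature x s u) (path_signature x u t)) N.+1 (y s) =
        psum A (path_signature x s t) N.+1 (y s).
      apply: eq_bigr => i _; apply: eq_sigact => w _.
      exact: (path_signature_chen vu vm xd).
    have -> : y t - psum A (path_signature x s t) N.+1 (y s) =
      (y t - psum A (path_signature x u t) N.+1 (y u)) +
      psum A (path_signature x u t) N.+1 (y u - psum A (path_signature x s u) N.+1 (y s)) +
      (psum A (path_signature x u t) N.+1 (psum A (path_signature x s u) N.+1 (y s)) -
       psum A (tensor_mul (path_signature x s u) (path_signature x u t)) N.+1 (y s)).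
      by rewrite psumB ch; apply/ffunP => i; rewrite !ffunE; ring.
    apply: (le_trans (nrmD _ _)); apply: lerD.
      by apply: (le_trans (nrmD _ _)); rewrite lerD2l; exact: normE.
    have sob := omU s t as_ st tb.
    apply: (le_trans (psum_almost_mult L0 HL K10 _ _ (lev s u s t _ _ _ _ _) (lev u t s t _ _ _ _ _))) => //.
      by move/andP: sob => [-> /le_trans]; apply.
    rewrite pinc_theta -/Ca -/Cc [leRHS]mulrAC; apply: ler_wpM2l; last by apply: HY; rewrite as_ (le_trans st).
    by rewrite mulr_ge0 // powR_ge0.
  - move=> s t as_ st tb; have s0 : 0 <= s := le_trans a0 as_.
    have tT : t <= T := le_trans tb bT.
    apply: (le_trans (HK s t s0 st tT)); rewrite -mulrA -(mulrA K); apply: ler_wpM2l => //.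
    have V0 : 0 <= v t - v s by rewrite subr_ge0 vm.
    have VV : v t - v s <= Vt.
      have h1 := vm t T (le_trans s0 st) tT (lexx T).
      have h2 := vm 0 s (lexx 0) s0 (le_trans st tT).
      apply: (@le_trans _ _ (v T - v 0)); last by rewrite /Vt lerDl.
      by apply: lerD => //; rewrite lerN2.
    have -> : (v t - v s) ^+ 2 = Vt ^+ 2 * ((v t - v s) / Vt) ^+ 2.
      by rewrite -exprMn mulrCA divff ?mulr1 // gt_eqF.
    apply: ler_wpM2l; first by rewrite exprn_ge0 // ltW.
    set z := (v t - v s) / Vt.
    have z0 : 0 <= z by rewrite divr_ge0 // ltW.
    have z1 : z <= 1 by rewrite ler_pdivrMr // mul1r.
    apply: (@le_trans _ _ (z `^ theta)).
      have [->|zn] := eqVneq z 0; first by rewrite expr0n /= powR_ge0.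
      rewrite -powR_mulrn //; apply: ger_powR => //.
      by rewrite lt_neqAle eq_sym zn z0.
    rewrite -powRM ?subr_ge0 ?Um //; last by rewrite invr_ge0 mulr_ge0 // ltW.
    apply: ge0_ler_powR; rewrite ?nnegrE //; first exact: le_trans ler01 (ltW th1).
      by apply: mulr_ge0; [rewrite invr_ge0 mulr_ge0 // ltW|rewrite subr_ge0 Um].
    rewrite /z mulrC invfM -mulrA [leRHS]mulrCA; apply: ler_wpM2l; first by rewrite invr_ge0 ltW.
    rewrite mulrC ler_pdivlMr // mulrC; apply: (le_trans (Heta s t s0 st tT)).
    by rewrite /U opprD addrACA lerDr subr_ge0 W_mono.
  - move=> e e0; have Ke : 0 < Num.min 1 (e / (K + 1)) by rewrite lt_min ltr01 divr_gt0 // ltr_wpDl.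
    have [dl dl0 Hdl] := vu _ Ke; exists dl => // s t as_ st tb std.
    have s0 : 0 <= s := le_trans a0 as_.
    have tT : t <= T := le_trans tb bT.
    have sT : 0 <= s <= T by rewrite s0 (le_trans st).
    have tT' : 0 <= t <= T by rewrite tT (le_trans s0).
    apply: (le_trans (HK s t s0 st tT)).
    have V0 : 0 <= v t - v s by rewrite subr_ge0 vm.
    have := Hdl t s; rewrite ger0_norm ?subr_ge0 // => /(_ tT' sT std).
    rewrite ger0_norm // lt_min => /andP[v1 v2].
    apply: (@le_trans _ _ ((K + 1) * (v t - v s))); last first.
      by rewrite mulrC -ler_pdivlMr; [exact: ltW|rewrite ltr_wpDl].
    apply: ler_pM => //; [by rewrite exprn_ge0|by rewrite lerDl|].
    by rewrite expr2 ler_piMl // ltW.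
split=> [t tab|s t Y HY]; last exact: rem.
have [Y0 Y00 HY0] := linear_ode_bounded (ltW T_gt0) yo.
(* Bootstrap: a bound [Y] on [y] improves to [(1 + eps) * nrm (y a) + Y / 4], which at least halves
   the excess over [2 * nrm (y a)]. *)
have main n : forall r, a <= r <= b -> nrm (y r) <= 2 * nrm (y a) + Y0 * 2^-1 ^+ n.
  elim: n => [|n IH] r rab.
    rewrite expr0 mulr1; apply: (le_trans (HY0 r _)).
      by case/andP: rab => h1 h2; rewrite (le_trans a0) // (le_trans h2).
    by rewrite lerDr mulr_ge0 // nrm_ge0.
  have [ar rb] := andP rab.
  have := rem _ IH a r (lexx a) ar rb; rewrite -pinc_theta.
  have /andP[z0 z1] := omU a r (lexx a) ar rb.
  set Y := _ + _ * _ => h1.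
  have Yp : 0 <= Y by rewrite addr_ge0 // mulr_ge0 ?nrm_ge0 ?exprn_ge0.
  have h2 : C * Y * pinc U a r ^+ N.+1 <= 4^-1 * Y.
    rewrite mulrAC; apply: ler_wpM2r => //; apply: le_trans om0C; apply: ler_wpM2l => //.
    by apply: (le_trans _ z1); rewrite exprS ler_piMr // exprn_ile1 // (le_trans z1).
  have h3 := normE a r (y a) (lexx a) ar rb.
  have := nrmD (y r - psum A (path_signature x a r) N.+1 (y a)) (psum A (path_signature x a r) N.+1 (y a)).
  rewrite subrK => h4.
  have h5 : (1 + eps) * nrm (y a) <= (1 + 4^-1) * nrm (y a).
    by apply: ler_wpM2r; [exact: nrm_ge0|rewrite lerD2l].
  have h6 := nrm_ge0 (y a).
  have h7 : 0 <= Y0 * 2^-1 ^+ n by rewrite mulr_ge0 // exprn_ge0.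
  have EY : Y = 2 * nrm (y a) + Y0 * 2^-1 ^+ n by [].
  rewrite exprS mulrCA; clearbody Y; clear - h1 h2 h3 h4 h5 h6 h7 EY; lra.
apply/ler_addgt0Pr => e e0; have [n Hn] := geometric_small Y0 e0.
apply: (le_trans (main n t tab)); rewrite lerD2l; exact: Hn.
Qed.

End RoughDriver.

(** * Convergence of the solutions to the word series *)

Section RoughConvergence.
Variables (R : realType) (d : nat) (T p : R) (N : nat).
Hypotheses (T_gt0 : 0 < T) (p_gt2 : 2 < p) (N_gt0 : (0 < N)%N) (Np : N%:R <= p < N.+1%:R).
Variables (S : R -> R -> tensor_series R d) (W : R -> R) (kap : nat -> R).

Hypotheses (W_ucont : ucont 0 T W)
  (W_mono : forall s t, 0 <= s -> s <= t -> t <= T -> W s <= W t)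
  (kap_ge0 : forall n, 0 <= kap n)
  (kap_small : forall r : R, 0 <= r -> exists C : R, forall n, kap n * r ^+ n <= C)
  (S_nil : forall s t, 0 <= s -> s <= t -> t <= T -> S s t [::] = 1)
  (S_chen : forall s u t, 0 <= s -> s <= u -> u <= t -> t <= T ->
     tensor_mul (S s u) (S u t) = S s t)
  (S_le : forall s t w, 0 <= s -> s <= t -> t <= T ->
     `|S s t w| <= kap (size w) * pinc p W s t ^+ size w).

Variables (I : finType) (A : 'I_d -> {linear {ffun I -> R} -> {ffun I -> R}}).

Local Notation pinc := (pinc p).
Local Notation theta := (theta p N).
Local Notation driver_near := (driver_near T p N S).

Lemma sig_bounded_signature s t : 0 <= s -> s <= t -> t <= T ->
  sig_bounded kap (pinc W 0 T) (S s t) (pinc W s t).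
Proof.
move=> s0 st tT; split; first 1 last; [exact: S_nil|by move=> w; exact: S_le|].
rewrite pinc_ge0; apply: pinc_le => //; first by rewrite subr_ge0 W_mono.
apply: lerD; first exact: W_mono (le_trans s0 st) tT (lexx T).
by rewrite lerN2; exact: W_mono (lexx 0) s0 (le_trans st tT).
Qed.

Lemma sigop_near_id : exists2 C : R, 0 <= C & forall s t y, 0 <= s -> s <= t -> t <= T ->
  nrm (sigop A (S s t) y - y) <= C * pinc W s t * nrm y.
Proof.
have [L L0 HL] := linear_bounded_all A.
have [C C0 HC] := sigop_approx L0 HL kap_ge0 (pinc_ge0 p W 0 T) kap_small.
exists C => // s t y s0 st tT.
have [_] := HC _ _ 1%N 1%N y (sig_bounded_signature s0 st tT) (leqnn _).
rewrite /psum big_ord1 sigact0 ?S_nil // !expr1 => /le_trans; apply.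
apply: ler_wpM2r; first exact: nrm_ge0.
by rewrite ler_piMr ?mulr_ge0 ?pinc_ge0 // invf_le1 // ler1n.
Qed.

Lemma sigop_id t y : 0 <= t <= T -> sigop A (S t t) y = y.
Proof.
move=> /andP[t0 tT]; have [C C0 HC] := sigop_near_id.
apply/eqP; rewrite -subr_eq0; apply/eqP; apply: nrm_eq0.
apply: (le_trans (HC t t y t0 (lexx _) tT)).
rewrite /pinc subrr powR0 ?mulr0 ?mul0r // invr_eq0 gt_eqF //.
exact: lt_trans p_gt2.
Qed.

Lemma sigop_increment : exists2 C : R, 0 <= C & forall s t y, 0 <= s -> s <= t -> t <= T ->
  nrm (sigop A (S 0 t) y - sigop A (S 0 s) y) <= C * pinc W s t * nrm y.
Proof.
have [L L0 HL] := linear_bounded_all A.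
have [C C0 HC] := sigop_near_id.
have [D D0 HD] := sigop_bounded L0 HL kap_ge0 (pinc_ge0 p W 0 T) kap_small.
exists (C * D) => [|s t y s0 st tT]; first by rewrite mulr_ge0.
have sT : s <= T := le_trans st tT.
rewrite -(@sigop_chen _ _ _ A L kap _ L0 HL kap_ge0 (pinc_ge0 p W 0 T) kap_small (S 0 s) (S s t) (S 0 t)
  _ _ _ y (sig_bounded_signature (lexx 0) s0 sT) (sig_bounded_signature s0 st tT)
  (sig_bounded_signature (lexx 0) (le_trans s0 st) tT)); last by move=> w; rewrite S_chen.
apply: (le_trans (HC s t _ s0 st tT)).
rewrite [leRHS](_ : _ = C * pinc W s t * (D * nrm y)); last by ring.
apply: ler_wpM2l; first by rewrite mulr_ge0 // pinc_ge0.
exact: HD (sig_bounded_signature (lexx 0) s0 sT).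
Qed.

Lemma pinc_small (U : R -> R) s t om : 0 <= om -> 0 <= U t - U s -> U t - U s <= om `^ p ->
  pinc U s t <= om.
Proof.
move=> om0 U0 Uom; have p0 : 0 < p := lt_trans (ltr0n R 2) p_gt2.
have <- : (om `^ p) `^ p^-1 = om by rewrite -powRrM mulfV ?gt_eqF // powRr1.
by apply: ge0_ler_powR; rewrite ?nnegrE ?powR_ge0 // invr_ge0 ltW.
Qed.

(** Time is cut into pieces on which [W] varies little; on each, [local_remainder] lets the norm at
    most double. As [D] is small in total, the number of pieces depends on [W] alone. *)
Lemma rough_apriori_bound (y0 : {ffun I -> R}) : exists2 rho0 : R, 0 < rho0 &
  exists2 Y : R, 0 <= Y & forall rho x v D y, rho <= rho0 -> driver_near rho x v D ->
    linear_ode T x v A y0 y -> forall t, 0 <= t <= T -> nrm (y t) <= Y.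
Proof.
have [om0 /andP[om0_gt om01] [C C0 HC]] := local_remainder T_gt0 p_gt2 N_gt0 Np W_mono kap_ge0 S_le A.
set alpha := om0 `^ p; have alpha0 : 0 < alpha by exact: powR_gt0.
have a20 : 0 < alpha / 2 by rewrite divr_gt0.
have [dl dl0 Hdl] := W_ucont a20.
pose n := (Num.truncn (T / (dl / 2))).+1.
exists (alpha / 2) => //; exists (2 ^+ n * nrm y0); first by rewrite mulr_ge0 ?nrm_ge0 // exprn_ge0.
move=> rho x v D y rhole dn yo t tT.
have [vu vm xd Dm Dr _ _] := dn.
have step a b : 0 <= a -> a <= b -> b <= T -> b - a < dl -> nrm (y b) <= 2 * nrm (y a).
  move=> a0 ab bT bad.
  have pU : pinc (fun t => W t + D t) a b <= om0.
    have hW := W_mono a0 ab bT; have hD := Dm a b a0 ab bT.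
    apply: pinc_small; [exact: ltW|lra|].
    have D1 := Dm 0 a (lexx 0) a0 (le_trans ab bT).
    have D2 := Dm b T (le_trans a0 ab) bT (lexx T).
    have := Hdl b a; rewrite ger0_norm ?subr_ge0 // ger0_norm ?subr_ge0 //.
    rewrite (le_trans a0 ab) bT a0 (le_trans ab bT) -/alpha => /(_ isT isT bad).
    lra.
  by have [H _] := HC _ _ _ _ _ _ _ _ dn yo a0 ab bT pU; apply: H; rewrite ab lexx.
have main i : forall t, 0 <= t -> t <= T -> t <= i%:R * (dl / 2) -> nrm (y t) <= 2 ^+ i * nrm y0.
  elim: i => [|i IH] {tT}t t0 tT ti.
    have -> : t = 0 by apply/eqP; rewrite eq_le t0 andbT (le_trans ti) // mul0r.
    by rewrite yo.1 expr0 mul1r.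
  have [td|td] := ltP t dl.
    apply: (le_trans (step 0 t (lexx 0) t0 tT _)); first by rewrite subr0.
    rewrite yo.1 exprS; apply: ler_wpM2r; first exact: nrm_ge0.
    by rewrite ler_peMr // exprn_ege1 // ler1n.
  have E : i.+1%:R = i%:R + 1 :> R by rewrite natr1.
  rewrite E in ti.
  have h1 : 0 <= t - dl / 2 by lra.
  have h2 : t - dl / 2 <= t by lra.
  apply: (le_trans (step (t - dl / 2) t h1 h2 tT _)); first lra.
  by rewrite exprS -mulrA; apply: ler_wpM2l => //; apply: IH; lra.
case/andP: tT => t0 tT; apply: main => //; apply: (le_trans tT).
rewrite -ler_pdivrMr ?divr_gt0 //.
by apply: ltW; apply: truncnS_gt.
Qed.

Lemma powR_superlinear (z sigma : R) : 1 < theta -> 0 < sigma -> 0 <= z -> z <= sigma `^ (theta - 1)^-1 ->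
  z `^ theta <= sigma * z.
Proof.
move=> th s0 z0 zs; have th0 : 0 < theta by lra.
rewrite -(mulr_powRB1 z0 th0) mulrC; apply: ler_wpM2r => //.
have <- : (sigma `^ (theta - 1)^-1) `^ (theta - 1) = sigma.
  by rewrite -powRrM mulVf ?powRr1 ?(ltW s0) // gt_eqF // subr_gt0.
by apply: ge0_ler_powR; rewrite ?nnegrE ?powR_ge0 //; lra.
Qed.

(** Three errors are added: the remainder of [y], the distance between the truncated signatures of
    [x] and of [S], and the tail of the series of [S]. The first and the last are of order [theta],
    the middle one of order [pinc D]. *)
Lemma rough_one_step : exists2 om0 : R, 0 < om0 & exists2 C : R, 0 <= C &
  forall rho x v D y0 y a b Y, driver_near rho x v D -> linear_ode T x v A y0 y ->
  (forall t, 0 <= t <= T -> nrm (y t) <= Y) ->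
  0 <= a -> a <= b -> b <= T -> (W b + D b) - (W a + D a) <= om0 -> pinc D a b <= 1 ->
  nrm (y b - sigop A (S a b) (y a)) <=
    C * Y * (((W b + D b) - (W a + D a)) `^ theta + pinc D a b).
Proof.
have [om0 /andP[om0_gt om01] [C C0 HC]] := local_remainder T_gt0 p_gt2 N_gt0 Np W_mono kap_ge0 S_le A.
have [L L0 HL] := linear_bounded_all A.
have [F F0 HF] := sigop_approx L0 HL kap_ge0 (pinc_ge0 p W 0 T) kap_small.
set G := N%:R * (1 + d%:R * L) ^+ N.
have G0 : 0 <= G by rewrite mulr_ge0 // exprn_ge0 // addr_ge0 // mulr_ge0.
exists (om0 `^ p); first exact: powR_gt0.
exists (C + F + G); first by rewrite !addr_ge0.
move=> rho x v D y0 y a b Y dn yo HY a0 ab bT hU hD.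
have [vu vm xd Dm _ _ close] := dn.
have Y0 : 0 <= Y by apply: le_trans (HY 0 _); rewrite ?nrm_ge0 // lexx ltW.
have W0 := W_mono a0 ab bT; have D0 := Dm a b a0 ab bT.
set U := W b + D b - (W a + D a) in hU *.
have U0 : 0 <= U by rewrite /U; lra.
have pU : pinc (fun t => W t + D t) a b <= om0 by apply: pinc_small => //; exact: ltW.
have [_ H] := HC _ _ _ _ _ _ _ _ dn yo a0 ab bT pU.
have {H} h1 : nrm (y b - psum A (path_signature x a b) N.+1 (y a)) <= C * Y * U `^ theta.
  by apply: H => // r /andP[ar rb]; apply: HY; rewrite (le_trans a0 ar) (le_trans rb bT).
have aT : 0 <= a <= T by rewrite a0 (le_trans ab).
have h2 : nrm (psum A (path_signature x a b) N.+1 (y a) - psum A (S a b) N.+1 (y a)) <= G * Y * pinc D a b.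
  apply: (le_trans (psum_close L0 HL _ _ (om := pinc D a b) _ _)).
  - by rewrite pinc_ge0.
  - by rewrite S_nil.
  - by move=> w wN; exact: close.
  - rewrite -/G mulrAC; apply: ler_wpM2r; first exact: pinc_ge0.
    by apply: ler_wpM2l => //; exact: HY.
have h3 : nrm (sigop A (S a b) (y a) - psum A (S a b) N.+1 (y a)) <= F * Y * U `^ theta.
  have [_] := HF _ _ N.+1 N.+1 (y a) (sig_bounded_signature a0 ab bT) (leqnn _).
  move=> /le_trans; apply; rewrite pinc_theta.
  rewrite [leLHS](_ : _ = F * nrm (y a) * ((W b - W a) `^ theta * 2^-1 ^+ N.+1)); last by ring.
  apply: ler_pM; rewrite ?mulr_ge0 ?nrm_ge0 ?powR_ge0 ?exprn_ge0 //.
    by apply: ler_wpM2l => //; exact: HY.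
  rewrite -[leRHS]mulr1; apply: ler_pM; rewrite ?powR_ge0 ?exprn_ge0 //.
    have th1 := theta_gt1 p_gt2 Np.
    by apply: ge0_ler_powR; rewrite ?nnegrE //; [lra|lra|rewrite /U; lra].
  by rewrite exprn_ile1 // invf_le1 // ler1n.
have -> : y b - sigop A (S a b) (y a) = (y b - psum A (path_signature x a b) N.+1 (y a)) +
  (psum A (path_signature x a b) N.+1 (y a) - psum A (S a b) N.+1 (y a)) -
  (sigop A (S a b) (y a) - psum A (S a b) N.+1 (y a)).
  by apply/ffunP => i; rewrite !ffunE; ring.
apply: (le_trans (nrmB _ _)); apply: (le_trans (lerD (nrmD _ _) (lexx _))).
have P0 : 0 <= U `^ theta by exact: powR_ge0.
have Q0 := pinc_ge0 p D a b.
apply: (le_trans (lerD (lerD h1 h2) h3)).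
have k1 := mulr_ge0 (mulr_ge0 C0 Y0) Q0.
have k2 := mulr_ge0 (mulr_ge0 F0 Y0) Q0.
have k3 := mulr_ge0 (mulr_ge0 G0 Y0) P0.
rewrite !mulrDl !mulrDr; lra.
Qed.

(** [Q i] follows [y] up to the grid point [tau i] and the flow of [S] from there to [t], so
    consecutive values differ by one local error transported by a bounded operator. The errors of
    order [theta] sum to at most [sigma] times the total control; the others vanish with [rho] on a
    fixed grid. *)
Lemma rough_convergence (y0 : {ffun I -> R}) e : 0 < e -> exists2 rho : R, 0 < rho &
  forall x v D y, driver_near rho x v D -> linear_ode T x v A y0 y ->
  forall t, 0 <= t <= T -> nrm (y t - sigop A (S 0 t) y0) <= e.
Proof.
move=> e0; have p0 : 0 < p := lt_trans (ltr0n R 2) p_gt2.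
have [L L0 HL] := linear_bounded_all A.
have [r1 r10 [Y Y0 HY]] := rough_apriori_bound y0.
have [om0 om0_gt [C C0 HC]] := rough_one_step.
have [B B0 HB] := sigop_bounded L0 HL kap_ge0 (pinc_ge0 p W 0 T) kap_small.
have th1 := theta_gt1 p_gt2 Np.
pose Wt := W T - W 0 + 1.
have Wt0 : 0 < Wt by have := W_mono (lexx 0) (ltW T_gt0) (lexx T); rewrite /Wt; lra.
have CY0 : 0 <= B * (C * Y) by rewrite !mulr_ge0.
(* The order of the choices matters: [sigma], then [mu] and the number [n] of steps, which depends
   on [W] only, and then [r] and [rho], which may depend on [n]. *)
pose sigma := e / 2 / (B * (C * Y) * Wt + 1).
have sigma0 : 0 < sigma by rewrite !divr_gt0 // ltr_wpDl // mulr_ge0 // ltW.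
pose mu := Num.min om0 (sigma `^ (theta - 1)^-1).
have mu0 : 0 < mu by rewrite lt_min om0_gt powR_gt0.
have mu20 : 0 < mu / 2 by rewrite divr_gt0.
have [dl dl0 Hdl] := W_ucont mu20.
pose n := (Num.truncn (T / dl)).+1.
have nP : T / n%:R < dl.
  rewrite ltr_pdivrMr ?ltr0n // mulrC -ltr_pdivrMr //; exact: truncnS_gt.
pose r := Num.min 1 (e / 2 / (B * (C * Y) * n%:R + 1)).
have r0 : 0 < r by rewrite lt_min ltr01 !divr_gt0 // ltr_wpDl // mulr_ge0.
pose rho := Num.min (Num.min r1 1) (Num.min (mu / 2) (r `^ p)).
have rho0 : 0 < rho by rewrite !lt_min r10 ltr01 mu20 powR_gt0.
have rho_r1 : rho <= r1 by rewrite !ge_min lexx.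
have rho_1 : rho <= 1 by rewrite !ge_min lexx orbT.
have rho_mu : rho <= mu / 2 by rewrite !ge_min lexx !orbT.
have rho_r : rho <= r `^ p by rewrite !ge_min lexx !orbT.
exists rho => // x v D y dn yo t /andP[t0 tT].
have [vu vm xd Dm Dr _ _] := dn.
have HYt := HY rho x v D y rho_r1 dn yo.
pose tau (i : nat) : R := i%:R * (t / n%:R).
have tau0 i : 0 <= tau i by rewrite !mulr_ge0 // invr_ge0.
have tauS i : tau i <= tau i.+1.
  by apply: ler_wpM2r; [rewrite divr_ge0|rewrite ler_nat].
have taun : tau n = t by rewrite /tau mulrCA divff ?mulr1 // pnatr_eq0.
have taut i : (i <= n)%N -> tau i <= t.
  by move=> ni; rewrite -[leRHS]taun; apply: ler_wpM2r; [rewrite divr_ge0|rewrite ler_nat].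
pose Q i := sigop A (S (tau i) t) (y (tau i)).
have Q0 : Q 0%N = sigop A (S 0 t) y0 by rewrite /Q /tau mul0r yo.1.
have Qn : Q n = y t by rewrite /Q taun sigop_id // t0.
have QS i : (i < n)%N -> nrm (Q i.+1 - Q i) <=
    B * (C * Y * (sigma * ((W (tau i.+1) + D (tau i.+1)) - (W (tau i) + D (tau i))) + r)).
  move=> ni; have a0 := tau0 i; have ab := tauS i; have bt := taut i.+1 ni.
  set a := tau i in a0 ab *; set b := tau i.+1 in ab bt *.
  have b0 : 0 <= b := le_trans a0 ab.
  have bT : b <= T := le_trans bt tT.
  have bS := sig_bounded_signature b0 bt tT.
  have -> : Q i.+1 - Q i = sigop A (S b t) (y b - sigop A (S a b) (y a)).
    rewrite (sigopB L0 HL kap_ge0 (pinc_ge0 p W 0 T) kap_small _ _ bS) /Q.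
    rewrite (@sigop_chen _ _ _ A L kap _ L0 HL kap_ge0 (pinc_ge0 p W 0 T) kap_small (S a b) (S b t) (S a t)
      _ _ _ (y a) (sig_bounded_signature a0 ab bT) bS (sig_bounded_signature a0 (le_trans ab bt) tT)) //.
    by move=> w; rewrite S_chen.
  apply: (le_trans (HB _ _ _ bS)); apply: ler_wpM2l => //.
  have hD := Dm a b a0 ab bT; have hW := W_mono a0 ab bT.
  have D1 := Dm 0 a (lexx 0) a0 (le_trans ab bT).
  have D2 := Dm b T b0 bT (lexx T).
  have Dab : D b - D a <= rho by lra.
  have ban : b - a = t / n%:R.
    rewrite /b /a /tau -mulrBl (_ : i.+1%:R - i%:R = 1) ?mul1r //.
    by rewrite -natr1 addrAC subrr add0r.
  have Wab : W b - W a <= mu / 2.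
    have := Hdl b a; rewrite ger0_norm ?subr_ge0 // ger0_norm ?subr_ge0 //.
    rewrite b0 bT a0 (le_trans ab bT) => /(_ isT isT) H; apply: ltW; apply: H.
    by rewrite ban; apply: le_lt_trans nP; apply: ler_wpM2r; rewrite // invr_ge0.
  have Umu : (W b + D b) - (W a + D a) <= mu by lra.
  have muom : mu <= om0 by rewrite ge_min lexx.
  have musig : mu <= sigma `^ (theta - 1)^-1 by rewrite ge_min lexx orbT.
  have Dr1 : pinc D a b <= r.
    by apply: pinc_small; [exact: ltW|rewrite subr_ge0|exact: le_trans rho_r].
  have r1' : r <= 1 by rewrite ge_min lexx.
  apply: (le_trans (HC _ _ _ _ _ _ _ _ Y dn yo HYt a0 ab bT (le_trans Umu muom) (le_trans Dr1 r1'))).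
  apply: ler_wpM2l; first by rewrite mulr_ge0.
  apply: lerD => //; apply: powR_superlinear => //; first lra.
  exact: le_trans musig.
have sumQ : Q n - Q 0%N = \sum_(0 <= i < n) (Q i.+1 - Q i) by rewrite telescope_sumr.
rewrite -Qn -Q0 sumQ; apply: (le_trans (nrm_sum _ _ _)).
pose U i := W (tau i) + D (tau i).
apply: (@le_trans _ _ (\sum_(0 <= i < n) B * (C * Y * (sigma * (U i.+1 - U i) + r)))).
  by rewrite big_nat [leRHS]big_nat; apply: ler_sum => i /= /QS.
rewrite -mulr_sumr -mulr_sumr big_split /= -mulr_sumr (telescope_nat U).
rewrite sumr_const_nat subn0 -[r *+ n]mulr_natl mulrA mulrDr.
have Ub : U n - U 0%N <= Wt.
  rewrite /U taun /tau mul0r /Wt.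
  have := W_mono t0 tT (lexx T); have := Dm t T t0 tT (lexx T); lra.
have s1 : B * (C * Y) * (sigma * (U n - U 0%N)) <= e / 2.
  apply: (@le_trans _ _ ((B * (C * Y) * Wt + 1) * sigma)).
    rewrite [leRHS]mulrC mulrCA; apply: ler_wpM2l; first exact: ltW.
    apply: (@le_trans _ _ (B * (C * Y) * Wt)); last by rewrite lerDl.
    by apply: ler_wpM2l.
  by rewrite mulrC /sigma divfK // gt_eqF // ltr_wpDl // mulr_ge0 // ltW.
have s2 : B * (C * Y) * (n%:R * r) <= e / 2.
  apply: (@le_trans _ _ ((B * (C * Y) * n%:R + 1) * r)).
    by rewrite (mulrA _ n%:R); apply: ler_wpM2r; [exact: ltW|rewrite lerDl].
  rewrite mulrC -ler_pdivlMr; last by rewrite ltr_wpDl // mulr_ge0.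
  by rewrite ge_min lexx orbT.
lra.
Qed.

End RoughConvergence.

(** * Control of the signature *)

Section ProjectiveNorm.
Variables (R : realType) (d n : nat).

Lemma pure_tensor_le (v : 'I_n -> 'rV[R]_d) (w : n.-tuple 'I_d) :
  `|pure_tensor v w| <= \prod_(j < n) euclid_norm (v j).
Proof.
rewrite ffunE normr_prod; apply: ler_prod => j _; rewrite normr_ge0 /=.
rewrite /euclid_norm -sqrtr_sqr; apply: ler_wsqrtr.
by rewrite (bigD1 (tnth w j)) //= lerDl; apply: sumr_ge0 => i _; exact: sqr_ge0.
Qed.

(** Each decomposition into pure tensors bounds every coordinate. The basis expansion shows that
    decompositions exist; the infimum of the empty set would be the default 0. *)
Lemma coord_le_proj_norm (x : tensor R d n) (w : n.-tuple 'I_d) : `|x w| <= proj_norm x.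
Proof.
rewrite /proj_norm; apply: lb_le_inf; last first.
  move=> r [m [c [v [xE ->]]]]; rewrite xE; apply: (le_trans (ler_norm_sum _ _ _)).
  by apply: ler_sum => l _; rewrite normrM; apply: ler_wpM2l => //; exact: pure_tensor_le.
pose u (l : 'I_#|{: n.-tuple 'I_d}|) := enum_val l.
exists (\sum_(l < #|{: n.-tuple 'I_d}|) `|x (u l)| * \prod_(j < n) euclid_norm (delta_mx ord0 (tnth (u l) j) : 'rV[R]_d)).
exists #|{: n.-tuple 'I_d}|, (fun l => x (u l)), (fun l j => delta_mx ord0 (tnth (u l) j)); split=> // w'.
rewrite (bigD1 (enum_rank w')) //= /u enum_rankK big1 ?addr0 => [|l lw].
  by rewrite ffunE big1 ?mulr1 // => j _; rewrite mxE !eqxx.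
rewrite ffunE; have [j jl] : exists j, tnth w' j != tnth (enum_val l) j.
  apply/existsP; rewrite -negb_forall; apply: contra lw => /forallP H.
  by apply/eqP; rewrite -[l]enum_valK; congr (enum_rank _); apply: eq_from_tnth => j; apply/esym/eqP/H.
by rewrite (bigD1 j) //= mxE eqxx (negbTE jl) mul0r mulr0.
Qed.

End ProjectiveNorm.

(** * Growth of the Gamma function *)

Section GammaGrowth.
Variable R : realType.
Implicit Types a x t : R.

Lemma powR_le_expR x : 0 <= x -> exists2 C : R, 0 <= C &
  forall t, 0 < t -> t `^ x <= C * expR (t / 2).
Proof.
move=> x0; pose m := (Num.truncn x).+1.
have xm : x <= m%:R by apply: ltW; apply: truncnS_gt.
have m0 : 0 < m%:R :> R by rewrite ltr0n.
exists (1 + (2 * m%:R) ^+ m) => [|t t0]; first by rewrite addr_ge0 // exprn_ge0 // mulr_ge0.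
have e1 : 1 <= expR (t / 2) by rewrite -[leLHS]expR0 ler_expR divr_ge0 // ltW.
have em : t ^+ m <= (2 * m%:R) ^+ m * expR (t / 2).
  have -> : expR (t / 2) = expR (t / 2 / m%:R) ^+ m.
    by rewrite -expRM_natl [m%:R * _]mulrC divfK // gt_eqF.
  rewrite -exprMn; apply: lerXn2r; rewrite ?nnegrE ?(ltW t0) ?mulr_ge0 ?expR_ge0 //.
  have := expR_ge1Dx (t / 2 / m%:R) => h.
  apply: (@le_trans _ _ (2 * m%:R * (t / 2 / m%:R))).
    by rewrite le_eqVlt; apply/orP; left; apply/eqP; field; rewrite gt_eqF.
  by apply: ler_wpM2l; rewrite ?mulr_ge0 //; lra.
have [t1|t1] := leP t 1.
  have h : t `^ x <= 1.
    have -> : 1 = 1 `^ x :> R by rewrite powR1.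
    by apply: ge0_ler_powR; rewrite ?nnegrE // ltW.
  have := exprn_ge0 m (ltW t0); rewrite mulrDl; lra.
have h : t `^ x <= t ^+ m by rewrite -powR_mulrn ?(ltW t0) // ler_powR // ltW.
by rewrite mulrDl mul1r; have := expR_ge0 (t / 2); lra.
Qed.

(* The integrand of Gamma on [a, a + 1]. *)
Lemma Gamma_ge x a : 0 <= x -> 0 < a -> a `^ x * expR (- (a + 1)) <= Gamma (x + 1).
Proof.
move=> x0 a0; rewrite /Gamma addrK /Rintegral.
pose f t := t `^ x * expR (- t).
have f0 t : 0 <= f t by rewrite mulr_ge0 ?powR_ge0 ?expR_ge0.
have mf (D : set (measurableTypeR R)) : measurable D -> measurable_fun D (fun t : measurableTypeR R => (f t)%:E).
  move=> mD; apply/measurable_EFinP; apply: measurable_funM.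
    by apply: measurable_funTS; exact: measurable_powR.
  by apply: measurable_funTS; apply: measurableT_comp; [exact: measurable_expR|exact: oppr_measurable].
(* Finiteness matters, since [fine] sends an infinite integral to 0. The integrand is dominated by a
   multiple of the exponential density of rate 1/2. *)
rewrite -lee_fin fineK; last first.
  rewrite ge0_fin_numE; last by apply: integral_ge0 => t _; rewrite lee_fin; exact: f0.
  have [C C0 HC] := powR_le_expR x0.
  have half0 : 0 < (2^-1 : R) by [].
  apply: (@le_lt_trans _ _ (\int[lebesgue_measure]_(t in `]0%R, +oo[) (((2 * C)%:E) * (exponential_pdf 2^-1 t)%:E))%E).
    apply: ge0_le_integral => //.
    - by move=> t _; rewrite lee_fin; exact: f0.
    - exact: mf.
    - apply: measurable_funeM; apply: measurable_funTS; apply/measurable_EFinP.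
      exact: measurable_exponential_pdf.
    - move=> t /=; rewrite in_itv /= andbT => t0.
      rewrite -EFinM lee_fin exponential_pdfE ?(ltW t0) //.
      apply: (@le_trans _ _ (C * expR (t / 2) * expR (- t))).
        by apply: ler_wpM2r; [exact: expR_ge0|exact: HC].
      rewrite -[leLHS]mulrA -expRD (_ : 2 * C * _ = C * expR (- 2^-1 * t)); last by field.
      by rewrite (_ : t / 2 - t = - 2^-1 * t) //; field.
  rewrite ge0_integralZl_EFin //.
  - rewrite lte_mul_pinfty ?lee_fin ?mulr_ge0 //.
    apply: (@le_lt_trans _ _ (\int[lebesgue_measure]_t (exponential_pdf (2^-1 : R) t)%:E)%E).
      apply: ge0_subset_integral => //.
      + by apply/measurable_EFinP; exact: measurable_exponential_pdf.
      + by move=> t _; rewrite lee_fin exponential_pdf_ge0.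
    by rewrite integral_exponential_pdf // ltry.
  - by move=> t _; rewrite lee_fin exponential_pdf_ge0.
  - apply: measurable_funTS; apply/measurable_EFinP; exact: measurable_exponential_pdf.
  - by rewrite mulr_ge0.
apply: (@le_trans _ _ (\int[lebesgue_measure]_(t in `[a, (a + 1)%R]) (f t)%:E)%E); last first.
  apply: ge0_subset_integral => //.
  - exact: mf.
  - by move=> t _; rewrite lee_fin.
  - by move=> t /=; rewrite !in_itv /= andbT => /andP[+ _]; exact: lt_le_trans.
apply: (@le_trans _ _ (\int[lebesgue_measure]_(t in `[a, (a + 1)%R]) (a `^ x * expR (- (a + 1)))%:E)%E).
  rewrite integral_cst // [X in (_ * X)%E](_ : _ = 1%E) ?mule1 //.
  apply: (etrans (lebesgue_measure_itv `[a, (a + 1)%R])).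
  by rewrite /= lte_fin ltrDl ltr01 -EFinB addrAC subrr add0r.
apply: ge0_le_integral => //.
- by move=> t _; rewrite lee_fin mulr_ge0 ?powR_ge0 ?expR_ge0.
- exact: mf.
- move=> t /=; rewrite in_itv /= => /andP[at1 ta]; rewrite lee_fin.
  apply: ler_pM; rewrite ?powR_ge0 ?expR_ge0 //; last by rewrite ler_expR lerN2.
  by apply: ge0_ler_powR; rewrite ?nnegrE // ?(ltW a0) // (le_trans (ltW a0)).
Qed.

Lemma Gamma_gt0 x : 0 <= x -> 0 < Gamma (x + 1).
Proof.
move=> x0; apply: lt_le_trans (Gamma_ge x0 ltr01).
by rewrite mulr_gt0 ?powR_gt0 ?expR_gt0.
Qed.

(** The point [a] of [Gamma_ge] is free: for [a = (r + 1) ^ p], the power [a ^ (n / p)] is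
    [(r + 1) ^ n], with a prefactor independent of [n]. *)
Lemma inv_Gamma_small (p r : R) : 0 < p -> 0 <= r -> exists C : R,
  forall n, (Gamma (n%:R / p + 1))^-1 * r ^+ n <= C.
Proof.
move=> p0 r0; pose a := (r + 1) `^ p.
have r10 : 0 < r + 1 by lra.
have a0 : 0 < a by exact: powR_gt0.
exists (expR (a + 1)) => n.
have np : 0 <= n%:R / p by rewrite divr_ge0 // ltW.
have := Gamma_ge np a0.
have -> : a `^ (n%:R / p) = (r + 1) ^+ n.
  by rewrite /a -powRrM mulrCA divff ?gt_eqF // mulr1 powR_mulrn // ltW.
rewrite expRN => h.
have G0 := Gamma_gt0 np.
rewrite mulrC ler_pdivrMr // -(ler_pdivrMl _ _ (expR_gt0 _)) mulrC.
apply: le_trans h; apply: ler_wpM2r; first by rewrite invr_ge0 expR_ge0.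
by apply: lerXn2r; rewrite ?nnegrE //; lra.
Qed.

End GammaGrowth.

(** * From p-variation and controls to increments of one function *)

Section ChainSums.
Variables (R : realType) (T : R) (phi : R -> R -> R) (rho : R).
Hypotheses (T_ge0 : 0 <= T) (phi_ge0 : forall s t, 0 <= phi s t).

Definition chain_sum (s : seq R) := \sum_(0 <= j < size s)
  phi (nth T (0 :: s) j) (nth T (0 :: s) j.+1).

Hypothesis phi_sum : forall s, itv_partition 0 T s -> chain_sum s <= rho.

Lemma chain_sum_rcons s u : chain_sum (rcons s u) = chain_sum s + phi (last 0 s) u.
Proof.
rewrite /chain_sum size_rcons big_nat_recr //= nth_rcons ltnn eqxx.
congr (_ + phi _ _).
  rewrite big_nat [RHS]big_nat; apply: eq_bigr => j /= js.
  rewrite nth_rcons js; congr (phi _ _).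
  by case: j js => // j js; rewrite /= nth_rcons (ltnW js).
case: s => [//|a s] /=; rewrite -rcons_cons nth_rcons /= ltnSn.
by have := nth_last T (a :: s) => /= ->.
Qed.

Lemma itv_partition_rcons (a t u : R) s : itv_partition a t s -> t < u ->
  itv_partition a u (rcons s u).
Proof. by move=> [ps /eqP st] tu; split; rewrite ?rcons_path ?last_rcons ?ps ?st. Qed.

(* D t is the supremum of the chain sums over the partitions of [0, t]. *)
Lemma dominating_increment : exists D : R -> R,
  [/\ forall s t, 0 <= s -> s <= t -> t <= T -> D s <= D t,
      D T - D 0 <= rho &
      forall s t, 0 <= s -> s < t -> t <= T -> phi s t <= D t - D s].
Proof.
pose E t := [set chain_sum s | s in itv_partition 0 t].
have E0 t : 0 <= t -> E t !=set0.
  move=> t0; have [s sP _] := @fine_partition R 1 0 t ltr01 t0.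
  by exists (chain_sum s); exists s.
have Eub t : t <= T -> ubound (E t) rho.
  rewrite le_eqVlt => /orP[/eqP -> |tT] r [s sP <-]; first exact: phi_sum.
  apply: le_trans (phi_sum (itv_partition_rcons sP tT)).
  by rewrite chain_sum_rcons lerDl.
have hE t : 0 <= t -> t <= T -> has_sup (E t).
  by move=> t0 tT; split; [exact: E0|exists rho; exact: Eub].
have inc s t : 0 <= s -> s < t -> t <= T -> phi s t <= sup (E t) - sup (E s).
  move=> s0 st tT; rewrite lerBrDl -lerBrDr.
  apply: ge_sup; first exact: E0.
  move=> r [c cP <-]; rewrite lerBrDr.
  apply: ub_le_sup; first exact: (hE t (le_trans s0 (ltW st)) tT).2.
  exists (rcons c t); first exact: itv_partition_rcons cP st.
  by rewrite chain_sum_rcons; case: cP => _ /eqP ->.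
exists (fun t => sup (E t)); split=> //.
  move=> s t s0; rewrite le_eqVlt => /orP[/eqP -> //|st] tT.
  by rewrite -subr_ge0 (le_trans _ (inc s t s0 st tT)).
have h1 : sup (E T) <= rho by apply: ge_sup; [exact: E0|exact: Eub].
have h2 : 0 <= sup (E 0).
  apply: ub_le_sup; first exact: (hE 0 (lexx 0) T_ge0).2.
  by exists [::]; [split => //=|rewrite /chain_sum big_nil].
lra.
Qed.

End ChainSums.

Section FromDefinitions.
Variables (R : realType) (d : nat) (p gamma T : R).
Variables (X : R -> R -> trunc_tensor R d (Num.truncn p)) (S : R -> R -> tensor_series R d).
Hypotheses (T_gt0 : 0 < T) (p_gt2 : 2 < p) (gamma_gt0 : 0 < gamma).
Hypothesis S_signature : is_signature gamma T X S.

Local Notation N := (Num.truncn p).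

Lemma level_in_tuple (Z : tensor_series R d) w : level (size w) Z (in_tuple w) = Z w.
Proof. by rewrite ffunE. Qed.

Lemma series_of_truncE (Z : tensor_series R d) w : (size w <= N)%N ->
  series_of_trunc (trunc_of_series N Z) w = Z w.
Proof.
move=> wN; rewrite /series_of_trunc.
by case: insubP => [u _ uw|]; [rewrite ffunE uw|rewrite wN].
Qed.

Lemma powR_le_root (b c : R) n : 0 <= b -> (0 < n)%N -> b `^ (p / n%:R) <= c ->
  b <= (c `^ p^-1) ^+ n.
Proof.
move=> b0 n0 h; have p0 : 0 < p := lt_trans (ltr0n R 2) p_gt2.
have nR : 0 < n%:R :> R by rewrite ltr0n.
have c0 : 0 <= c := le_trans (powR_ge0 _ _) h.
rewrite -powR_mulrn ?powR_ge0 // -powRrM.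
have {1}-> : b = (b `^ (p / n%:R)) `^ (p^-1 * n%:R).
  rewrite -powRrM (_ : p / n%:R * (p^-1 * n%:R) = 1) ?powRr1 //.
  by field; rewrite !gt_eqF.
by apply: ge0_ler_powR; rewrite ?nnegrE ?powR_ge0 // mulr_ge0 // ?invr_ge0 ltW.
Qed.

Lemma control_ucont (w : R -> R -> R) :
  {within simplex T, continuous (fun st : R * R => w st.1 st.2)} -> ucont 0 T (w 0).
Proof.
move=> /subspace_continuousP cw; apply: within_ucont; apply/subspace_continuousP => t /=.
rewrite in_itv /= => /andP[t0 tT].
have st : simplex T (0, t) by rewrite /simplex /= lexx.
apply/cvgrPdist_lt => e e0.
have := cw _ st => /cvgrPdist_lt/(_ e e0); rewrite /prop_near1 /within /=.
move=> /nbhs_ballP[r /= r0 Hr]; exists r => //= u tu; rewrite in_itv /= => /andP[u0 uT].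
apply: (Hr (0, u)) => /=; last by rewrite /simplex /= lexx.
by split => //=; exact: ballxx.
Qed.

Lemma signature_nil s t : 0 <= s -> s <= t -> t <= T -> S s t [::] = 1.
Proof. by move=> s0 st tT; have [H _ _ _] := S_signature; apply: H; rewrite /simplex /= s0. Qed.

Lemma signature_chen s u t : 0 <= s -> s <= u -> u <= t -> t <= T ->
  tensor_mul (S s u) (S u t) = S s t.
Proof.
by move=> s0 su ut tT; have [_ H _ _] := S_signature; apply: H; rewrite ?s0 ?ut.
Qed.

(** By superadditivity [w s t <= w 0 t - w 0 s], so the control turns into the increment of the
    single function [w 0]. Level 0 equals 1 rather than being small, hence the separate value of
    [kap] there. *)
Lemma signature_control : exists (W : R -> R) (kap : nat -> R),
  [/\ ucont 0 T W, forall s t, 0 <= s -> s <= t -> t <= T -> W s <= W t,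
      forall n, 0 <= kap n,
      forall r : R, 0 <= r -> exists C : R, forall n, kap n * r ^+ n <= C &
      forall s t w, 0 <= s -> s <= t -> t <= T ->
        `|S s t w| <= kap (size w) * pinc p W s t ^+ size w].
Proof.
have p0 : 0 < p := lt_trans (ltr0n R 2) p_gt2.
have [_ _ _ [w [cw w0 wd wadd] wb]] := S_signature.
have winc s t : 0 <= s -> s <= t -> t <= T -> w s t <= w 0 t - w 0 s.
  by move=> s0 st tT; rewrite lerBrDl; apply: wadd; rewrite ?lexx ?s0 ?st.
have wge s t : 0 <= s -> s <= t -> t <= T -> 0 <= w s t.
  by move=> s0 st tT; apply: w0; rewrite /simplex /= s0.
pose G n := Gamma (n%:R / p + 1) * gamma.
have G0 n : 0 < G n by rewrite mulr_gt0 // Gamma_gt0 // divr_ge0 // ltW.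
exists (w 0), (fun n => if n == 0%N then 1 else (G n)^-1); split.
- exact: control_ucont.
- by move=> s t s0 st tT; rewrite -subr_ge0 (le_trans (wge s t s0 st tT)) ?winc.
- by move=> n; case: ifP => // _; rewrite invr_ge0 ltW.
- move=> r r0; have [C HC] := inv_Gamma_small p0 r0.
  have C0 : 0 <= C.
    apply: le_trans (HC 0%N); rewrite expr0 mulr1 mul0r invr_ge0 ltW //.
    exact: Gamma_gt0.
  exists (1 + C / gamma) => -[|n] /=.
    by rewrite expr0 mulr1 lerDl divr_ge0 // ltW.
  rewrite /G invfM mulrAC; apply: (@le_trans _ _ (C / gamma)); last by rewrite lerDr.
  by apply: ler_wpM2r; [rewrite invr_ge0 ltW|exact: HC].
- move=> s t u s0 st tT; case: eqP => [/size0nil ->|/eqP].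
    by rewrite signature_nil // normr1 expr0 mulr1.
  rewrite -lt0n => u0; rewrite mulrC ler_pdivlMr //.
  have st' : simplex T (s, t) by rewrite /simplex /= s0.
  have := wb (size u) u0 s t st'; rewrite -/(G _) => h.
  have P0 : 0 <= proj_norm (level (size u) (S s t)).
    by apply: le_trans (coord_le_proj_norm _ (in_tuple u)).
  have := powR_le_root (mulr_ge0 (ltW (G0 _)) P0) u0 (le_trans h (winc s t s0 st tT)).
  apply: le_trans; rewrite mulrC; apply: ler_wpM2l; first exact: ltW.
  by rewrite -(level_in_tuple (S s t) u); exact: coord_le_proj_norm.
Qed.

Lemma pvar_level_sum (Y : R -> R -> trunc_tensor R d N) (eps : R) n : 0 < eps ->
  (pvar_dist T Y X < eps%:E)%E -> (1 <= n <= N)%N ->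
  forall s, itv_partition 0 T s ->
  chain_sum T (fun s t => proj_norm (level n (series_of_trunc (Y s t)) -
    level n (series_of_trunc (X s t))) `^ (p / n%:R)) s <= eps `^ p.
Proof.
move=> e0; have p0 : 0 < p := lt_trans (ltr0n R 2) p_gt2.
move=> Alt nN s sP.
pose phi m s t := proj_norm (level m (series_of_trunc (Y s t)) -
  level m (series_of_trunc (X s t))) `^ (p / m%:R).
pose F m := ereal_sup [set (chain_sum T (phi m) s)%:E | s in itv_partition 0 T].
pose A := (\sum_(1 <= m < N.+1) F m)%E.
have {}Alt : (A `^ p^-1 < eps%:E)%E := Alt.
have F0 m : (0 <= F m)%E.
  apply: (@le_trans _ _ (chain_sum T (phi m) s)%:E).
    by rewrite lee_fin sumr_ge0 // => i _; exact: powR_ge0.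
  by apply: ereal_sup_ubound; exists s.
have A0 : (0 <= A)%E by rewrite /A sume_ge0.
have Ale : (A <= (eps `^ p)%:E)%E.
  move: Alt A0; case: A => [a| |]; [|by rewrite poweRyr ?invr_eq0 ?gt_eqF // ltNge leey|by []].
  rewrite poweR_EFin lte_fin lee_fin => h a0; rewrite lee_fin.
  have -> : a = (a `^ p^-1) `^ p by rewrite -powRrM mulVf ?gt_eqF // powRr1.
  by apply: ge0_ler_powR; rewrite ?nnegrE ?powR_ge0 // ltW.
rewrite -lee_fin; apply: le_trans Ale; apply: (@le_trans _ _ (F n)).
  by apply: ereal_sup_ubound; exists s.
rewrite /A (bigD1_seq n) ?iota_uniq ?mem_index_iota ?ltnS //=.
by rewrite leeDl // sume_ge0.
Qed.

(** [dominating_increment] gives a function [D n] for each level, and their sum dominates all levels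
    at once; a multiple of [v] is added for the field [near_eta]. *)
Lemma pvar_driver_near W kap x v (eps : R) :
  (forall s t, 0 <= s -> s <= t -> t <= T -> W s <= W t) ->
  (forall s t w, 0 <= s -> s <= t -> t <= T ->
     `|S s t w| <= kap (size w) * pinc p W s t ^+ size w) ->
  0 < eps -> (pvar_dist T (trunc_signature N x) X < eps%:E)%E ->
  ucont 0 T v -> (forall s t, 0 <= s -> s <= t -> t <= T -> v s <= v t) ->
  (forall i, dominated 0 T v (fun t => x t ord0 i)) ->
  exists D, driver_near T p N S (N.+1%:R * eps `^ p) x v D.
Proof.
move=> Wm S_le e0 dist vu vm xd.
pose phi n s t := proj_norm (level n (series_of_trunc (trunc_signature N x s t)) -
    level n (series_of_trunc (X s t))) `^ (p / n%:R).
have /choice [D HD] : forall n, exists D : R -> R, (1 <= n <= N)%N ->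
  [/\ forall s t, 0 <= s -> s <= t -> t <= T -> D s <= D t,
      D T - D 0 <= eps `^ p &
      forall s t, 0 <= s -> s < t -> t <= T -> phi n s t <= D t - D s].
  move=> n; have [nN|_] := boolP (1 <= n <= N)%N; last by exists (cst 0).
  have [D HD] := dominating_increment (ltW T_gt0) (fun s t => powR_ge0 _ _)
    (pvar_level_sum e0 dist nN).
  by exists D.
have V0 : 0 < v T - v 0 + 1 by rewrite ltr_wpDl // subr_ge0 vm // ltW.
have ep0 : 0 < eps `^ p by exact: powR_gt0.
(* The total increment of [eta * v] is at most one more [eps ^ p]; together with the [N] levels this
   explains the factor [N.+1]. *)
pose eta := eps `^ p / (v T - v 0 + 1).
have eta0 : 0 < eta by rewrite divr_gt0.
pose DD t := \sum_(1 <= n < N.+1) D n t + eta * v t.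
have DDE s t : DD t - DD s = \sum_(1 <= n < N.+1) (D n t - D n s) + eta * (v t - v s).
  by rewrite /DD sumrB mulrBr; ring.
have sumD0 s t (P : pred nat) : 0 <= s -> s <= t -> t <= T ->
    0 <= \sum_(1 <= n < N.+1 | P n) (D n t - D n s).
  move=> s0 st tT; rewrite big_nat_cond; apply: sumr_ge0 => n /andP[nN _].
  by rewrite subr_ge0; have [] := HD n nN; move=> H _ _; exact: H.
exists DD; split=> //.
- move=> s t s0 st tT; rewrite -subr_ge0 DDE addr_ge0 ?sumD0 //.
  by rewrite mulr_ge0 ?(ltW eta0) // subr_ge0 vm.
- rewrite DDE -natr1 mulrDl mul1r; apply: lerD.
    rewrite big_nat; apply: (@le_trans _ _ (\sum_(1 <= n < N.+1) eps `^ p)).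
      by rewrite [leRHS]big_nat; apply: ler_sum => n nN; have [] := HD n nN.
    by rewrite sumr_const_nat subn1 mulr_natl.
  by rewrite /eta mulrAC ler_pdivrMr // ler_pM2l // lerDl.
- by exists eta => // s t s0 st tT; rewrite DDE lerDr sumD0.
(* [dominating_increment] concerns [s < t] only; for [s = t] both signatures vanish on nonempty
   words. *)
- move=> s t w s0; rewrite le_eqVlt => /orP[/eqP <-|st] tT wN.
    have w0 : (0 < size w)%N by case/andP: wN.
    have -> : path_signature x s s w = 0.
      apply/eqP; rewrite -normr_le0.
      apply: (le_trans (path_signature_le vu vm xd w s0 (lexx s) tT)).
      by rewrite subrr expr0n gtn_eqF.
    have -> : S s s w = 0.
      apply/eqP; rewrite -normr_le0; apply: (le_trans (S_le s s w s0 (lexx s) tT)).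
      rewrite /pinc subrr powR0 ?expr0n ?gtn_eqF ?mulr0 // invr_eq0 gt_eqF //.
      exact: lt_trans p_gt2.
    by rewrite subrr normr0 exprn_ge0 // pinc_ge0.
  have [Dm _ Dphi] := HD (size w) wN.
  have [_ _ XS _] := S_signature.
  have st' : simplex T (s, t) by rewrite /simplex /= s0 ltW.
  have wle : (size w <= N)%N by case/andP: wN.
  set P := level (size w) (series_of_trunc (trunc_signature N x s t)) -
    level (size w) (series_of_trunc (X s t)).
  have PE : P (in_tuple w) = path_signature x s t w - S s t w.
    by rewrite /P -(XS s t st') !ffunE !series_of_truncE.
  have P0 : 0 <= proj_norm P by apply: le_trans (coord_le_proj_norm P (in_tuple w)).
  rewrite -PE; apply: (le_trans (coord_le_proj_norm P (in_tuple w))).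
  apply: powR_le_root => //; first by case/andP: wN.
  apply: (le_trans (Dphi s t s0 st tT)); rewrite DDE.
  rewrite (bigD1_seq (size w)) ?iota_uniq ?mem_index_iota ?ltnS //= -addrA lerDl.
  rewrite addr_ge0 ?sumD0 ?(ltW st) //.
  by rewrite mulr_ge0 ?(ltW eta0) // subr_ge0 vm // ltW.
Qed.

End FromDefinitions.

(** * Linear rough differential equations *)

Section Transfer.
Variables (R : realType) (d : nat) (T : R).
Hypothesis T_gt0 : 0 < T.

Lemma eq_ucont a b (f g : R -> R) : (forall t, a <= t <= b -> f t = g t) ->
  ucont a b f -> ucont a b g.
Proof.
move=> fg uf e /uf [dl dl0 H]; exists dl => // s t sab tab st.
by rewrite -!fg //; exact: H.
Qed.

Lemma eq_tangent_fun a b v (f g : R -> R) mu : (forall t, a <= t <= b -> f t = g t) ->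
  tangent a b v f mu -> tangent a b v g mu.
Proof.
move=> fg tf e /tf [dl dl0 H]; exists dl => // s t as_ st tb std.
rewrite -!fg; first exact: H.
- by rewrite as_ (le_trans st).
- by rewrite tb (le_trans as_).
Qed.

Lemma uniform_cvgP (F : nat -> R -> R) (g : R -> R) :
  {uniform `[0, T], F @ \oo --> g} <->
  (forall e, 0 < e -> exists M, forall m, (M <= m)%N -> forall t, 0 <= t <= T ->
    `|g t - F m t| < e).
Proof.
split=> [H e e0|H].
  have : nbhs (g : {uniform` `[0, T]%classic -> R}) [set h | forall t, 0 <= t <= T -> `|g t - h t| < e].
    apply/uniform_nbhs; exists [set xy | ball xy.1 e xy.2]; split.
      by rewrite -entourage_ballE; exists e.
    by move=> h /= Hh t tT; apply: Hh; rewrite /= in_itv.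
  by move=> /H [M _ HM]; exists M => m Mm; exact: HM.
move=> P /uniform_nbhs [E []]; rewrite -entourage_ballE => -[e /= e0 eE] EP.
have [M HM] := H e e0; exists M => // m /= Mm; apply: EP => t /=; rewrite in_itv /= => tT.
by apply: eE => /=; exact: HM.
Qed.

Variables (E : Type) (I : finType) (c : I -> E -> R).

Definition cvec (y : E) : {ffun I -> R} := [ffun a => c a y].

Section OneDriver.
Variables (x : R -> 'rV[R]_d) (v : R -> R).
Hypotheses (v_ucont : ucont 0 T v)
  (v_mono : forall s t, 0 <= s -> s <= t -> t <= T -> v s <= v t)
  (x_dom : forall i, dominated 0 T v (fun t => x t ord0 i)).
Variables (V : E -> 'rV[R]_d -> E) (y0 : E).
Local Notation field j y := (cvec (V y (delta_mx ord0 j))).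

(** [driven_integral] provides the germ of the integrated right-hand side, which agrees with the
    solution on [[0, T]]. *)
Lemma ode_solution_driven (Y : R -> E) :
  (forall j a, ucont 0 T (fun t => field j (Y t) a)) ->
  ode_solution c T V y0 x Y ->
  cvec (Y 0) = cvec y0 /\ driven T x v (fun t => cvec (Y t)) (fun j t => field j (Y t)).
Proof.
move=> uf sol; have T0 : 0 <= T := ltW T_gt0.
have E1 a j : (fun u => c a (V (Y u) (delta_mx ord0 j))) = (fun u => field j (Y u) a).
  by apply/funext => u; rewrite ffunE.
have E2 t a : 0 <= t <= T -> [ffun b => (cvec y0) b + \sum_j RS_integral (fun s => field j (Y s) b)
    (fun s => x s ord0 j) 0 t] a = cvec (Y t) a.
  move=> tT; have [_ H] := sol a; rewrite !ffunE (H t tT).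
  by congr (_ + _); apply: eq_bigr => j _; rewrite E1.
have dI := driven_integral (I := I) T0 v_ucont v_mono x_dom (cvec y0) uf.
split.
  apply/ffunP => a; rewrite -E2 ?lexx // ffunE big1 ?addr0 // => j _.
  exact: RS_integral_xx.
move=> a; have [h1 h2] := dI a; split.
  by apply: (eq_ucont _ h1) => t tT; rewrite -(E2 t a tT).
by apply: (eq_tangent_fun _ h2) => t tT; rewrite -(E2 t a tT).
Qed.

Lemma driven_ode_solution (Y : R -> E) :
  (forall j a, ucont 0 T (fun t => field j (Y t) a)) ->
  cvec (Y 0) = cvec y0 -> driven T x v (fun t => cvec (Y t)) (fun j t => field j (Y t)) ->
  ode_solution c T V y0 x Y.
Proof.
move=> uf Y0 dr a; have T0 : 0 <= T := ltW T_gt0.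
have E0 t : cvec (Y t) a = c a (Y t) by rewrite ffunE.
have [h1 h2] := dr a; split.
  by apply: ucont_within; apply: eq_ucont h1 => t _.
move=> t tT; have dI := driven_integral (I := I) T0 v_ucont v_mono x_dom (cvec y0) uf.
pose Z t := [ffun b => cvec y0 b + \sum_j RS_integral (fun s => field j (Y s) b) (fun s => x s ord0 j) 0 t].
have Z0 : cvec (Y 0) a = Z 0 a.
  rewrite Y0 [RHS]ffunE big1 ?addr0 // => j _; exact: RS_integral_xx.
have EZ : cvec (Y t) a = Z t a := tangent_eq T0 v_mono h2 (dI a).2 Z0 tT.
rewrite -E0 EZ ffunE [cvec y0 a]ffunE; congr (_ + _); apply: eq_bigr => j _; congr RS_integral.
by apply/funext => u; rewrite ffunE.
Qed.

Variable A : 'I_d -> {linear {ffun I -> R} -> {ffun I -> R}}.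
Hypothesis V_linear : forall y j, field j y = A j (cvec y).

Lemma ode_solution_linear (Y : R -> E) : ode_solution c T V y0 x Y ->
  linear_ode T x v A (cvec y0) (fun t => cvec (Y t)).
Proof.
move=> sol.
have uf j a : ucont 0 T (fun t => field j (Y t) a).
  rewrite (_ : (fun t => _) = (fun t => A j (cvec (Y t)) a)).
    apply: ucont_linear => b; have [cb _] := sol b.
    by apply: eq_ucont (within_ucont cb) => t _; rewrite ffunE.
  by apply/funext => t; rewrite V_linear.
have [h1 h2] := ode_solution_driven uf sol; split=> // a; have [k1 k2] := h2 a; split=> //.
by apply: eq_tangent k2 => s t *; apply: eq_bigr => j _; rewrite V_linear.
Qed.

Lemma linear_ode_solution (Y : R -> E) : linear_ode T x v A (cvec y0) (fun t => cvec (Y t)) ->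
  ode_solution c T V y0 x Y.
Proof.
move=> [Y0 dr]; apply: driven_ode_solution => //.
  move=> j a; rewrite (_ : (fun t => _) = (fun t => A j (cvec (Y t)) a)).
    by apply: ucont_linear => b; exact: (dr b).1.
  by apply/funext => t; rewrite V_linear.
move=> a; have [k1 k2] := dr a; split=> //.
by apply: eq_tangent k2 => s t *; apply: eq_bigr => j _; rewrite V_linear.
Qed.

End OneDriver.

End Transfer.

Section HolderPaths.
Variables (R : realType) (T p : R) (W : R -> R).
Hypotheses (T_gt0 : 0 < T) (p_gt2 : 2 < p) (W_ucont : ucont 0 T W)
  (W_mono : forall s t, 0 <= s -> s <= t -> t <= T -> W s <= W t).

(** Hölder continuity of exponent 1/p in the clock [W]: it implies finite p-variation and is stable
    under the products that occur in [couple]. *)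
Definition hol (f : R -> R) := exists2 C : R, 0 <= C &
  forall s t, 0 <= s -> s <= t -> t <= T -> `|f t - f s| <= C * pinc p W s t.

Lemma hol_bounded f : hol f -> exists2 C : R, 0 <= C & forall t, 0 <= t <= T -> `|f t| <= C.
Proof.
move=> [C C0 H]; exists (`|f 0| + C * pinc p W 0 T).
  by rewrite addr_ge0 // mulr_ge0 // pinc_ge0.
move=> t /andP[t0 tT]; have h1 := H 0 t (lexx 0) t0 tT.
have h2 : C * pinc p W 0 t <= C * pinc p W 0 T.
  apply: ler_wpM2l => //; apply: pinc_le => //; first by rewrite subr_ge0 W_mono.
  by rewrite lerD2r W_mono.
have := ler_normD (f t - f 0) (f 0); rewrite subrK; lra.
Qed.

Lemma eq_hol f g : (forall t, 0 <= t <= T -> f t = g t) -> hol f -> hol g.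
Proof.
move=> fg [C C0 H]; exists C => // s t s0 st tT; rewrite -!fg; first exact: H.
- by rewrite s0 (le_trans st).
- by rewrite tT (le_trans s0).
Qed.

Lemma holM f g : hol f -> hol g -> hol (fun t => f t * g t).
Proof.
move=> hf hg; have [F F0 HF] := hol_bounded hf; have [G G0 HG] := hol_bounded hg.
have [C C0 HC] := hf; have [D D0 HD] := hg.
exists (C * G + F * D); first by rewrite addr_ge0 // mulr_ge0.
move=> s t s0 st tT.
rewrite [X in `|X| <= _](_ : _ = (f t - f s) * g t + f s * (g t - g s)); last by ring.
apply: (le_trans (ler_normD _ _)); rewrite !normrM mulrDl; apply: lerD.
  rewrite mulrAC; apply: ler_pM => //; [exact: HC|apply: HG].
  by rewrite tT (le_trans s0).
rewrite -mulrA; apply: ler_pM => //; [apply: HF|exact: HD].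
by rewrite s0 (le_trans st).
Qed.

Lemma hol_sum (J : Type) (r : seq J) (f : J -> R -> R) : (forall j, hol (f j)) ->
  hol (fun t => \sum_(j <- r) f j t).
Proof.
move=> H; elim: r => [|j r [C C0 HC]].
  by exists 0 => // s t *; rewrite !big_nil subrr normr0 mul0r.
have [D D0 HD] := H j; exists (D + C); first by rewrite addr_ge0.
move=> s t s0 st tT; rewrite !big_cons opprD addrACA mulrDl.
by apply: (le_trans (ler_normD _ _)); apply: lerD; [exact: HD|exact: HC].
Qed.

Lemma hol_ucont f : hol f -> ucont 0 T f.
Proof.
move=> [C C0 HC] e e0.
have C10 : 0 < C + 1 by rewrite ltr_wpDl.
have e1 : 0 < e / (C + 1) by rewrite divr_gt0.
have ep : 0 < (e / (C + 1)) `^ p by exact: powR_gt0.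
have [dl dl0 Hdl] := W_ucont ep; exists dl => //.
have main s t : 0 <= s -> s <= t -> t <= T -> t - s < dl -> `|f t - f s| < e.
  move=> s0 st tT std; apply: (le_lt_trans (HC s t s0 st tT)).
  have W0 : 0 <= W t - W s by rewrite subr_ge0 W_mono.
  have h : pinc p W s t <= e / (C + 1).
    apply: pinc_small => //; first exact: ltW.
    apply: ltW; have := Hdl t s; rewrite ger0_norm ?subr_ge0 // ger0_norm //; apply => //.
      by rewrite tT (le_trans s0).
    by rewrite s0 (le_trans st).
  apply: (@le_lt_trans _ _ (C * (e / (C + 1)))); first by apply: ler_wpM2l.
  by rewrite mulrCA gtr_pMr // ltr_pdivrMr // mul1r ltrDl.
move=> s t /andP[s0 sT] /andP[t0 tT]; have [st|/ltW ts] := leP s t.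
  by rewrite distrC ger0_norm ?subr_ge0 // distrC => /(main s t s0 st tT); rewrite distrC.
by rewrite ger0_norm ?subr_ge0 //; exact: main.
Qed.

Lemma finite_pvar_hol (E : Type) (I : finType) (c : I -> E -> R) (Y : R -> E) :
  (forall a, hol (fun t => c a (Y t))) -> finite_pvar c p T Y.
Proof.
move=> H a; split; first exact/ucont_within/hol_ucont.
have p0 : 0 < p := lt_trans (ltr0n R 2) p_gt2.
have [C C0 HC] := H a; exists (C `^ p * (W T - W 0)) => r [s sP <-].
rewrite -(telescope_partition W sP) mulr_sumr big_nat [leRHS]big_nat.
apply: ler_sum => i /= si; have [s1 s2 s3] := itv_partition_sorted sP si.
have h := HC _ _ s1 s2 s3; have W0 := W_mono s1 s2 s3.
apply: (@le_trans _ _ ((C * pinc p W (nth T (0 :: s) i) (nth T (0 :: s) i.+1)) `^ p)).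
  by apply: ge0_ler_powR; rewrite ?nnegrE ?(ltW p0) // mulr_ge0 // pinc_ge0.
rewrite powRM ?pinc_ge0 // /pinc -powRrM mulVf ?gt_eqF // powRr1 //.
by rewrite subr_ge0.
Qed.

End HolderPaths.

(** * Existence and uniqueness for linear rough equations *)

Section LinearRDE.
Variables (R : realType) (d : nat) (p gamma T : R).
Variables (X : R -> R -> trunc_tensor R d (Num.truncn p)) (S : R -> R -> tensor_series R d).
Hypotheses (T_gt0 : 0 < T) (p_gt2 : 2 < p).
Hypothesis S_signature : is_signature gamma T X S.
Variables (W : R -> R) (kap : nat -> R).
Hypotheses (W_ucont : ucont 0 T W)
  (W_mono : forall s t, 0 <= s -> s <= t -> t <= T -> W s <= W t)
  (kap_ge0 : forall n, 0 <= kap n)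
  (kap_small : forall r : R, 0 <= r -> exists C : R, forall n, kap n * r ^+ n <= C)
  (S_le : forall s t w, 0 <= s -> s <= t -> t <= T ->
     `|S s t w| <= kap (size w) * pinc p W s t ^+ size w).

Local Notation N := (Num.truncn p).

Lemma truncn_bounds : (0 < N)%N /\ N%:R <= p < N.+1%:R.
Proof.
have p2 := p_gt2; have p0 : 0 <= p by lra.
split; last exact: truncn_itv.
by rewrite truncn_gt0; lra.
Qed.

Lemma path_control x : continuous_BV T x -> exists v : R -> R,
  [/\ ucont 0 T v, forall s t, 0 <= s -> s <= t -> t <= T -> v s <= v t &
      forall i : 'I_d, dominated 0 T v (fun t => x t ord0 i)].
Proof. by move=> /(continuous_BV_dominated T_gt0) [v vu [vm xd]]; exists v. Qed.

Definition approximates (x : nat -> R -> 'rV[R]_d) :=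
  (forall m, continuous_BV T (x m)) /\
  pvar_dist T (trunc_signature N (x m)) X @[m --> \oo] --> 0%E.

Lemma path_controls x : approximates x -> exists v : nat -> R -> R, forall m,
  [/\ ucont 0 T (v m), forall s t, 0 <= s -> s <= t -> t <= T -> v m s <= v m t &
     forall i, dominated 0 T (v m) (fun t => x m t ord0 i)].
Proof.
move=> [xb _].
have /choice [v vP] : forall m, exists v : R -> R,
    [/\ ucont 0 T v, forall s t, 0 <= s -> s <= t -> t <= T -> v s <= v t &
      forall i : 'I_d, dominated 0 T v (fun t => x m t ord0 i)].
  by move=> m; exact: path_control.
by exists v.
Qed.

Lemma approximates_lt x (e : R) : approximates x -> 0 < e ->
  exists M, forall m, (M <= m)%N -> (pvar_dist T (trunc_signature N (x m)) X < e%:E)%E.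
Proof.
move=> [_ cx] e0; have /cx [M _ HM] : nbhs (0%:E : \bar R) [set z | (z < e%:E)%E].
  exists e => //= r; rewrite /= sub0r normrN => re.
  by rewrite lte_fin (le_lt_trans (ler_norm r)).
by exists M => m Mm; exact: HM.
Qed.

Lemma geometric_approximates : is_geometric_rough_path gamma T X -> exists x, approximates x.
Proof.
move=> [_ HX].
have /choice [x Hx] : forall m : nat, exists x, continuous_BV T x /\
    (pvar_dist T (trunc_signature N x) X < (m.+1%:R^-1)%:E)%E.
  move=> m; have m0 : 0 < m.+1%:R^-1 :> R by rewrite invr_gt0 ltr0n.
  by have [x xb xd] := HX _ m0; exists x.
exists x; split=> [m|]; first exact: (Hx m).1.
apply: (@squeeze_cvge _ _ _ _ (cst 0%E) _ (fun m : nat => (m.+1%:R^-1)%:E)).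
- near=> m; rewrite poweR_ge0 /=; exact/ltW/(Hx m).2.
- exact: cvg_cst.
- apply: cvg_EFin; first by near=> m.
  exact: cvg_harmonic.
Unshelve. all: by end_near. Qed.

Section OneSystem.
Variables (I : finType) (A : 'I_d -> {linear {ffun I -> R} -> {ffun I -> R}}).

(** The limit is the same word series for every choice of approximating drivers; both uniqueness and
    existence rest on this. *)
Lemma linear_approx_cvg (z0 : {ffun I -> R}) x (v : nat -> R -> R) (y : nat -> R -> {ffun I -> R}) :
  approximates x ->
  (forall m, [/\ ucont 0 T (v m), forall s t, 0 <= s -> s <= t -> t <= T -> v m s <= v m t &
     forall i, dominated 0 T (v m) (fun t => x m t ord0 i)]) ->
  (forall m, linear_ode T (x m) (v m) A z0 (y m)) ->
  forall e, 0 < e -> exists M, forall m, (M <= m)%N -> forall t, 0 <= t <= T ->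
    nrm (y m t - sigop A (S 0 t) z0) < e.
Proof.
move=> ax vP yo e e0; have [N0 Np] := truncn_bounds.
have e20 : 0 < e / 2 by rewrite divr_gt0.
have [rho rho0 H] := rough_convergence T_gt0 p_gt2 N0 Np W_ucont W_mono kap_ge0 kap_small
  (signature_nil S_signature) (signature_chen S_signature) S_le A z0 e20.
have p0 : 0 < p := lt_trans (ltr0n R 2) p_gt2.
have q0 : 0 < rho / N.+1%:R by rewrite divr_gt0.
have eps0 : 0 < (rho / N.+1%:R) `^ p^-1 by exact: powR_gt0.
have [M HM] := approximates_lt ax eps0.
exists M => m Mm t tT; have [vu vm xd] := vP m.
have [D DN] := pvar_driver_near T_gt0 p_gt2 S_signature W_mono S_le eps0 (HM m Mm) vu vm xd.
have E : N.+1%:R * ((rho / N.+1%:R) `^ p^-1) `^ p = rho.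
  by rewrite -powRrM mulVf ?gt_eqF // powRr1 ?(ltW q0) // mulrC divfK // pnatr_eq0.
rewrite E in DN; apply: (le_lt_trans (H _ _ _ _ DN (yo m) t tT)).
by rewrite ltr_pdivrMr // ltr_pMr // ltr1n.
Qed.

Lemma hol_sigop z0 a : hol T p W (fun t => sigop A (S 0 t) z0 a).
Proof.
have [N0 Np] := truncn_bounds.
have [C C0 HC] := sigop_increment p_gt2 W_mono kap_ge0 kap_small
  (signature_nil S_signature) (signature_chen S_signature) S_le A.
exists (C * nrm z0); first by rewrite mulr_ge0 // nrm_ge0.
move=> s t s0 st tT; rewrite mulrAC.
apply: le_trans (HC s t z0 s0 st tT).
apply: le_trans (nrm_coord _ a).
by rewrite [X in _ <= `|X|](_ : _ = sigop A (S 0 t) z0 a - sigop A (S 0 s) z0 a) // !ffunE.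
Qed.

Variables (E : Type) (c : I -> E -> R) (V : E -> 'rV[R]_d -> E) (y0 : E).
Hypothesis V_linear : forall y j, cvec c (V y (delta_mx ord0 j)) = A j (cvec c y).

Lemma rde_linear_limit (Y : R -> E) : rde_solution c T X V y0 Y ->
  forall t, 0 <= t <= T -> cvec c (Y t) = sigop A (S 0 t) (cvec c y0).
Proof.
move=> [_ [x [Ym [xb xd sol cY]]]] t tT.
have ax : approximates x by split.
have [v vP] := path_controls ax.
have lo m : linear_ode T (x m) (v m) A (cvec c y0) (fun t => cvec c (Ym m t)).
  by have [vu vm xdm] := vP m; exact: (ode_solution_linear T_gt0 vu vm xdm V_linear (sol m)).
apply/ffunP => a; apply/eqP; rewrite -subr_eq0 -normr_le0.
apply/ler_addgt0Pr => e e0; rewrite add0r.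
have e20 : 0 < e / 2 by rewrite divr_gt0.
have [M1 H1] := linear_approx_cvg ax vP lo e20.
have [M2 H2] := (uniform_cvgP T _ _).1 (cY a) _ e20.
have h1 := H1 (maxn M1 M2) (leq_maxl _ _) t tT.
have h2 := H2 (maxn M1 M2) (leq_maxr _ _) t tT.
have h3 := le_lt_trans (nrm_coord _ a) h1; rewrite !ffunE in h3 *.
move: h2 h3; set u := c a (Ym _ t); set b := limn _ => h2 h3.
have := ler_normD (c a (Y t) - u) (u - b); rewrite addrA subrK; lra.
Qed.

Variable unc : {ffun I -> R} -> E.
Hypothesis cvecK : forall y, cvec c (unc y) = y.

Lemma rde_linear_exists : is_geometric_rough_path gamma T X ->
  rde_solution c T X V y0 (fun t => unc (sigop A (S 0 t) (cvec c y0))).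
Proof.
move=> /geometric_approximates [x ax].
have cE y a : c a (unc y) = y a by rewrite -[in RHS](cvecK y) ffunE.
split.
  apply: (finite_pvar_hol p_gt2 W_ucont W_mono) => a.
  by apply: eq_hol (hol_sigop (cvec c y0) a) => t _; rewrite cE.
have [v vP] := path_controls ax.
have /choice [y yo] : forall m, exists y, linear_ode T (x m) (v m) A (cvec c y0) y.
  by move=> m; have [vu vm xdm] := vP m; exact: linear_ode_exists (ltW T_gt0) vu vm xdm _ _.
exists x, (fun m t => unc (y m t)); split.
- exact: ax.1.
- exact: ax.2.
- move=> m; have [vu vm xdm] := vP m.
  apply: (linear_ode_solution T_gt0 vu vm xdm V_linear).
  have -> : (fun t => cvec c (unc (y m t))) = y m by apply/funext => t; rewrite cvecK.
  exact: yo.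
- move=> a; apply/(uniform_cvgP T) => e e0.
  have [M HM] := linear_approx_cvg ax vP yo e0.
  exists M => m Mm t tT; rewrite distrC !cE.
  apply: le_lt_trans (HM m Mm t tT); apply: le_trans (nrm_coord _ a).
  by rewrite [X in _ <= `|X|](_ : _ = y m t a - sigop A (S 0 t) (cvec c y0) a) // !ffunE.
Qed.

End OneSystem.

End LinearRDE.

(** * Entire power series *)

Section EntrywiseLimits.

Lemma mx_cvg (K : numFieldType) m n (U : Type) (F : set_system U) (f : U -> 'M[K]_(m, n))
    (A : 'M[K]_(m, n)) : Filter F ->
  (forall i j, (f u i j : K^o) @[u --> F] --> (A i j : K^o)) -> f u @[u --> F] --> A.
Proof.
move=> FF H; apply/cvg_ballP => e e0.
have : \forall u \near F, forall ij : 'I_m * 'I_n, ball (A ij.1 ij.2 : K^o) e (f u ij.1 ij.2 : K^o).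
  by apply: filter_forall => -[i j]; have /cvg_ballP/(_ e e0) := H i j.
by apply: filterS => u Hu; split=> // i j; exact: (Hu (i, j)).
Qed.

Lemma Re_Im_norm_le (R : realType) (z : R[i]) :
  `|z| <= real_complex R (`|complex.Re z| + `|complex.Im z|).
Proof.
rewrite normc_def lecR; set a := complex.Re z; set b := complex.Im z.
rewrite -[leRHS]ger0_norm ?addr_ge0 // -sqrtr_sqr; apply: ler_wsqrtr.
rewrite sqrrD !real_normK ?num_real // addrAC lerDl.
by rewrite mulrn_wge0 // mulr_ge0.
Qed.

Lemma Cplx_gt0 (R : realType) (e : R[i]) : 0 < e -> exists2 e1 : R, e = real_complex R e1 & 0 < e1.
Proof.
case: e => a b; rewrite ltcE /= => /andP[/eqP -> a0].
by exists a.
Qed.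

Lemma Cplx_cvg (R : realType) (u : nat -> R[i]) (l : R[i]) :
  complex.Re (u n) @[n --> \oo] --> complex.Re l ->
  complex.Im (u n) @[n --> \oo] --> complex.Im l ->
  (u n : (Cplx R)^o) @[n --> \oo] --> (l : (Cplx R)^o).
Proof.
move=> cR cI; apply/cvgrPdist_lt => /= e /Cplx_gt0 [e1 -> e10].
have e20 : 0 < e1 / 2 by rewrite divr_gt0.
have /cvgrPdist_lt/(_ _ e20) := cR; have /cvgrPdist_lt/(_ _ e20) := cI.
apply: filterS2 => n /= hI hR.
apply: (le_lt_trans (Re_Im_norm_le _)); rewrite ltcR !raddfB /=; lra.
Qed.

End EntrywiseLimits.

Section EntireSeries.
Variable K : numFieldType.
Implicit Types (b : nat -> K) (z h : K).

(** Infinite radius of convergence: as [r] is arbitrary, the factor [2^-1 ^+ n] costs nothing and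
    makes all tails geometric. *)
Definition entire b := forall r : K, 0 <= r -> exists2 C : K, 0 <= C &
  forall n, `|b n| * r ^+ n <= C * 2^-1 ^+ n.

Definition dseries b n : K := n.+1%:R * b n.+1.

Definition poly_sum b z n : K := \sum_(i < n) b i * z ^+ i.

Lemma natr_le_exp2 n : n%:R <= 2 ^+ n :> K.
Proof. by rewrite -natrX ler_nat ltnW // ltn_expl. Qed.

Lemma entire_dseries b : entire b -> entire (dseries b).
Proof.
move=> eb r r0; have r1 : 0 <= 2 * (r + 1) by rewrite mulr_ge0 // addr_ge0.
have [C C0 HC] := eb _ r1; exists C => // n; have h := HC n.+1.
have h2 : `|dseries b n| * r ^+ n <= `|b n.+1| * (2 * (r + 1)) ^+ n.+1.
  rewrite /dseries normrM normr_nat exprMn [_ * `|b _|]mulrC -mulrA; apply: ler_wpM2l => //.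
  apply: ler_pM; rewrite ?exprn_ge0 ?natr_le_exp2 //.
  rewrite exprSr; apply: (@le_trans _ _ ((r + 1) ^+ n)).
    by apply: lerXn2r; rewrite ?nnegrE ?addr_ge0 // lerDl.
  by apply: ler_peMr; rewrite ?exprn_ge0 ?addr_ge0 // lerDr.
apply: (le_trans h2); apply: (le_trans h); apply: ler_wpM2l => //.
by rewrite exprS ler_piMl ?exprn_ge0 ?invr_ge0 // invf_le1 // ler1n.
Qed.

(** Induction on [n], with one factor [z + h] split off. The crude [4 ^+ n] absorbs the factors [n]
    and is harmless against entire coefficients. *)
Lemma expr_taylor z h rho n : 1 <= rho -> `|z| <= rho -> `|z + h| <= rho ->
  `|(z + h) ^+ n - z ^+ n - n%:R * h * z ^+ n.-1| <= `|h| ^+ 2 * (4 * rho) ^+ n.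
Proof.
move=> r1 zr zhr; have r0 : 0 <= rho := le_trans ler01 r1.
elim: n => [|n IH].
  by rewrite !expr0 subrr mul0r mul0r subr0 normr0 mulr1 exprn_ge0.
have -> : (z + h) ^+ n.+1 - z ^+ n.+1 - n.+1%:R * h * z ^+ n.+1.-1 =
    (z + h) * ((z + h) ^+ n - z ^+ n - n%:R * h * z ^+ n.-1) + n%:R * h ^+ 2 * z ^+ n.-1.
  case: n {IH} => [|n]; first by rewrite /= !expr0 !expr1; ring.
  by rewrite /= -[n.+2%:R]natr1 !exprS; ring.
apply: (le_trans (ler_normD _ _)); rewrite (normrM (z + h)).
have h1 : `|z + h| * `|(z + h) ^+ n - z ^+ n - n%:R * h * z ^+ n.-1| <=
    rho * (`|h| ^+ 2 * (4 * rho) ^+ n) by apply: ler_pM.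
have h2 : `|n%:R * h ^+ 2 * z ^+ n.-1| <= `|h| ^+ 2 * (4 ^+ n * rho ^+ n).
  rewrite (normrM _ (z ^+ _)) (normrM n%:R) normr_nat !normrX -mulrA mulrCA; apply: ler_wpM2l; first by rewrite exprn_ge0.
  apply: ler_pM; rewrite ?exprn_ge0 //.
    apply: (le_trans (natr_le_exp2 n)); apply: lerXn2r; rewrite ?nnegrE // ler_nat //.
  apply: (@le_trans _ _ (rho ^+ n.-1)); first by apply: lerXn2r; rewrite ?nnegrE.
  by apply: ler_weXn2l => //; exact: leq_pred.
apply: (le_trans (lerD h1 h2)); rewrite -exprMn (exprS (4 * rho)).
set X := (4 * rho) ^+ n.
rewrite [leRHS](_ : _ = rho * (`|h| ^+ 2 * X) + 3 * rho * (`|h| ^+ 2 * X)); last by ring.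
rewrite lerD2l ler_peMl //; first by rewrite mulr_ge0 ?exprn_ge0 ?mulr_ge0.
by apply: (le_trans r1); rewrite ler_peMl // ler1n.
Qed.

Lemma cvg_norm_le (u : nat -> K) (l B : K) : (u n : K^o) @[n --> \oo] --> (l : K^o) ->
  0 <= B -> (forall n, `|u n| <= B) -> `|l| <= B.
Proof.
move=> /cvgrPdist_lt cu B0 uB.
have lr : `|l| \is Num.real by exact: normr_real.
rewrite real_leNgt ?ger0_real //; apply/negP => Bl.
have e0 : 0 < `|l| - B by rewrite subr_gt0.
have [n _ /(_ n (leqnn n)) /= h] := cu _ e0.
have := ler_normD (l - u n) (u n); rewrite subrK.
move=> /le_lt_trans/(_ (ltr_leD h (uB n))); rewrite subrK ltxx //.
Qed.

(** The quadratic estimate holds for partial sums with a constant independent of their length, hence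
    for the limit. Over a general [K] it serves real and complex derivatives alike. *)
Lemma entire_taylor b (f : K -> K) (g z : K) : entire b ->
  (forall w, (poly_sum b w n : K^o) @[n --> \oo] --> (f w : K^o)) ->
  (poly_sum (dseries b) z n : K^o) @[n --> \oo] --> (g : K^o) ->
  exists2 C : K, 0 <= C & forall h, `|h| <= 1 -> `|f (z + h) - f z - h * g| <= C * `|h| ^+ 2.
Proof.
move=> eb cf cg; pose rho := 1 + `|z|.
have rho1 : 1 <= rho by rewrite lerDl.
have r40 : 0 <= 4 * rho by rewrite mulr_ge0 // (le_trans ler01).
have [C C0 HC] := eb _ r40.
exists (C * 2) => [|h h1]; first by rewrite mulr_ge0.
have key n : `|poly_sum b (z + h) n.+1 - poly_sum b z n.+1 - h * poly_sum (dseries b) z n| <=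
    C * 2 * `|h| ^+ 2.
  have -> : poly_sum b (z + h) n.+1 - poly_sum b z n.+1 - h * poly_sum (dseries b) z n =
      \sum_(i < n.+1) b i * ((z + h) ^+ i - z ^+ i - i%:R * h * z ^+ i.-1).
    have -> : h * poly_sum (dseries b) z n = \sum_(i < n.+1) b i * (i%:R * h * z ^+ i.-1).
      rewrite big_ord_recl /= mul0r mul0r mulr0 add0r mulr_sumr; apply: eq_bigr => i _ /=.
      by rewrite /dseries /bump /= add1n; ring.
    by rewrite -!sumrB; apply: eq_bigr => i _; ring.
  apply: (le_trans (ler_norm_sum _ _ _)).
  apply: (@le_trans _ _ (\sum_(i < n.+1) C * 2^-1 ^+ i * `|h| ^+ 2)).
    apply: ler_sum => i _; rewrite normrM.
    apply: (@le_trans _ _ (`|b i| * (`|h| ^+ 2 * (4 * rho) ^+ i))).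
      apply: ler_wpM2l => //; apply: expr_taylor => //; first by rewrite lerDr.
      by apply: (le_trans (ler_normD _ _)); rewrite addrC lerD2r.
    rewrite mulrCA mulrC; apply: ler_wpM2r; first by rewrite exprn_ge0.
    exact: HC.
  rewrite -mulr_suml; apply: ler_wpM2r; first by rewrite exprn_ge0.
  rewrite -mulr_sumr; apply: ler_wpM2l => //.
  have geo m : \sum_(i < m) (2^-1 : K) ^+ i = 2 - 2 * 2^-1 ^+ m.
    elim: m => [|m IH]; first by rewrite big_ord0 expr0 mulr1 subrr.
    by rewrite big_ord_recr /= IH exprS mulrA mulfV ?pnatr_eq0 // mul1r; ring.
  by rewrite geo gerBl mulr_ge0 // exprn_ge0 // invr_ge0.
apply: (cvg_norm_le (u := fun n => poly_sum b (z + h) n.+1 - poly_sum b z n.+1 - h * poly_sum (dseries b) z n)) => //.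
- apply: cvgB; last by apply: cvgMl_tmp.
  by apply: cvgB; [have := cf (z + h)|have := cf z]; rewrite -(cvg_shiftS (poly_sum b _)).
- by rewrite !mulr_ge0 // exprn_ge0.
Qed.

Lemma entire_derivative b (f : K -> K) (g z : K) : entire b ->
  (forall w, (poly_sum b w n : K^o) @[n --> \oo] --> (f w : K^o)) ->
  (poly_sum (dseries b) z n : K^o) @[n --> \oo] --> (g : K^o) ->
  (h^-1 * (f (h + z) - f z) : K^o) @[h --> (0 : K^o)^'] --> (g : K^o).
Proof.
move=> eb cf cg; have [C C0 HC] := entire_taylor eb cf cg.
apply/cvgrPdist_lt => e e0.
have C10 : 0 < C + 1 by rewrite ltr_wpDl.
near=> h.
have hn0 : h != 0 by near: h; exact: nbhs_dnbhs_neq.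
have h1 : `|h| <= 1.
  by near: h; apply: dnbhs0_le.
have h2 : `|h| < e / (C + 1).
  by near: h; apply: dnbhs0_lt; rewrite divr_gt0.
have -> : g - h^-1 * (f (h + z) - f z) = - h^-1 * (f (z + h) - f z - h * g).
  by rewrite (addrC h z); field.
rewrite normrM normrN normfV ltr_pdivrMl ?normr_gt0 //.
apply: (le_lt_trans (HC h h1)); rewrite expr2 mulrA mulrC ltr_pM2l ?normr_gt0 //.
rewrite ltr_pdivlMr // in h2; apply: le_lt_trans h2.
by rewrite mulrC; apply: ler_wpM2l => //; rewrite lerDl.
Unshelve. all: by end_near. Qed.

End EntireSeries.

Section RealEntireSeries.
Variable R : realType.
Implicit Types b : nat -> R.

Lemma seriesE (V : zmodType) (u : nat -> V) n : series u n = \sum_(i < n) u i.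
Proof. by rewrite /series /= big_mkord. Qed.

Lemma entire_cvg b (z : R) : entire b ->
  exists l : R, (poly_sum b z n : R^o) @[n --> \oo] --> (l : R^o).
Proof.
move=> eb; have [C C0 HC] := eb _ (normr_ge0 z).
have [|l cl _] := @geometric_cvg R (poly_sum b z) C; last by exists l.
move=> n; rewrite /poly_sum big_ord_recr /= addrAC subrr add0r normrM normrX.
exact: HC.
Qed.

Lemma iter_dseries b m n : iter m (@dseries R) b n = ((n + m) ^_ m)%:R * b (n + m)%N.
Proof.
elim: m n => [|m IH] n /=; first by rewrite addn0 ffactn0 mul1r.
by rewrite /dseries IH mulrA -natrM -addSnnS ffactnSr addnK mulnC.
Qed.

Lemma entire_iter_dseries b m : entire b -> entire (iter m (@dseries R) b).
Proof. by move=> eb; elim: m => //= m IH; exact: entire_dseries. Qed.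

(** Recentring at [x0]: [a n] is the sum over [m] of ['C(m, n) * b m * x0 ^+ (m - n)]. Its
    truncations [aL n L] converge at a rate independent of [n], so the finite rearrangement [expand]
    and [|h| < 1/2] suffice. *)
Lemma entire_real_analytic b (f : R -> R) : entire b ->
  (forall w, (poly_sum b w n : R^o) @[n --> \oo] --> (f w : R^o)) -> real_analytic f.
Proof.
move=> eb cf x0; pose rho := 1 + `|x0|.
have rho1 : 1 <= rho by rewrite lerDl.
have r20 : 0 <= 2 * rho by rewrite mulr_ge0 // (le_trans ler01).
have [C C0 HC] := eb _ r20.
pose aL n L := \sum_(m < L) 'C(m, n)%:R * b m * x0 ^+ (m - n).
have /choice [a aP] : forall n, exists l : R, forall L, `|l - aL n L| <= C * 2 * 2^-1 ^+ L.
  move=> n; have [|l _ H] := @geometric_cvg R (aL n) C; last by exists l.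
  move=> L; rewrite /aL big_ord_recr /= addrAC subrr add0r !normrM normr_nat normrX.
  apply: le_trans (HC L); rewrite [_ * `|b L|]mulrC -mulrA; apply: ler_wpM2l => //.
  rewrite exprMn; apply: ler_pM; [by []|by rewrite exprn_ge0| |].
    rewrite -natrX ler_nat; have [nL|Ln] := leqP n L; last by rewrite bin_small.
    have -> : (2 ^ L = \sum_(i < L.+1) 'C(L, i))%N.
      by rewrite -[2%N]/(1 + 1)%N expnDn; apply: eq_bigr => i _; rewrite !exp1n !muln1.
    by rewrite (bigD1 (Ordinal (n:=L.+1) (m:=n) nL)) //= leq_addr.
  apply: (@le_trans _ _ (rho ^+ (L - n))).
    by apply: lerXn2r; rewrite ?nnegrE // /rho ?addr_ge0 // lerDr.
  by apply: ler_weXn2l => //; exact: leq_subr.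
exists a, (2^-1) => // x; set h := x - x0 => hx.
have xE : x = x0 + h by rewrite /h addrC subrK.
have expand q : \sum_(n < q) aL n q * h ^+ n = poly_sum b x q.
  rewrite /poly_sum /aL; under eq_bigr do rewrite mulr_suml.
  rewrite exchange_big /=; apply: eq_bigr => m _.
  rewrite xE exprDn mulr_sumr.
  rewrite [RHS](big_ord_widen q (fun i : nat => b m * ((x0 ^+ (m - i) * h ^+ i) *+ 'C(m, i)))) ?ltn_ord //.
  rewrite [RHS]big_mkcond; apply: eq_bigr => i _ /=.
  case: ltnP => [im|mi]; first by rewrite -[_ *+ 'C(_, _)]mulr_natl; ring.
  by rewrite bin_small // !mul0r.
have dist q : `|series (fun n => a n * h ^+ n) q - poly_sum b x q| <= C * 4 * 2^-1 ^+ q.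
  rewrite seriesE -expand -sumrB.
  apply: (le_trans (ler_norm_sum _ _ _)).
  apply: (@le_trans _ _ (\sum_(n < q) C * 2 * 2^-1 ^+ q * 2^-1 ^+ n)).
    apply: ler_sum => n _; rewrite -mulrBl normrM normrX; apply: ler_pM => //.
    by apply: lerXn2r; rewrite ?nnegrE // ltW.
  rewrite -mulr_sumr.
  have geo : \sum_(n < q) (2^-1 : R) ^+ n <= 2.
    have -> : \sum_(n < q) (2^-1 : R) ^+ n = 2 - 2 * 2^-1 ^+ q.
      elim: (q) => [|m IH]; first by rewrite big_ord0 expr0 mulr1 subrr.
      by rewrite big_ord_recr /= IH exprS; field.
    by rewrite gerBl mulr_ge0 // exprn_ge0.
  rewrite [leRHS](_ : _ = C * 2 * 2^-1 ^+ q * 2); last by ring.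
  by apply: ler_wpM2l => //; rewrite !mulr_ge0 // exprn_ge0.
have c0 : (fun n => series (fun n => a n * h ^+ n) n - poly_sum b x n) @ \oo --> (0 : R).
  apply/cvgrPdist_le => e e0; have [q Hq] := geometric_small (C * 4) e0.
  exists q => // n /= /Hq h1; apply: (le_trans _ h1); rewrite sub0r normrN; exact: dist.
have := cvgD c0 (cf x); rewrite add0r => cs.
rewrite (_ : series (fun n => a n * h ^+ n) = (fun n => series (fun n => a n * h ^+ n) n -
  poly_sum b x n + poly_sum b x n)); last by apply/funext => n; rewrite subrK.
exact: cs.
Qed.

(** Induction on [m]: the series of each derivative is entire again, so [entire_derivative] gives
    the limit of its difference quotients entry by entry. *)
Lemma derive1n_entire k (A : nat -> 'M[R]_k) (Y : R -> 'M[R]_k) :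
  (forall i j, entire (fun n => A n i j)) ->
  (forall z i j, (poly_sum (fun n => A n i j) z n : R^o) @[n --> \oo] --> (Y z i j : R^o)) ->
  forall m z i j, (poly_sum (iter m (@dseries R) (fun n => A n i j)) z n : R^o) @[n --> \oo] -->
    (derive1n m Y z i j : R^o).
Proof.
move=> eA cY; elim=> [|m IH] z i j; first exact: cY.
have /choice [G GP] : forall ij : 'I_k * 'I_k, exists l : R,
    (poly_sum (iter m.+1 (@dseries R) (fun n => A n ij.1 ij.2)) z n : R^o) @[n --> \oo] --> (l : R^o).
  by move=> ij; apply: entire_cvg; exact: entire_iter_dseries (eA _ _).
suff -> : derive1n m.+1 Y z = \matrix_(i, j) G (i, j) by rewrite mxE; exact: (GP (i, j)).
rewrite derive1nS /derive1; apply: (cvg_lim (@norm_hausdorff _ _)).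
apply: mx_cvg => i' j'; rewrite mxE.
have c := entire_derivative (entire_iter_dseries m (eA i' j')) (fun w => IH w i' j') (GP (i', j')).
rewrite (_ : (fun h : R => _) = (fun h => h^-1 * (derive1n m Y (h + z) i' j' - derive1n m Y z i' j'))).
  exact: c.
by apply/funext => h; rewrite !mxE.
Qed.

End RealEntireSeries.

Section ComplexEntireSeries.
Variable R : realType.
Local Notation C := (Cplx R).
Implicit Types (b : nat -> R) (z : Cplx R).

Lemma entire_Cplx b : entire b -> entire (fun n => to_Cplx R (b n)).
Proof.
move=> eb r r0; have [r1 rE r10] : exists2 r1 : R, r = to_Cplx R r1 & 0 <= r1.
  move: r0; rewrite le_eqVlt => /orP[/eqP <-|/Cplx_gt0 [r1 -> r10]].
    by exists 0; rewrite ?rmorph0.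
  by exists r1 => //; exact: ltW.
have [B B0 HB] := eb r1 r10.
exists (to_Cplx R B) => [|n]; first by rewrite -(rmorph0 (to_Cplx R)) lecR.
have -> : `|to_Cplx R (b n)| = to_Cplx R `|b n|.
  by rewrite normc_def /= expr0n addr0 sqrtr_sqr.
have -> : 2^-1 = to_Cplx R 2^-1 by rewrite fmorphV rmorph_nat.
by rewrite rE -!rmorphXn -!rmorphM lecR.
Qed.

Lemma Cplx_entire_cvg b z : entire b ->
  exists l : C, (poly_sum (fun n => to_Cplx R (b n)) z n : C^o) @[n --> \oo] --> (l : C^o).
Proof.
move=> eb; set r := ComplexField.Normc.normc z.
have r0 : 0 <= r by rewrite /r; case: (z) => x y; exact: sqrtr_ge0.
have [B B0 HB] := eb r r0.
have zn n : `|complex.Re (z ^+ n)| <= r ^+ n /\ `|complex.Im (z ^+ n)| <= r ^+ n.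
  have E : ComplexField.Normc.normc (z ^+ n) = r ^+ n.
    by elim: n => [|n IH]; [rewrite !expr0 ComplexField.Normc.normc1|rewrite !exprS ComplexField.Normc.normcM IH].
  rewrite -E; case: (z ^+ n) => x y /=.
  by split; rewrite -sqrtr_sqr; apply: ler_wsqrtr; rewrite ?lerDl ?lerDr sqr_ge0.
have mulE (x : R) (w : R[i]) : complex.Re (to_Cplx R x * w) = x * complex.Re w /\
    complex.Im (to_Cplx R x * w) = x * complex.Im w.
  by case: w => u v /=; rewrite !mul0r subr0 addr0.
have [|lr lrP _] := @geometric_cvg R (fun n => complex.Re (poly_sum (fun n => to_Cplx R (b n)) z n : R[i])) B.
  move=> n; rewrite /poly_sum big_ord_recr /= raddfD /= addrAC subrr add0r.
  rewrite (mulE _ _).1 normrM; apply: le_trans (HB n); apply: ler_wpM2l => //; exact: (zn n).1.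
have [|li liP _] := @geometric_cvg R (fun n => complex.Im (poly_sum (fun n => to_Cplx R (b n)) z n : R[i])) B.
  move=> n; rewrite /poly_sum big_ord_recr /= raddfD /= addrAC subrr add0r.
  rewrite (mulE _ _).2 normrM; apply: le_trans (HB n); apply: ler_wpM2l => //; exact: (zn n).2.
by exists (Complex lr li); apply: Cplx_cvg.
Qed.

Lemma entire_holomorphic b (f : C -> C) : entire b ->
  (forall w, (poly_sum (fun n => to_Cplx R (b n)) w n : C^o) @[n --> \oo] --> (f w : C^o)) ->
  holomorphic f.
Proof.
move=> eb cf z; have [g cg] := Cplx_entire_cvg z (entire_dseries eb).
have cg' : (poly_sum (dseries (fun n => to_Cplx R (b n))) z n : C^o) @[n --> \oo] --> (g : C^o).
  have -> : poly_sum (dseries (fun n => to_Cplx R (b n))) z =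
    poly_sum (fun n => to_Cplx R (dseries b n)) z.
    by apply/funext => n; apply: eq_bigr => i _; rewrite /dseries rmorphM rmorph_nat.
  exact: cg.
have c := entire_derivative (entire_Cplx eb) cf cg'.
apply/cvg_ex; exists g.
rewrite (_ : (fun h => _) = (fun h => h^-1 * (f (h + z) - f z))); first exact: c.
by apply/funext => h; rewrite /GRing.scale /= mulr1.
Qed.

End ComplexEntireSeries.

(** * Matrix equations *)

Section WordFormulas.
Variables (R : realType) (d : nat) (E : Type) (I : finType) (c : I -> E -> R).
Variables (unc : {ffun I -> R} -> E) (V : E -> 'rV[R]_d -> E).

Lemma linear_of_field :
  (forall y, unc (cvec c y) = y) ->
  (forall j, linear (fun z => cvec c (V (unc z) (delta_mx ord0 j)))) ->
  exists A : 'I_d -> {linear {ffun I -> R} -> {ffun I -> R}},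
    forall y j, cvec c (V y (delta_mx ord0 j)) = A j (cvec c y).
Proof.
move=> uK Vl; have /choice [A HA] : forall j, exists A : {linear {ffun I -> R} -> {ffun I -> R}},
    forall z, A z = cvec c (V (unc z) (delta_mx ord0 j)).
  move=> j; pose F z := cvec c (V (unc z) (delta_mx ord0 j)).
  pose A : {linear {ffun I -> R} -> {ffun I -> R}} :=
    HB.pack F (GRing.isLinear.Build R {ffun I -> R} {ffun I -> R} _ F (Vl j)).
  by exists A.
by exists A => y j; rewrite HA uK.
Qed.

Variable A : 'I_d -> {linear {ffun I -> R} -> {ffun I -> R}}.
Hypothesis V_linear : forall y j, cvec c (V y (delta_mx ord0 j)) = A j (cvec c y).

Lemma act_cvec w y :
  act A w (cvec c y) = cvec c (foldl (fun y j => V y (delta_mx ord0 j)) y w).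
Proof. by elim: w y => [|j w IH] y //=; rewrite -V_linear IH. Qed.

Lemma sigact_coord Z n y a : sigact A Z n (cvec c y) a =
  \sum_(w : n.-tuple 'I_d) Z w * c a (foldl (fun y j => V y (delta_mx ord0 j)) y w).
Proof.
rewrite /sigact wsum_tuple sum_ffunE; apply: eq_bigr => w _.
by rewrite ffunE act_cvec ffunE.
Qed.

End WordFormulas.

Section MatrixWords.
Variables (R : realType) (d k : nat) (K : numFieldType) (iota : {rmorphism R -> K}).
Variable M : 'rV[R]_d -> 'M[K]_k.

Definition word_prod (w : seq 'I_d) : 'M[K]_k :=
  \big[mulmx/1%:M]_(j <- w) M (delta_mx ord0 j).

Lemma foldl_linear_field (y : 'M[K]_k) w :
  foldl (fun y j => linear_field M y (delta_mx ord0 j)) y w = y *m word_prod w.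
Proof.
rewrite /word_prod; elim: w y => [|j w IH] y /=; first by rewrite big_nil mulmx1.
by rewrite IH big_cons /linear_field mulmxA.
Qed.

Lemma mx_tensor_level n (Z : tensor_series R d) :
  mx_tensor iota M (level n Z) = \sum_(w : n.-tuple 'I_d) iota (Z w) *: word_prod w.
Proof. by apply: eq_bigr => w _; rewrite ffunE /word_prod big_tuple. Qed.

End MatrixWords.

Lemma word_prod_scale (R : realType) (d k : nat) (K : numFieldType) (M : 'rV[R]_d -> 'M[K]_k)
    (z : K) w :
  word_prod (fun x => z *: M x) w = z ^+ size w *: word_prod M w.
Proof.
rewrite /word_prod; elim: w => [|j w IH] /=; first by rewrite !big_nil expr0 scale1r.
by rewrite !big_cons IH -scalemxAl -scalemxAr scalerA exprS.
Qed.

Lemma word_prod_map (R : realType) (d k : nat) (K L : numFieldType) (f : {rmorphism K -> L})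
    (M : 'rV[R]_d -> 'M[K]_k) w :
  word_prod (fun x => map_mx f (M x)) w = map_mx f (word_prod M w).
Proof.
rewrite /word_prod; elim: w => [|j w IH] /=; first by rewrite !big_nil map_mx1.
by rewrite !big_cons IH map_mxM.
Qed.

Lemma mx_tensor_scale (R : realType) (d k : nat) (K : numFieldType) (iota : {rmorphism R -> K})
    (M : 'rV[R]_d -> 'M[K]_k) (z : K) n (Z : tensor_series R d) :
  mx_tensor iota (fun x => z *: M x) (level n Z) = z ^+ n *: mx_tensor iota M (level n Z).
Proof.
rewrite !mx_tensor_level scaler_sumr; apply: eq_bigr => w _.
by rewrite word_prod_scale size_tuple !scalerA mulrC.
Qed.

Lemma mx_tensor_map (R : realType) (d k : nat) (K : numFieldType) (iota : {rmorphism R -> K})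
    (M : 'rV[R]_d -> 'M[R]_k) n (Z : tensor_series R d) :
  mx_tensor iota (fun x => map_mx iota (M x)) (level n Z) =
  map_mx iota (mx_tensor idfun M (level n Z)).
Proof.
rewrite !mx_tensor_level.
apply/matrixP => i l; rewrite mxE !summxE rmorph_sum; apply: eq_bigr => w _.
by rewrite word_prod_map !mxE rmorphM.
Qed.

Section RealMatrixSystem.
Variables (R : realType) (d k : nat) (M : {linear 'rV[R]_d -> 'M[R]_k}).

Definition mx_unc (y : {ffun 'I_k * 'I_k -> R}) : 'M[R]_k := \matrix_(i, l) y (i, l).

Lemma mx_uncK y : mx_unc (cvec (@mx_coord R k) y) = y.
Proof. by apply/matrixP => i l; rewrite mxE ffunE. Qed.

Lemma linear_field_system (lambda : R) :
  exists A : 'I_d -> {linear {ffun 'I_k * 'I_k -> R} -> {ffun 'I_k * 'I_k -> R}},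
    forall y j, cvec (@mx_coord R k) (linear_field (fun x => lambda *: M x) y (delta_mx ord0 j)) =
      A j (cvec (@mx_coord R k) y).
Proof.
apply: (linear_of_field mx_uncK) => j a y z; apply/ffunP => -[i l].
rewrite !ffunE /mx_coord /linear_field /= (_ : mx_unc (a *: y + z) = a *: mx_unc y + mx_unc z).
  by rewrite mulmxDl -scalemxAl !mxE.
by apply/matrixP => p q; rewrite !mxE !ffunE.
Qed.

Lemma sigact_linear_field lambda
    (A : 'I_d -> {linear {ffun 'I_k * 'I_k -> R} -> {ffun 'I_k * 'I_k -> R}})
    (Z : tensor_series R d) n i l :
  (forall y j, cvec (@mx_coord R k) (linear_field (fun x => lambda *: M x) y (delta_mx ord0 j)) =
      A j (cvec (@mx_coord R k) y)) ->
  sigact A Z n (cvec (@mx_coord R k) 1%:M) (i, l) =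
  lambda ^+ n * mx_tensor idfun M (level n Z) i l.
Proof.
move=> HA; rewrite (sigact_coord HA).
have -> : lambda ^+ n * mx_tensor idfun M (level n Z) i l =
    mx_tensor idfun (fun x => lambda *: M x) (level n Z) i l.
  by rewrite mx_tensor_scale mxE.
rewrite mx_tensor_level summxE; apply: eq_bigr => w _.
by rewrite foldl_linear_field mul1mx mxE.
Qed.

(** Applied to the field [r M], the estimate [sigact_decay] already contains the power [r ^+ n]. *)
Lemma entire_signature (kap : nat -> R) Om (Z : tensor_series R d) om i l :
  (forall n, 0 <= kap n) -> 0 <= Om ->
  (forall r : R, 0 <= r -> exists C : R, forall n, kap n * r ^+ n <= C) ->
  sig_bounded kap Om Z om ->
  entire (fun n => mx_tensor idfun M (level n Z) i l).
Proof.
move=> kap0 Om0 kaps bZ r r0.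
have [A HA] := linear_field_system r; have [L L0 HL] := linear_bounded_all A.
have [C C0 HC] := sigact_decay L0 HL kap0 Om0 kaps.
set y1 := cvec (@mx_coord R k) 1%:M.
exists (C * nrm y1) => [|n]; first by rewrite mulr_ge0 // nrm_ge0.
have := HC Z om 0%N n y1 bZ (leq0n _); rewrite expr0 mulr1 => h.
have := le_trans (nrm_coord _ (i, l)) h; rewrite (sigact_linear_field _ _ _ _ HA) normrM mulrC normrX (ger0_norm r0).
move=> /le_trans; apply; rewrite [leRHS]mulrAC; apply: ler_wpM2r; first exact: nrm_ge0.
apply: ler_wpM2l => //; rewrite expr4 ler_piMr ?exprn_ge0 //.
by apply: exprn_ile1; lra.
Qed.

Lemma psum_linear_field lambda
    (A : 'I_d -> {linear {ffun 'I_k * 'I_k -> R} -> {ffun 'I_k * 'I_k -> R}})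
    (Z : tensor_series R d) n i l :
  (forall y j, cvec (@mx_coord R k) (linear_field (fun x => lambda *: M x) y (delta_mx ord0 j)) =
      A j (cvec (@mx_coord R k) y)) ->
  psum A Z n (cvec (@mx_coord R k) 1%:M) (i, l) =
  poly_sum (fun n => mx_tensor idfun M (level n Z) i l) lambda n.
Proof.
move=> HA; rewrite /psum sum_ffunE; apply: eq_bigr => m _.
by rewrite (sigact_linear_field _ _ _ _ HA) mulrC.
Qed.

End RealMatrixSystem.

(** * The coupled system *)

Section DrivenCalculus.
Variables (R : realType) (d : nat) (T : R) (x : R -> 'rV[R]_d) (v : R -> R).
Hypotheses (T_ge0 : 0 <= T) (v_ucont : ucont 0 T v)
  (v_mono : forall s t, 0 <= s -> s <= t -> t <= T -> v s <= v t)
  (x_dom : forall i, dominated 0 T v (fun t => x t ord0 i)).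
Implicit Types (f g : R -> R) (F G : 'I_d -> R -> R).

(* df = sum_j F_j dx^j, in the sense of the tangent germs. *)
Definition differential f F :=
  [/\ ucont 0 T f, forall j, ucont 0 T (F j) &
      tangent 0 T v f (fun s t => \sum_j F j s * (x t ord0 j - x s ord0 j))].

Lemma ucont_normr a b f : ucont a b f -> ucont a b (fun t => `|f t|).
Proof.
move=> uf e /uf [dl dl0 H]; exists dl => // s t sab tab st.
exact: le_lt_trans (ler_dist_dist _ _) (H s t sab tab st).
Qed.

Lemma differential_bound F : (forall j, ucont 0 T (F j)) -> exists2 C : R, 0 <= C &
  forall s t, 0 <= s -> s <= t -> t <= T ->
    `|\sum_j F j s * (x t ord0 j - x s ord0 j)| <= C * (v t - v s).
Proof.
move=> uF; have [C C0 HC] : exists2 C : R, 0 <= C &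
    forall t, 0 <= t <= T -> `|\sum_j `|F j t| | <= C.
  by apply: ucont_bounded; apply: ucont_sum => j; exact: ucont_normr.
exists (d%:R * C) => [|s t s0 st tT]; first by rewrite mulr_ge0.
apply: (increment_sum_le x_dom) => // j; apply: (le_trans _ (HC s _)).
  rewrite [leRHS]ger0_norm ?sumr_ge0 // (bigD1 j) //= lerDl; exact: sumr_ge0.
by rewrite s0 (le_trans st).
Qed.

Lemma differentialM f g F G : differential f F -> differential g G ->
  differential (fun t => f t * g t) (fun j t => F j t * g t + f t * G j t).
Proof.
move=> [uf uF tf] [ug uG tg]; split; first exact: ucontM.
  by move=> j; apply: ucontD; exact: ucontM.
have [C C0 HC] := differential_bound uF; have [D D0 HD] := differential_bound uG.
apply: eq_tangent (tangentM T_ge0 C0 D0 v_mono v_ucont HC HD tf tg) => s t s0 st tT.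
by rewrite mulr_suml mulr_sumr -big_split /=; apply: eq_bigr => j _; ring.
Qed.

Lemma differential_sum (J : Type) (r : seq J) (f : J -> R -> R) (F : J -> 'I_d -> R -> R) :
  (forall a, differential (f a) (F a)) ->
  differential (fun t => \sum_(a <- r) f a t) (fun j t => \sum_(a <- r) F a j t).
Proof.
move=> H; split.
- by apply: ucont_sum => a; have [] := H a.
- by move=> j; apply: ucont_sum => a; have [_ uF _] := H a; exact: uF.
- have tf a : tangent 0 T v (f a) (fun s t => \sum_j F a j s * (x t ord0 j - x s ord0 j)).
    by have [] := H a.
  apply: eq_tangent (tangent_sum r v_mono tf) => s t s0 st tT.
  by rewrite exchange_big; apply: eq_bigr => j _; rewrite mulr_suml.
Qed.

Lemma differential_cst (c : R) : differential (cst c) (fun j => cst 0).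
Proof.
split; [exact: ucont_cst|by move=> j; exact: ucont_cst|].
apply: eq_tangent (tangent_cst c v_mono) => s t s0 st tT.
by rewrite big1 // => j _; rewrite mul0r.
Qed.

Lemma eq_differential f g F G : (forall t, 0 <= t <= T -> f t = g t) ->
  (forall j t, 0 <= t <= T -> F j t = G j t) -> differential f F -> differential g G.
Proof.
move=> fg FG [uf uF tf]; split; first exact: eq_ucont uf.
  by move=> j; apply: eq_ucont (uF j); exact: FG.
apply: eq_tangent_fun fg _; apply: eq_tangent tf => s t s0 st tT.
by apply: eq_bigr => j _; rewrite FG // s0 (le_trans st).
Qed.

Lemma differential_inj f g F : differential f F -> differential g F -> f 0 = g 0 ->
  forall t, 0 <= t <= T -> f t = g t.
Proof. by move=> [_ _ tf] [_ _ tg] E; exact: (tangent_eq T_ge0 v_mono tf tg E). Qed.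

Section MatrixDifferential.
Implicit Types (k l m : nat).

Definition mx_differential k l (P : R -> 'M[R]_(k, l)) (F : 'I_d -> R -> 'M[R]_(k, l)) :=
  forall a b, differential (fun t => P t a b) (fun j t => F j t a b).

Lemma mx_differentialM k l m (P : R -> 'M[R]_(k, l)) (Q : R -> 'M[R]_(l, m))
    (F : 'I_d -> R -> 'M[R]_(k, l)) (G : 'I_d -> R -> 'M[R]_(l, m)) :
  mx_differential P F -> mx_differential Q G ->
  mx_differential (fun t => P t *m Q t) (fun j t => F j t *m Q t + P t *m G j t).
Proof.
move=> dP dQ a b.
have := differential_sum (index_enum _) (fun e => differentialM (dP a e) (dQ e b)).
apply: eq_differential => [t _|j t _]; rewrite !mxE //.
by rewrite -big_split; apply: eq_bigr => e _.
Qed.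

Lemma mx_differential_tr k l (P : R -> 'M[R]_(k, l)) (F : 'I_d -> R -> 'M[R]_(k, l)) : mx_differential P F ->
  mx_differential (fun t => (P t)^T) (fun j t => (F j t)^T).
Proof. by move=> dP a b; apply: eq_differential (dP b a) => *; rewrite mxE. Qed.

Lemma mx_differential_cst k l (C : 'M[R]_(k, l)) : mx_differential (cst C) (fun j => cst 0).
Proof. by move=> a b; apply: eq_differential (differential_cst (C a b)) => *; rewrite ?mxE. Qed.

Lemma eq_mx_differential k l (P Q : R -> 'M[R]_(k, l)) (F G : 'I_d -> R -> 'M[R]_(k, l)) :
  (forall t, 0 <= t <= T -> P t = Q t) -> (forall j t, 0 <= t <= T -> F j t = G j t) ->
  mx_differential P F -> mx_differential Q G.
Proof. by move=> PQ FG dP a b; apply: eq_differential (dP a b) => *; rewrite ?PQ ?FG. Qed.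

Lemma mx_differential_inj k l (P Q : R -> 'M[R]_(k, l)) (F : 'I_d -> R -> 'M[R]_(k, l)) :
  mx_differential P F -> mx_differential Q F -> P 0 = Q 0 ->
  forall t, 0 <= t <= T -> P t = Q t.
Proof.
move=> dP dQ E t tT; apply/matrixP => a b.
by apply: (differential_inj (dP a b) (dQ a b)) => //; rewrite E.
Qed.

(** By the product rule [P P^T] has the differential [P (N + N^T) P^T dx], which is 0, so it keeps
    its initial value. *)
Lemma orthogonal_flow k (P : R -> 'M[R]_k) (N : 'I_d -> 'M[R]_k) :
  mx_differential P (fun j t => P t *m N j) -> P 0 = 1%:M -> (forall j, (N j)^T = - N j) ->
  forall t, 0 <= t <= T -> P t *m (P t)^T = 1%:M.
Proof.
move=> dP P0 Na; apply: (mx_differential_inj (mx_differentialM dP (mx_differential_tr dP))).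
  apply: eq_mx_differential (mx_differential_cst 1%:M) => // j t _ /=.
  by rewrite trmx_mul Na mulNmx mulmxN mulmxA subrr.
by rewrite P0 trmx1 mulmx1.
Qed.

End MatrixDifferential.

End DrivenCalculus.

(** * The coupled system and its linear form *)

Section CoupledSystem.
Variables (R : realType) (d k n : nat) (lambda : R) (M : {linear 'rV[R]_d -> 'M[R]_k}).
Local Notation fam := ('I_n.+1 -> 'M[R]_k).
Local Notation ix := ('I_n.+1 * ('I_k * 'I_k))%type.
Local Notation c := (@mxfam_coord R n.+1 k).
Local Notation e_ i := (delta_mx ord0 i).
Implicit Types (Z U : fam) (j : 'I_n.+1).

Definition mxfam_unc (y : {ffun ix -> R}) : fam := fun j => \matrix_(a, b) y (j, (a, b)).

Lemma mxfam_uncK Z : mxfam_unc (cvec c Z) = Z.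
Proof. by apply/funext => j; apply/matrixP => a b; rewrite mxE ffunE. Qed.

Lemma mxfam_cvecK y : cvec c (mxfam_unc y) = y.
Proof. by apply/ffunP => -[j [a b]]; rewrite ffunE /mxfam_coord mxE. Qed.

Definition ord_prev j : 'I_n.+1 := inord (val j).-1.

(* If y solves the linear equation of Y^lambda and z^j is as in the coupled   *)
(* system, then U_0 = y and U_j = z^j y solve this linear system; its U_j is  *)
(* the j-th derivative of Y^lambda.                                           *)
Definition derivative_field U (x : 'rV[R]_d) : fam := fun j =>
  lambda *: (U j *m M x) + (val j)%:R *: (U (ord_prev j) *m M x).

Definition uncouple Z : fam := fun j => if j == ord0 then Z ord0 else Z j *m Z ord0.

(** On orthogonal [U ord0] the transpose is the inverse; being polynomial, it passes directly to
    uniform limits. *)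
Definition couple U : fam := fun j => if j == ord0 then U ord0 else U j *m (U ord0)^T.

Lemma derivative_field_system :
  exists B : 'I_d -> {linear {ffun ix -> R} -> {ffun ix -> R}},
    forall U i, cvec c (derivative_field U (e_ i)) = B i (cvec c U).
Proof.
apply: (linear_of_field mxfam_uncK) => i q y z; apply/ffunP => -[j [a b]].
have E j' : mxfam_unc (q *: y + z) j' = q *: mxfam_unc y j' + mxfam_unc z j'.
  by apply/matrixP => a' b'; rewrite !mxE !ffunE.
rewrite !ffunE /mxfam_coord /derivative_field /= !E !mulmxDl -!scalemxAl.
set u := mxfam_unc y j *m _; set u' := mxfam_unc z j *m _.
set w := mxfam_unc y _ *m _; set w' := mxfam_unc z _ *m _.
by rewrite !mxE /GRing.scale /=; ring.
Qed.

(** The [j]-th derivative of [lambda ^+ q]; for [q < j] the falling factorial vanishes, whatever the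
    truncated exponent is. *)
Definition falling_coef j q : R := (q ^_ j)%:R * lambda ^+ (q - j).

(** Leibniz rule for the [j]-th derivative of [lambda * lambda ^+ q]. At [j = 0] the weight 0
    removes the default predecessor. *)
Lemma falling_coefS j q :
  falling_coef j q.+1 = lambda * falling_coef j q + (val j)%:R * falling_coef (ord_prev j) q.
Proof.
rewrite /falling_coef /ord_prev; case: j => [[|j] jn] /=.
  by rewrite !ffactn0 !subn0 mul0r addr0 !mul1r exprS.
rewrite inordK ?(ltnW jn) // ffactSS ffactnSr subSS.
have [jq|qj] := ltnP j q.
  rewrite -[(q - j)%N](@prednK (q - j)) ?subn_gt0 // -subnS !natrM exprS.
  have -> : (q - j.+1).+1%:R = q%:R - j%:R :> R by rewrite subnSK // natrB // ltnW.
  by rewrite -!natr1; ring.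
have [->|qj'] := eqVneq j q; first by rewrite subnn muln0 !natrM; ring.
have {}qj : (q < j)%N by rewrite ltn_neqAle eq_sym qj'.
by rewrite ffact_small // mul0n muln0 !mul0r mulr0; ring.
Qed.

(** Appending a letter multiplies component [j] by [lambda M] and adds [j] times the previous
    component: this is the recursion [falling_coefS]. *)
Lemma foldl_derivative_field w j :
  foldl (fun U i => derivative_field U (e_ i)) (@coupled_init R k n) w j =
  falling_coef j (size w) *: word_prod M w.
Proof.
elim/last_ind: w j => [|w i IH] j.
  rewrite /= /coupled_init /word_prod big_nil /falling_coef ffact0n sub0n expr0 mulr1.
  by case: eqP => [->|/eqP /negPf]; rewrite ?scale1r // -val_eqE /= => ->; rewrite scale0r.
rewrite foldl_rcons /derivative_field !IH size_rcons falling_coefS.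
have -> : word_prod M (rcons w i) = word_prod M w *m M (e_ i).
  by rewrite -[LHS]mul1mx -[in RHS](mul1mx (word_prod M w)) -!foldl_linear_field foldl_rcons.
by rewrite -!scalemxAl !scalerA scalerDl.
Qed.

Section OneDriver.
Variables (T : R) (x : R -> 'rV[R]_d) (v : R -> R).
Hypotheses (T_gt0 : 0 < T) (v_ucont : ucont 0 T v)
  (v_mono : forall s t, 0 <= s -> s <= t -> t <= T -> v s <= v t)
  (x_dom : forall i, dominated 0 T v (fun t => x t ord0 i)).
Hypothesis M_antisym : forall x, (M x)^T = - M x.
Local Notation mx_diff := (mx_differential T x v).

Let T_ge0 : 0 <= T. Proof. exact: ltW. Qed.

Lemma ucont_mulmx (P Q : R -> 'M[R]_k) :
  (forall a b, ucont 0 T (fun t => P t a b)) -> (forall a b, ucont 0 T (fun t => Q t a b)) ->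
  forall a b, ucont 0 T (fun t => (P t *m Q t) a b).
Proof.
move=> uP uQ a b; rewrite (_ : (fun t => _) = fun t => \sum_e P t a e * Q t e b).
  by apply: ucont_sum => e; exact: ucontM.
by apply/funext => t; rewrite mxE.
Qed.

Lemma ode_solution_mx_differential (V : fam -> 'rV[R]_d -> fam) y0 (Z : R -> fam) :
  (forall i j a b, ucont 0 T (fun t => V (Z t) (e_ i) j a b)) ->
  (ode_solution c T V y0 x Z <->
   Z 0 = y0 /\ forall j, mx_diff (fun t => Z t j) (fun i t => V (Z t) (e_ i) j)).
Proof.
move=> uV; have uf i a : ucont 0 T (fun t => cvec c (V (Z t) (e_ i)) a).
  case: a => j [a b]; rewrite (_ : (fun t => _) = fun t => V (Z t) (e_ i) j a b) //.
  by apply/funext => t; rewrite ffunE.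
have E1 j a b : (fun t => cvec c (Z t) (j, (a, b))) = fun t => Z t j a b.
  by apply/funext => t; rewrite ffunE.
have E2 j a b i t : cvec c (V (Z t) (e_ i)) (j, (a, b)) = V (Z t) (e_ i) j a b.
  by rewrite ffunE.
split=> [sol|[Z0 dZ]].
  have [h0 h] := ode_solution_driven T_gt0 v_ucont v_mono x_dom uf sol.
  split; first by rewrite -(mxfam_uncK (Z 0)) h0 mxfam_uncK.
  move=> j a b; have [h1 h2] := h (j, (a, b)); rewrite E1 in h1 h2; split=> //.
  by apply: eq_tangent h2 => s t *; apply: eq_bigr => i _; rewrite E2.
apply: (driven_ode_solution T_gt0 v_ucont v_mono x_dom uf); first by rewrite Z0.
move=> [j [a b]]; have [h1 _ h2] := dZ j a b; rewrite E1; split=> //.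
by apply: eq_tangent h2 => s t *; apply: eq_bigr => i _; rewrite E2.
Qed.

(** Component 0 solves a closed linear equation with orthogonal flow, so [invmx] in the other
    components is a genuine inverse. *)
Lemma coupled_base (Z : R -> fam) :
  ode_solution c T (coupled_field lambda M) (@coupled_init R k n) x Z ->
  [/\ forall j a b, ucont 0 T (fun t => Z t j a b),
      mx_diff (fun t => Z t ord0) (fun i t => Z t ord0 *m (lambda *: M (e_ i))),
      Z 0 ord0 = 1%:M &
      forall t, 0 <= t <= T -> Z t ord0 *m (Z t ord0)^T = 1%:M].
Proof.
move=> sol; have uZ j a b : ucont 0 T (fun t => Z t j a b).
  by apply: within_ucont; exact: (sol (j, (a, b))).1.
pose V (y : 'M[R]_k) (u : 'rV[R]_d) := lambda *: (y *m M u).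
have sol0 : ode_solution (@mx_coord R k) T V 1%:M x (fun t => Z t ord0).
  by move=> a; exact: sol (ord0, a).
have uV i a : ucont 0 T (fun t => cvec (@mx_coord R k) (V (Z t ord0) (e_ i)) a).
  case: a => a b.
  rewrite (_ : (fun t => _) = fun t => lambda * (Z t ord0 *m M (e_ i)) a b).
    apply: ucontZ; apply: (ucont_mulmx (uZ ord0)) => a' b'; exact: ucont_cst.
  by apply/funext => t; rewrite ffunE /mx_coord /V mxE.
have [h0 h] := ode_solution_driven T_gt0 v_ucont v_mono x_dom uV sol0.
have Z0 : Z 0 ord0 = 1%:M by rewrite -(mx_uncK (Z 0 ord0)) h0 mx_uncK.
have dZ : mx_diff (fun t => Z t ord0) (fun i t => Z t ord0 *m (lambda *: M (e_ i))).
  move=> a b; have [h1 h2] := h (a, b); split.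
  - exact: uZ.
  - by move=> i; apply: (ucont_mulmx (uZ ord0)) => a' b'; exact: ucont_cst.
  - rewrite (_ : (fun t => _) = fun t => Z t ord0 a b) in h2; last by apply/funext => t; rewrite ffunE.
    apply: eq_tangent h2 => s t *; apply: eq_bigr => i _.
    by rewrite ffunE /mx_coord /V /= -scalemxAr.
split=> //; apply: (orthogonal_flow T_ge0 v_ucont v_mono x_dom dZ Z0) => i.
by rewrite linearZ /= M_antisym scalerN.
Qed.

Lemma orthogonal_inv (P : 'M[R]_k) : P *m P^T = 1%:M -> invmx P = P^T.
Proof.
move=> PP; have [uP _] := mulmx1_unit PP.
by rewrite -[RHS]mul1mx -(mulVmx uP) -mulmxA PP mulmx1.
Qed.

(* With z^0 = 1, the equation of z^1 is the case j = 1 of                     *)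
(* dz^j = j z^(j-1) Ad_(y^0) M(dX).                                           *)
Definition relative (Z : fam) : fam := fun j => if j == ord0 then 1%:M else Z j.

Lemma coupled_field_relative Z u j : j != ord0 ->
  coupled_field lambda M Z u j = (val j)%:R *: (relative Z (ord_prev j) *m Ad (Z ord0) M u).
Proof.
rewrite /coupled_field /relative /ord_prev; case: j => [[|[|j]] jn] // _ /=.
  by rewrite (_ : inord 0 == ord0) ?scale1r ?mul1mx // -val_eqE /= inordK.
by rewrite ifF //; apply/negP; rewrite -val_eqE /= inordK // ltnW.
Qed.

Lemma uncouple_relative Z j : uncouple Z j = relative Z j *m Z ord0.
Proof. by rewrite /uncouple /relative; case: eqP => // _; rewrite mul1mx. Qed.

(** Product rule for [z^j y]: in [j z^(j-1) y M y^-1 y] the inverse cancels, and [z^j dy] gives the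
    term with [lambda]. *)
Lemma uncouple_linear_ode (Z : R -> fam) (B : 'I_d -> {linear {ffun ix -> R} -> {ffun ix -> R}}) :
  (forall U i, cvec c (derivative_field U (e_ i)) = B i (cvec c U)) ->
  ode_solution c T (coupled_field lambda M) (@coupled_init R k n) x Z ->
  linear_ode T x v B (cvec c (@coupled_init R k n)) (fun t => cvec c (uncouple (Z t))).
Proof.
move=> HB sol; have [uZ dP P0 PP] := coupled_base sol.
have uM (N : 'M[R]_k) a b : ucont 0 T (cst (N a b)) by exact: ucont_cst.
have uPT a b : ucont 0 T (fun t => (Z t ord0)^T a b).
  by apply: eq_ucont (uZ ord0 b a) => t _; rewrite mxE.
have uR j a b : ucont 0 T (fun t => relative (Z t) j a b).
  by rewrite /relative; case: (j == ord0); [exact: ucont_cst|exact: uZ].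
have inv t : 0 <= t <= T -> invmx (Z t ord0) = (Z t ord0)^T.
  by move=> tT; apply: orthogonal_inv; exact: PP.
have uF j i a b : ucont 0 T (fun t =>
    ((val j)%:R *: (relative (Z t) (ord_prev j) *m Ad (Z t ord0) M (e_ i))) a b).
  apply: (@eq_ucont _ _ _ (fun t => (val j)%:R * (relative (Z t) (ord_prev j) *m
    (Z t ord0 *m M (e_ i) *m (Z t ord0)^T)) a b)).
    by move=> t tT; rewrite [RHS]mxE /Ad inv.
  apply: ucontZ.
  exact: (ucont_mulmx (uR _) (ucont_mulmx (ucont_mulmx (uZ ord0) (uM (M (e_ i)))) uPT)).
have uV i j a b : ucont 0 T (fun t => coupled_field lambda M (Z t) (e_ i) j a b).
  have [->|j0] := eqVneq j ord0.
    apply: (@eq_ucont _ _ _ (fun t => lambda * (Z t ord0 *m M (e_ i)) a b)).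
      by move=> t _; rewrite [RHS]mxE.
    by apply: ucontZ; exact: (ucont_mulmx (uZ ord0) (uM (M (e_ i)))).
  by apply: eq_ucont (uF j i a b) => t _; rewrite coupled_field_relative.
have [Z0 dZ] := (ode_solution_mx_differential _ uV).1 sol.
have dR j : mx_diff (fun t => relative (Z t) j) (fun i t =>
    (val j)%:R *: (relative (Z t) (ord_prev j) *m Ad (Z t ord0) M (e_ i))).
  have [j0|j0] := eqVneq j ord0.
    apply: eq_mx_differential (mx_differential_cst x v_mono 1%:M) => [t _|i t _].
      by rewrite /relative j0 eqxx.
    by rewrite j0 /= scale0r.
  apply: eq_mx_differential (dZ j) => [t _|i t _]; first by rewrite /relative (negPf j0).
  by rewrite coupled_field_relative.
have dU j : mx_diff (fun t => uncouple (Z t) j)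
    (fun i t => derivative_field (uncouple (Z t)) (e_ i) j).
  apply: eq_mx_differential (mx_differentialM T_ge0 v_ucont v_mono x_dom (dR j) dP).
    by move=> t _; rewrite uncouple_relative.
  move=> i t tT; rewrite /derivative_field !uncouple_relative /Ad inv // addrC.
  rewrite -scalemxAr -[in RHS](mulmxA (relative (Z t) j)) -scalemxAr; congr (_ + _).
  by rewrite -scalemxAl -!mulmxA (mulmx1C (PP t tT)) mulmx1.
apply: (ode_solution_linear T_gt0 v_ucont v_mono x_dom HB).
apply/ode_solution_mx_differential.
  by move=> i j a b; have [_ h _] := dU j a b; exact: h.
split=> //; apply/funext => j; rewrite /uncouple Z0 /coupled_init.
by case: eqP => //; rewrite eqxx mulmx1.
Qed.

(** In the differential of [U_j y^T] the terms with [lambda] cancel by antisymmetry; inserting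
    [y^T y = 1] into [j U_(j-1) M y^T] gives the form with [Ad]. *)
Lemma couple_ode_solution (U : R -> fam) (B : 'I_d -> {linear {ffun ix -> R} -> {ffun ix -> R}}) :
  (forall U i, cvec c (derivative_field U (e_ i)) = B i (cvec c U)) ->
  linear_ode T x v B (cvec c (@coupled_init R k n)) (fun t => cvec c (U t)) ->
  ode_solution c T (coupled_field lambda M) (@coupled_init R k n) x (fun t => couple (U t)).
Proof.
move=> HB lo; have sol := linear_ode_solution T_gt0 v_ucont v_mono x_dom HB lo.
have uU j a b : ucont 0 T (fun t => U t j a b).
  by apply: within_ucont; exact: (sol (j, (a, b))).1.
have uM (N : 'M[R]_k) a b : ucont 0 T (cst (N a b)) by exact: ucont_cst.
have uD i j a b : ucont 0 T (fun t => derivative_field (U t) (e_ i) j a b).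
  apply: (@eq_ucont _ _ _ (fun t => lambda * (U t j *m M (e_ i)) a b +
      (val j)%:R * (U t (ord_prev j) *m M (e_ i)) a b)).
    by move=> t _; rewrite [RHS]mxE; congr (_ + _); rewrite [RHS]mxE.
  by apply: ucontD; apply: ucontZ; exact: (ucont_mulmx (uU _) (uM (M (e_ i)))).
have [U0 dU] := (ode_solution_mx_differential _ uD).1 sol.
have dP : mx_diff (fun t => U t ord0) (fun i t => U t ord0 *m (lambda *: M (e_ i))).
  apply: eq_mx_differential (dU ord0) => // i t _.
  by rewrite /derivative_field /= scale0r addr0 -scalemxAr.
have P0 : U 0 ord0 = 1%:M by rewrite U0 /coupled_init eqxx.
have PP : forall t, 0 <= t <= T -> U t ord0 *m (U t ord0)^T = 1%:M.
  apply: (orthogonal_flow T_ge0 v_ucont v_mono x_dom dP P0) => i.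
  by rewrite linearZ /= M_antisym scalerN.
have c0 t : couple (U t) ord0 = U t ord0 by rewrite /couple eqxx.
have cE t j : 0 <= t <= T -> relative (couple (U t)) j = U t j *m (U t ord0)^T.
  move=> tT; rewrite /relative /couple; have [->|//] := eqVneq j ord0.
  by rewrite PP.
have dR j : mx_diff (fun t => U t j *m (U t ord0)^T) (fun i t =>
    (val j)%:R *: (U t (ord_prev j) *m M (e_ i) *m (U t ord0)^T)).
  apply: eq_mx_differential (mx_differentialM T_ge0 v_ucont v_mono x_dom (dU j) (mx_differential_tr dP)) => // i t _.
  rewrite /derivative_field trmx_mul linearZ /= M_antisym mulmxDl scalerN mulNmx mulmxN.
  by rewrite -!scalemxAl -!scalemxAr mulmxA addrAC subrr add0r.
have dZ j : mx_diff (fun t => couple (U t) j)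
    (fun i t => coupled_field lambda M (couple (U t)) (e_ i) j).
  have [->|j0] := eqVneq j ord0.
    apply: eq_mx_differential dP => [t _|i t _]; first by rewrite c0.
    by rewrite /coupled_field /= c0 -scalemxAr.
  apply: eq_mx_differential (dR j) => [t _|i t tT]; first by rewrite /couple (negPf j0).
  rewrite coupled_field_relative // cE // /Ad c0 orthogonal_inv ?PP //.
  rewrite -!mulmxA; congr (_ *: (_ *m _)).
  by rewrite [in RHS]mulmxA (mulmx1C (PP t tT)) mul1mx.
apply/ode_solution_mx_differential.
  by move=> i j a b; have [_ h _] := dZ j a b; exact: h.
split=> //; apply/funext => j; rewrite /couple U0 /coupled_init.
by case: eqP => //; rewrite eqxx trmx1 mulmx1.
Qed.

Lemma couple_uncouple (Z : R -> fam) t :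
  ode_solution c T (coupled_field lambda M) (@coupled_init R k n) x Z -> 0 <= t <= T ->
  couple (uncouple (Z t)) = Z t.
Proof.
move=> sol tT; have [_ _ _ PP] := coupled_base sol; apply/funext => j.
rewrite /couple /uncouple eqxx; case: eqP => [->//|_].
by rewrite -mulmxA PP // mulmx1.
Qed.

End OneDriver.
End CoupledSystem.

Section UniformLimits.
Variables (R : realType) (T : R).
Implicit Types (F G : nat -> R -> R) (f g : R -> R).

Definition uconv F g := forall e, 0 < e -> exists M, forall m, (M <= m)%N ->
  forall t, 0 <= t <= T -> `|g t - F m t| < e.

Definition bounded_on f := exists2 C : R, 0 <= C & forall t, 0 <= t <= T -> `|f t| <= C.

Lemma uconvM F G f g : bounded_on f -> bounded_on g -> uconv F f -> uconv G g ->
  uconv (fun m t => F m t * G m t) (fun t => f t * g t).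
Proof.
move=> [C C0 HC] [D D0 HD] cF cG e e0.
have r0 : 0 < e / (C + D + 1) by rewrite divr_gt0 //; lra.
have d0 : 0 < Num.min 1 (e / (C + D + 1)) by rewrite lt_min ltr01.
have [M1 H1] := cF _ d0; have [M2 H2] := cG _ d0.
exists (maxn M1 M2) => m; rewrite geq_max => /andP[m1 m2] t tT.
have h1 := H1 m m1 t tT; have h2 := H2 m m2 t tT.
set r := Num.min _ _ in d0 h1 h2.
have rC : (C + D + 1) * r <= e.
  rewrite mulrC -ler_pdivlMr; last by lra.
  by rewrite /r ge_min lexx orbT.
have r1 : r <= 1 by rewrite /r ge_min lexx.
apply: lt_le_trans rC.
rewrite (_ : f t * g t - F m t * G m t = f t * (g t - G m t) + (f t - F m t) * G m t); last by ring.
apply: (le_lt_trans (ler_normD _ _)); rewrite !normrM.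
have hG : `|G m t| < D + 1.
  have := ler_normB (g t) (g t - G m t); rewrite opprB addrC subrK.
  have := HD t tT; lra.
have k1 : `|f t| * `|g t - G m t| <= C * r by apply: ler_pM => //; [exact: HC|exact: ltW].
have k2 : `|f t - F m t| * `|G m t| < r * (D + 1) by apply: ltr_pM.
rewrite (_ : (C + D + 1) * r = C * r + r * (D + 1)); last by ring.
exact: ler_ltD.
Qed.

Lemma uconv_sum (J : Type) (r : seq J) (F : J -> nat -> R -> R) (f : J -> R -> R) :
  (forall a, uconv (F a) (f a)) ->
  uconv (fun m t => \sum_(a <- r) F a m t) (fun t => \sum_(a <- r) f a t).
Proof.
move=> H; elim: r => [|a r IH] e e0.
  by exists 0%N => m _ t _; rewrite !big_nil subrr normr0.
have e20 : 0 < e / 2 by rewrite divr_gt0.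
have [M1 H1] := H a _ e20; have [M2 H2] := IH _ e20.
exists (maxn M1 M2) => m; rewrite geq_max => /andP[m1 m2] t tT.
have h1 := H1 m m1 t tT; have h2 := H2 m m2 t tT.
rewrite !big_cons opprD addrACA; apply: (le_lt_trans (ler_normD _ _)); lra.
Qed.

Lemma eq_uconv F G f : (forall m t, 0 <= t <= T -> F m t = G m t) -> uconv F f -> uconv G f.
Proof.
move=> FG H e /H [M HM]; exists M => m Mm t tT; rewrite -FG //; exact: HM.
Qed.

Lemma uconv_unique F f g : uconv F f -> uconv F g -> forall t, 0 <= t <= T -> f t = g t.
Proof.
move=> cf cg t tT; apply/eqP; rewrite -subr_eq0 -normr_le0.
apply/ler_addgt0Pr => e e0; rewrite add0r.
have e20 : 0 < e / 2 by rewrite divr_gt0.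
have [M1 H1] := cf _ e20; have [M2 H2] := cg _ e20.
have h1 := H1 (maxn M1 M2) (leq_maxl _ _) t tT.
have h2 := H2 (maxn M1 M2) (leq_maxr _ _) t tT.
have := ler_normB (f t - F (maxn M1 M2) t) (g t - F (maxn M1 M2) t).
rewrite [X in `|X| <= _](_ : _ = f t - g t); last by ring.
lra.
Qed.

End UniformLimits.

Lemma mulmx_tr_entry (R : pzSemiRingType) k l m (P : 'M[R]_(k, l)) (Q : 'M[R]_(m, l)) a b :
  (P *m Q^T) a b = \sum_e P a e * Q b e.
Proof. by rewrite mxE; apply: eq_bigr => e _; rewrite mxE. Qed.

(** * The coupled rough equation *)

Section CoupledRDE.
Variables (R : realType) (d k n : nat) (p gamma T lambda : R).
Variables (X : R -> R -> trunc_tensor R d (Num.truncn p)) (S : R -> R -> tensor_series R d).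
Variable M : {linear 'rV[R]_d -> 'M[R]_k}.
Hypotheses (T_gt0 : 0 < T) (p_gt2 : 2 < p).
Hypothesis X_geometric : is_geometric_rough_path gamma T X.
Hypothesis S_signature : is_signature gamma T X S.
Hypothesis M_antisym : forall x, (M x)^T = - M x.
Variables (W : R -> R) (kap : nat -> R).
Hypotheses (W_ucont : ucont 0 T W)
  (W_mono : forall s t, 0 <= s -> s <= t -> t <= T -> W s <= W t)
  (kap_ge0 : forall n, 0 <= kap n)
  (kap_small : forall r : R, 0 <= r -> exists C : R, forall n, kap n * r ^+ n <= C)
  (S_le : forall s t w, 0 <= s -> s <= t -> t <= T ->
     `|S s t w| <= kap (size w) * pinc p W s t ^+ size w).
Local Notation fam := ('I_n.+1 -> 'M[R]_k).
Local Notation ix := ('I_n.+1 * ('I_k * 'I_k))%type.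
Local Notation c := (@mxfam_coord R n.+1 k).
Local Notation init := (@coupled_init R k n).

Variable B : 'I_d -> {linear {ffun ix -> R} -> {ffun ix -> R}}.
Hypothesis B_def : forall U i,
  cvec c (derivative_field lambda M U (delta_mx ord0 i)) = B i (cvec c U).

Definition derivative_flow (t : R) : fam := mxfam_unc (sigop B (S 0 t) (cvec c init)).

Lemma derivative_flow_hol j a b : hol T p W (fun t => derivative_flow t j a b).
Proof.
rewrite (_ : (fun t => _) = (fun t => sigop B (S 0 t) (cvec c init) (j, (a, b)))).
  exact: (hol_sigop p_gt2 S_signature W_mono kap_ge0 kap_small S_le).
by apply/funext => t; rewrite /derivative_flow mxE.
Qed.

Lemma derivative_flow_bounded j a b : bounded_on T (fun t => derivative_flow t j a b).
Proof. exact: (hol_bounded p_gt2 W_mono (derivative_flow_hol j a b)). Qed.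

Lemma couple_hol j a b : hol T p W (fun t => couple (derivative_flow t) j a b).
Proof.
rewrite /couple; case: (j == ord0); first exact: derivative_flow_hol.
rewrite (_ : (fun t => _) = fun t => \sum_e derivative_flow t j a e * derivative_flow t ord0 b e); last first.
  by apply/funext => t; rewrite mulmx_tr_entry.
by apply: hol_sum => e; apply: (holM p_gt2 W_mono); exact: derivative_flow_hol.
Qed.

Lemma couple_uconv (U : nat -> R -> fam) :
  (forall j a b, uconv T (fun m t => U m t j a b) (fun t => derivative_flow t j a b)) ->
  forall j a b, uconv T (fun m t => couple (U m t) j a b) (fun t => couple (derivative_flow t) j a b).
Proof.
move=> cU j a b; rewrite /couple; case: (j == ord0); first exact: cU.
rewrite (_ : (fun m t => _) = fun m t => \sum_e U m t j a e * U m t ord0 b e); last first.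
  by apply/funext => m; apply/funext => t; rewrite mulmx_tr_entry.
rewrite [X in uconv _ _ X](_ : _ =
    fun t => \sum_e derivative_flow t j a e * derivative_flow t ord0 b e); last first.
  by apply/funext => t; rewrite mulmx_tr_entry.
by apply: uconv_sum => e; apply: uconvM => //; exact: derivative_flow_bounded.
Qed.

Lemma derivative_flow_approx x (v : nat -> R -> R) (U : nat -> R -> fam) : approximates T X x ->
  (forall m, [/\ ucont 0 T (v m), forall s t, 0 <= s -> s <= t -> t <= T -> v m s <= v m t &
     forall i, dominated 0 T (v m) (fun t => x m t ord0 i)]) ->
  (forall m, linear_ode T (x m) (v m) B (cvec c init) (fun t => cvec c (U m t))) ->
  forall j a b, uconv T (fun m t => U m t j a b) (fun t => derivative_flow t j a b).
Proof.
move=> ax vP lo j a b e e0.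
have [m0 H] := linear_approx_cvg T_gt0 p_gt2 S_signature W_ucont W_mono kap_ge0 kap_small S_le
  ax vP lo e0.
exists m0 => m mm t tT; apply: (le_lt_trans _ (H m mm t tT)).
apply: le_trans (nrm_coord _ (j, (a, b))).
rewrite distrC [X in _ <= `|X|](_ : _ = U m t j a b - derivative_flow t j a b) //.
by rewrite /derivative_flow mxE !ffunE.
Qed.

Lemma derivative_flow_approximants :
  exists x (v : nat -> R -> R) (U : nat -> R -> fam), [/\ approximates T X x,
    forall m, [/\ ucont 0 T (v m), forall s t, 0 <= s -> s <= t -> t <= T -> v m s <= v m t &
      forall i, dominated 0 T (v m) (fun t => x m t ord0 i)] &
    forall m, linear_ode T (x m) (v m) B (cvec c init) (fun t => cvec c (U m t))].
Proof.
have [x ax] := geometric_approximates X_geometric; have [v vP] := path_controls T_gt0 ax.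
have /choice [y yo] : forall m, exists y, linear_ode T (x m) (v m) B (cvec c init) y.
  by move=> m; have [vu vm xdm] := vP m; exact: linear_ode_exists (ltW T_gt0) vu vm xdm _ _.
exists x, v, (fun m t => mxfam_unc (y m t)); split=> // m.
by rewrite (_ : (fun t => _) = y m) //; apply/funext => t; rewrite mxfam_cvecK.
Qed.

(** The identity holds for the approximating solutions and, being polynomial, survives uniform
    convergence. *)
Lemma derivative_flow_orthogonal t : 0 <= t <= T ->
  derivative_flow t ord0 *m (derivative_flow t ord0)^T = 1%:M.
Proof.
move=> tT; have [x [v [U [ax vP lo]]]] := derivative_flow_approximants.
have PP m s : 0 <= s <= T -> U m s ord0 *m (U m s ord0)^T = 1%:M.
  move=> sT; have [vu vm xdm] := vP m.
  have sol := couple_ode_solution T_gt0 vu vm xdm M_antisym B_def (lo m).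
  have [_ _ _ H] := coupled_base T_gt0 vu vm xdm M_antisym sol.
  by have := H s sT; rewrite /couple eqxx.
apply/matrixP => a b; rewrite mulmx_tr_entry.
apply: (@uconv_unique _ T (fun m s => \sum_e U m s ord0 a e * U m s ord0 b e)
    (fun s => \sum_e derivative_flow s ord0 a e * derivative_flow s ord0 b e)
    (cst ((1%:M : 'M[R]_k) a b))) tT.
  apply: uconv_sum => e; apply: uconvM; try exact: derivative_flow_bounded.
    exact: derivative_flow_approx lo _ _ _.
  exact: derivative_flow_approx lo _ _ _.
move=> e e0; exists 0%N => m _ s sT; rewrite -mulmx_tr_entry PP //.
by rewrite subrr normr0.
Qed.

Lemma coupled_rde_exists :
  rde_solution c T X (coupled_field lambda M) init (fun t => couple (derivative_flow t)).
Proof.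
split.
  by apply: (finite_pvar_hol p_gt2 W_ucont W_mono) => -[j [a b]]; exact: couple_hol.
have [x [v [U [ax vP lo]]]] := derivative_flow_approximants.
exists x, (fun m t => couple (U m t)); split.
- exact: ax.1.
- exact: ax.2.
- move=> m; have [vu vm xdm] := vP m.
  exact: (couple_ode_solution T_gt0 vu vm xdm M_antisym B_def (lo m)).
- move=> [j [a b]]; apply/(uniform_cvgP T).
  exact: (couple_uconv (derivative_flow_approx ax vP lo)).
Qed.

(** Uncoupling the approximants of a solution gives solutions of the linear system, whose limit is
    known; [couple] recovers the approximants and passes to the limit. *)
Lemma coupled_rde_unique Z : rde_solution c T X (coupled_field lambda M) init Z ->
  forall t, 0 <= t <= T -> Z t = couple (derivative_flow t).
Proof.
move=> [_ [x [Zm [xb xd sol cZ]]]] t tT.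
have ax : approximates T X x by split.
have [v vP] := path_controls T_gt0 ax.
have lo m : linear_ode T (x m) (v m) B (cvec c init) (fun t => cvec c (uncouple (Zm m t))).
  have [vu vm xdm] := vP m.
  exact: (uncouple_linear_ode T_gt0 vu vm xdm M_antisym B_def (sol m)).
have cC := couple_uconv (derivative_flow_approx ax vP lo).
apply/funext => j; apply/matrixP => a b.
apply: (@uconv_unique _ T (fun m t => Zm m t j a b) (fun t => Z t j a b)
    (fun t => couple (derivative_flow t) j a b)) tT.
  exact/(uniform_cvgP T)/(cZ (j, (a, b))).
apply: eq_uconv (cC j a b) => m s sT; have [vu vm xdm] := vP m.
by rewrite (couple_uncouple T_gt0 vu vm xdm M_antisym (sol m) sT).
Qed.

Lemma sigact_derivative_field (Z : tensor_series R d) q j a b :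
  sigact B Z q (cvec c init) (j, (a, b)) =
  falling_coef lambda j q * mx_tensor idfun M (level q Z) a b.
Proof.
rewrite (sigact_coord B_def) mx_tensor_level summxE mulr_sumr; apply: eq_bigr => w _.
by rewrite /mxfam_coord foldl_derivative_field size_tuple !mxE /=; ring.
Qed.

(** Levels below [j] have falling factorial 0, hence the shift by [j]; the others carry the
    coefficients of the series differentiated [j] times. *)
Lemma psum_derivative_field (Z : tensor_series R d) q (j : 'I_n.+1) a b :
  psum B Z (q + j) (cvec c init) (j, (a, b)) =
  poly_sum (iter j (@dseries R) (fun n => mx_tensor idfun M (level n Z) a b)) lambda q.
Proof.
rewrite /psum addnC big_split_ord /= ffunE !sum_ffunE big1 => [|i _]; last first.
  by rewrite sigact_derivative_field /falling_coef ffact_small ?ltn_ord // !mul0r.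
rewrite add0r; apply: eq_bigr => i _; rewrite sigact_derivative_field iter_dseries.
by rewrite /falling_coef addKn addnC mulrAC.
Qed.

Lemma derivative_flow_series t (j : 'I_n.+1) a b : 0 <= t <= T ->
  (poly_sum (iter j (@dseries R) (fun q => mx_tensor idfun M (level q (S 0 t)) a b)) lambda q : R^o)
    @[q --> \oo] --> (derivative_flow t j a b : R^o).
Proof.
move=> /andP[t0 tT].
have [L L0 HL] := linear_bounded_all B.
have bS := sig_bounded_signature p_gt2 W_mono (signature_nil S_signature) S_le (lexx 0) t0 tT.
have cS : (fun n => psum B (S 0 t) n (cvec c init) (j, (a, b))) @ \oo -->
    sigop B (S 0 t) (cvec c init) (j, (a, b)).
  exact: (sigop_cvg L0 HL kap_ge0 (pinc_ge0 _ _ _ _) kap_small bS).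
rewrite -(cvg_shiftn j) in cS.
rewrite /derivative_flow mxE.
rewrite (_ : poly_sum _ lambda = fun q => psum B (S 0 t) (q + j) (cvec c init) (j, (a, b))) //.
by apply/funext => q; rewrite psum_derivative_field.
Qed.

End CoupledRDE.

(** * The complex extension *)

Section LinearFlow.
Variables (R : realType) (d k : nat) (p gamma T : R).
Variables (X : R -> R -> trunc_tensor R d (Num.truncn p)) (S : R -> R -> tensor_series R d).
Variable M : {linear 'rV[R]_d -> 'M[R]_k}.
Hypotheses (T_gt0 : 0 < T) (p_gt2 : 2 < p).
Hypothesis S_signature : is_signature gamma T X S.
Variables (W : R -> R) (kap : nat -> R).
Hypotheses (W_ucont : ucont 0 T W)
  (W_mono : forall s t, 0 <= s -> s <= t -> t <= T -> W s <= W t)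
  (kap_ge0 : forall n, 0 <= kap n)
  (kap_small : forall r : R, 0 <= r -> exists C : R, forall n, kap n * r ^+ n <= C)
  (S_le : forall s t w, 0 <= s -> s <= t -> t <= T ->
     `|S s t w| <= kap (size w) * pinc p W s t ^+ size w).

Definition sig_coef (t : R) a b n := mx_tensor idfun M (level n (S 0 t)) a b.

Lemma psum_signature_cvg (I : finType) (A : 'I_d -> {linear {ffun I -> R} -> {ffun I -> R}})
    y a t : 0 <= t <= T ->
  (fun n => psum A (S 0 t) n y a) @ \oo --> sigop A (S 0 t) y a.
Proof.
move=> /andP[t0 tT]; have [L L0 HL] := linear_bounded_all A.
have bS := sig_bounded_signature p_gt2 W_mono (signature_nil S_signature) S_le (lexx 0) t0 tT.
exact: (sigop_cvg L0 HL kap_ge0 (pinc_ge0 _ _ _ _) kap_small bS).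
Qed.

Lemma entire_sig_coef t a b : 0 <= t <= T -> entire (sig_coef t a b).
Proof.
move=> /andP[t0 tT].
have bS := sig_bounded_signature p_gt2 W_mono (signature_nil S_signature) S_le (lexx 0) t0 tT.
exact: (entire_signature M a b kap_ge0 (pinc_ge0 _ _ _ _) kap_small bS).
Qed.

Lemma rde_entry_cvg lambda (Y : R -> 'M[R]_k) :
  rde_solution (@mx_coord R k) T X (linear_field (fun x => lambda *: M x)) 1%:M Y ->
  forall t, 0 <= t <= T -> forall a b,
  (poly_sum (sig_coef t a b) lambda n : R^o) @[n --> \oo] --> (Y t a b : R^o).
Proof.
move=> sol t tT a b; have [A HA] := linear_field_system M lambda.
have E := rde_linear_limit T_gt0 p_gt2 S_signature W_ucont W_mono kap_ge0 kap_small S_le HA sol tT.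
have -> : Y t a b = sigop A (S 0 t) (cvec (@mx_coord R k) 1%:M) (a, b) by rewrite -E ffunE.
rewrite (_ : poly_sum _ _ = fun n => psum A (S 0 t) n (cvec (@mx_coord R k) 1%:M) (a, b)).
  exact: psum_signature_cvg.
by apply/funext => n; rewrite (psum_linear_field _ _ _ _ HA).
Qed.

Definition cmx_unc (y : {ffun bool * ('I_k * 'I_k) -> R}) : 'M[Cplx R]_k :=
  \matrix_(a, b) (y (true, (a, b)) +i* y (false, (a, b)))%C.

Lemma cmx_uncK y : cmx_unc (cvec (@cmx_coord R k) y) = y.
Proof.
apply/matrixP => a b; rewrite mxE !ffunE /cmx_coord /=.
by case: (y a b).
Qed.

Lemma cmx_cvecK y : cvec (@cmx_coord R k) (cmx_unc y) = y.
Proof. by apply/ffunP => -[[] [a b]]; rewrite ffunE /cmx_coord /= mxE. Qed.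

Lemma cmx_coordD a (P Q : 'M[Cplx R]_k) : cmx_coord a (P + Q) = cmx_coord a P + cmx_coord a Q.
Proof.
case: a => e [a b]; rewrite /cmx_coord mxE /=.
by case: (P a b) (Q a b) => [? ?] [? ?]; case: e.
Qed.

Lemma cmx_coordZ a (q : R) (P : 'M[Cplx R]_k) :
  cmx_coord a (to_Cplx R q *: P) = q * cmx_coord a P.
Proof.
case: a => e [a b]; rewrite /cmx_coord mxE /=.
by case: (P a b) => [u v]; case: e; rewrite /= mul0r ?subr0 ?addr0.
Qed.

Local Notation cfield z := (linear_field (fun x => z *: map_mx (to_Cplx R) (M x))).

(** Multiplication by a complex matrix is real linear in the real and imaginary parts of the
    entries, so the real theory covers the complex equation. *)
Lemma complex_field_system (z : Cplx R) :
  exists A : 'I_d -> {linear {ffun bool * ('I_k * 'I_k) -> R} -> {ffun bool * ('I_k * 'I_k) -> R}},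
    forall y j, cvec (@cmx_coord R k) (cfield z y (delta_mx ord0 j)) =
      A j (cvec (@cmx_coord R k) y).
Proof.
apply: (linear_of_field cmx_uncK) => j q y y'; apply/ffunP => a.
rewrite !ffunE; have -> : cmx_unc (q *: y + y') = to_Cplx R q *: cmx_unc y + cmx_unc y'.
  rewrite -[RHS]cmx_uncK; congr cmx_unc; apply/ffunP => b.
  have cK w : cmx_coord b (cmx_unc w) = w b by rewrite -[in RHS](cmx_cvecK w) ffunE.
  by rewrite !ffunE cmx_coordD cmx_coordZ !cK.
by rewrite /linear_field mulmxDl -scalemxAl cmx_coordD cmx_coordZ.
Qed.

Lemma psum_complex_field z
    (A : 'I_d -> {linear {ffun bool * ('I_k * 'I_k) -> R} -> {ffun bool * ('I_k * 'I_k) -> R}})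
    (Z : tensor_series R d) n e a b :
  (forall y j, cvec (@cmx_coord R k) (cfield z y (delta_mx ord0 j)) =
      A j (cvec (@cmx_coord R k) y)) ->
  psum A Z n (cvec (@cmx_coord R k) 1%:M) (e, (a, b)) =
  cmx_coord (e, (a, b)) (\sum_(i < n) z ^+ i *: map_mx (to_Cplx R) (mx_tensor idfun M (level i Z))).
Proof.
move=> HA; have c0 : cmx_coord (e, (a, b)) (0 : 'M[Cplx R]_k) = 0.
  by rewrite /cmx_coord /= mxE; case: e.
rewrite /psum sum_ffunE (big_morph _ (cmx_coordD (e, (a, b))) c0).
apply: eq_bigr => i _; rewrite (sigact_coord HA) mx_tensor_level.
have -> : z ^+ i *: map_mx (to_Cplx R) (\sum_(w : i.-tuple 'I_d) idfun (Z w) *: word_prod M w) =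
    \sum_(w : i.-tuple 'I_d) to_Cplx R (Z w) *: (z ^+ i *: map_mx (to_Cplx R) (word_prod M w)).
  apply/matrixP => a' b'; rewrite !mxE !summxE rmorph_sum mulr_sumr; apply: eq_bigr => w _.
  by rewrite !mxE rmorphM mulrCA.
rewrite (big_morph _ (cmx_coordD (e, (a, b))) c0).
apply: eq_bigr => w _; rewrite cmx_coordZ foldl_linear_field mul1mx.
by rewrite word_prod_scale word_prod_map size_tuple.
Qed.

End LinearFlow.

Lemma series_power_entry (K : numFieldType) k (A : nat -> 'M[K]_k) z n a b :
  series (fun n => z ^+ n *: A n) n a b = poly_sum (fun n => A n a b) z n.
Proof. by rewrite seriesE summxE; apply: eq_bigr => i _; rewrite mxE mulrC. Qed.

Lemma power_series_mx_cvg (K : numFieldType) k (A : nat -> 'M[K]_k) z (Y : 'M[K]_k) :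
  (forall a b, (poly_sum (fun n => A n a b) z n : K^o) @[n --> \oo] --> (Y a b : K^o)) ->
  series (fun n => z ^+ n *: A n) @ \oo --> Y.
Proof.
move=> H; apply: mx_cvg => a b.
by rewrite (_ : (fun n => _) = poly_sum (fun n => A n a b) z) //; apply/funext => n; exact: series_power_entry.
Qed.

Lemma mx_tilde_power (R : realType) d k (K : numFieldType) (iota : {rmorphism R -> K})
    (M : 'rV[R]_d -> 'M[K]_k) z (Z : tensor_series R d) (Y : 'M[K]_k) :
  series (fun n => z ^+ n *: mx_tensor iota M (level n Z)) @ \oo --> Y ->
  cvgn (mx_tilde_series iota (fun x => z *: M x) Z) /\ Y = mx_tilde iota (fun x => z *: M x) Z.
Proof.
have -> : series (fun n => z ^+ n *: mx_tensor iota M (level n Z)) =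
    mx_tilde_series iota (fun x => z *: M x) Z.
  by rewrite /mx_tilde_series; congr series; apply/funext => n; rewrite mx_tensor_scale.
move=> h; split; first exact: (cvgP _ h).
by rewrite /mx_tilde; apply/esym; exact: (cvg_lim (@norm_hausdorff _ _) h).
Qed.

Section ComplexFlow.
Variables (R : realType) (d k : nat) (p gamma T : R).
Variables (X : R -> R -> trunc_tensor R d (Num.truncn p)) (S : R -> R -> tensor_series R d).
Variable M : {linear 'rV[R]_d -> 'M[R]_k}.
Hypotheses (T_gt0 : 0 < T) (p_gt2 : 2 < p).
Hypothesis X_geometric : is_geometric_rough_path gamma T X.
Hypothesis S_signature : is_signature gamma T X S.
Variables (W : R -> R) (kap : nat -> R).
Hypotheses (W_ucont : ucont 0 T W)
  (W_mono : forall s t, 0 <= s -> s <= t -> t <= T -> W s <= W t)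
  (kap_ge0 : forall n, 0 <= kap n)
  (kap_small : forall r : R, 0 <= r -> exists C : R, forall n, kap n * r ^+ n <= C)
  (S_le : forall s t w, 0 <= s -> s <= t -> t <= T ->
     `|S s t w| <= kap (size w) * pinc p W s t ^+ size w).

Lemma complex_flow : exists Yc : Cplx R -> R -> 'M[Cplx R]_k,
  (forall z, rde_solution (@cmx_coord R k) T X
     (linear_field (fun x => z *: map_mx (to_Cplx R) (M x))) 1%:M (Yc z)) /\
  forall z t, 0 <= t <= T -> forall a b,
    (poly_sum (fun n => to_Cplx R (sig_coef S M t a b n)) z n : (Cplx R)^o)
      @[n --> \oo] --> (Yc z t a b : (Cplx R)^o).
Proof.
have /choice [A HA] := complex_field_system M.
exists (fun z t => cmx_unc (sigop (A z) (S 0 t) (cvec (@cmx_coord R k) 1%:M))); split.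
  move=> z; exact: (rde_linear_exists T_gt0 p_gt2 S_signature W_ucont W_mono kap_ge0 kap_small
    S_le 1%:M (HA z) (@cmx_cvecK R k) X_geometric).
move=> z t tT a b.
have H e : (fun n => cmx_coord (e, (a, b)) (\sum_(i < n) z ^+ i *: map_mx (to_Cplx R)
    (mx_tensor idfun M (level i (S 0 t))))) @ \oo -->
    sigop (A z) (S 0 t) (cvec (@cmx_coord R k) 1%:M) (e, (a, b)).
  rewrite (_ : (fun n => _) = fun n => psum (A z) (S 0 t) n (cvec (@cmx_coord R k) 1%:M) (e, (a, b))).
    exact: (psum_signature_cvg p_gt2 S_signature W_mono kap_ge0 kap_small S_le).
  by apply/funext => n; rewrite (psum_complex_field _ _ _ _ _ (HA z)).
have E n : (\sum_(i < n) z ^+ i *: map_mx (to_Cplx R) (mx_tensor idfun M (level i (S 0 t)))) a b =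
    poly_sum (fun n => to_Cplx R (sig_coef S M t a b n)) z n.
  by rewrite summxE; apply: eq_bigr => i _; rewrite !mxE mulrC.
rewrite /cmx_unc mxE; apply: Cplx_cvg => /=.
- rewrite (_ : (fun n => _) = fun n => cmx_coord (true, (a, b)) (\sum_(i < n) z ^+ i *:
    map_mx (to_Cplx R) (mx_tensor idfun M (level i (S 0 t))))); first exact: H.
  by apply/funext => n; rewrite /cmx_coord /= E.
- rewrite (_ : (fun n => _) = fun n => cmx_coord (false, (a, b)) (\sum_(i < n) z ^+ i *:
    map_mx (to_Cplx R) (mx_tensor idfun M (level i (S 0 t))))); first exact: H.
  by apply/funext => n; rewrite /cmx_coord /= E.
Qed.

End ComplexFlow.

Lemma poly_sum_Cplx (R : realType) (b : nat -> R) (z : R) n :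
  poly_sum (fun n => to_Cplx R (b n)) (to_Cplx R z) n = to_Cplx R (poly_sum b z n).
Proof. by rewrite rmorph_sum; apply: eq_bigr => i _; rewrite rmorphM rmorphXn. Qed.

Lemma to_Cplx_cvg (R : realType) (u : nat -> R) (l : R) : u @ \oo --> l ->
  (to_Cplx R (u n) : (Cplx R)^o) @[n --> \oo] --> (to_Cplx R l : (Cplx R)^o).
Proof. by move=> cu; apply: Cplx_cvg => /=; [exact: cu|exact: cvg_cst]. Qed.

Theorem theorem3p8 (R : realType) (d k : nat) (p gamma T : R)
    (X : R -> R -> trunc_tensor R d (Num.truncn p))
    (S : R -> R -> tensor_series R d)
    (M : {linear 'rV[R]_d -> 'M[R]_k})
    (Y : R -> R -> 'M[R]_k)
    (k_ge1 : (1 <= k)%N) (p_gt2 : 2 < p) (gamma_gt0 : 0 < gamma) (T_gt0 : 0 < T)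
    (X_geometric : is_geometric_rough_path gamma T X)
    (S_signature : is_signature gamma T X S)
    (M_antisym : forall x, (M x)^T = - M x)
    (Y_solution : forall lambda : R,
       rde_solution (@mx_coord R k) T X
         (linear_field (fun x => lambda *: M x)) 1%:M (Y lambda)) :
  [/\ (* (1) *)
      forall (lambda t : R), 0 <= t <= T ->
        [/\ cvgn (mx_tilde_series idfun (fun x => lambda *: M x) (S 0 t)),
            Y lambda t = mx_tilde idfun (fun x => lambda *: M x) (S 0 t),
            series (fun n => lambda ^+ n *: mx_tensor idfun M (level n (S 0 t)))
              @ \oo --> Y lambda t &
            Y lambda t = Phi S t (fun x => lambda *: M x)],
      (* (2) *)
      forall (lambda t : R), 0 <= t <= T ->
        Y lambda t *m (Y lambda t)^T = 1%:M,
      (* (3), analyticity and complex extension *)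
      (forall t : R, 0 <= t <= T ->
         forall i j, real_analytic (fun lambda => Y lambda t i j)) /\
      (exists Yc : Cplx R -> R -> 'M[Cplx R]_k,
        [/\ forall (lambda t : R), 0 <= t <= T ->
              Yc (to_Cplx R lambda) t = map_mx (to_Cplx R) (Y lambda t),
            forall t : R, 0 <= t <= T ->
              forall i j, holomorphic (fun z => Yc z t i j),
            forall (z : Cplx R) (t : R), 0 <= t <= T ->
              [/\ series (fun n => z ^+ n *:
                     map_mx (to_Cplx R) (mx_tensor idfun M (level n (S 0 t))))
                    @ \oo --> Yc z t,
                  cvgn (mx_tilde_series (to_Cplx R)
                    (fun x => z *: map_mx (to_Cplx R) (M x)) (S 0 t)) &
                  Yc z t = mx_tilde (to_Cplx R)
                    (fun x => z *: map_mx (to_Cplx R) (M x)) (S 0 t)] &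
            forall z : Cplx R,
              rde_solution (@cmx_coord R k) T X
                (linear_field (fun x => z *: map_mx (to_Cplx R) (M x)))
                1%:M (Yc z)]) &
      (* (3), derivatives *)
      forall (n : nat) (lambda : R), (1 <= n)%N ->
        exists Z : R -> 'I_n.+1 -> 'M[R]_k,
          [/\ rde_solution (@mxfam_coord R n.+1 k) T X
                (coupled_field lambda M) (@coupled_init R k n) Z,
              forall Z' : R -> 'I_n.+1 -> 'M[R]_k,
                rde_solution (@mxfam_coord R n.+1 k) T X
                  (coupled_field lambda M) (@coupled_init R k n) Z' ->
                forall t : R, 0 <= t <= T -> Z' t = Z t &
              forall t : R, 0 <= t <= T ->
                derive1n n (fun l => Y l t) lambda = Z t ord_max *m Y lambda t]].
Proof.
have [W [kap [W_ucont W_mono kap_ge0 kap_small S_le]]] :=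
  signature_control p_gt2 gamma_gt0 S_signature.
have Y_series lambda t : 0 <= t <= T -> forall a b,
    (poly_sum (sig_coef S M t a b) lambda n : R^o) @[n --> \oo] --> (Y lambda t a b : R^o).
  move=> tT; exact: (rde_entry_cvg T_gt0 p_gt2 S_signature W_ucont W_mono kap_ge0 kap_small S_le
    (Y_solution lambda)).
have eS t a b : 0 <= t <= T -> entire (sig_coef S M t a b).
  exact: (entire_sig_coef M p_gt2 S_signature W_mono kap_ge0 kap_small S_le).
(* For every [n], component 0 of the linear system has the power series of [Y lambda]; thus
   [Y lambda] inherits orthogonality (already from [n = 0]) and is the [y^0] of the coupled
   system. *)
have Y_flow n lambda : exists2 B : 'I_d -> {linear {ffun 'I_n.+1 * ('I_k * 'I_k) -> R} ->
      {ffun 'I_n.+1 * ('I_k * 'I_k) -> R}},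
    (forall U i, cvec (@mxfam_coord R n.+1 k) (derivative_field lambda M U (delta_mx ord0 i)) =
      B i (cvec (@mxfam_coord R n.+1 k) U)) &
    forall t, 0 <= t <= T -> Y lambda t = derivative_flow S B t ord0.
  have [B HB] := derivative_field_system n lambda M.
  exists B => // t tT; apply/matrixP => a b.
  apply: (cvg_unique _ (Y_series lambda t tT a b)); first exact: norm_hausdorff.
  exact: (derivative_flow_series p_gt2 S_signature W_mono kap_ge0 kap_small S_le HB
    (j := ord0) (a := a) (b := b) tT).
split.
- move=> lambda t tT; have h := power_series_mx_cvg (Y_series lambda t tT).
  by have [h1 h2] := mx_tilde_power h.
- move=> lambda t tT; have [B HB ->//] := Y_flow 0 lambda.
  exact: (derivative_flow_orthogonal T_gt0 p_gt2 X_geometric S_signature M_antisym W_ucont W_mono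
    kap_ge0 kap_small S_le HB).
- split=> [t tT a b|].
    exact: (entire_real_analytic (eS t a b tT) (fun w => Y_series w t tT a b)).
  have [Yc [Yc_sol Yc_series]] := complex_flow M T_gt0 p_gt2 X_geometric S_signature W_ucont W_mono
    kap_ge0 kap_small S_le.
  exists Yc; split=> //.
  (* At real points both sides are limits of the same partial sums. *)
  + move=> lambda t tT; apply/matrixP => a b; rewrite mxE.
    apply: (cvg_unique _ (Yc_series (to_Cplx R lambda) t tT a b)); first exact: norm_hausdorff.
    rewrite (_ : poly_sum _ _ = fun n => to_Cplx R (poly_sum (sig_coef S M t a b) lambda n)).
      exact: to_Cplx_cvg (Y_series lambda t tT a b).
    by apply/funext => n; rewrite poly_sum_Cplx.
  + move=> t tT a b.
    exact: (entire_holomorphic (eS t a b tT) (fun w => Yc_series w t tT a b)).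
  + move=> z t tT.
    have h : series (fun n => z ^+ n *:
        map_mx (to_Cplx R) (mx_tensor idfun M (level n (S 0 t)))) @ \oo --> Yc z t.
      apply: power_series_mx_cvg => a b.
      rewrite (_ : (fun n => map_mx _ _ a b) = (fun n => to_Cplx R (sig_coef S M t a b n))); last first.
        by apply/funext => n; rewrite mxE.
      exact: Yc_series.
    have h' : series (fun n => z ^+ n *:
        mx_tensor (to_Cplx R) (fun x => map_mx (to_Cplx R) (M x)) (level n (S 0 t))) @ \oo --> Yc z t.
      rewrite (_ : (fun n => _) = fun n => z ^+ n *:
        map_mx (to_Cplx R) (mx_tensor idfun M (level n (S 0 t)))) //.
      by apply/funext => n; rewrite mx_tensor_map.
    by have [h1 h2] := mx_tilde_power h'.
- move=> n lambda n0; have [B HB YE] := Y_flow n lambda.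
  exists (fun t => couple (derivative_flow S B t)); split.
  + exact: (coupled_rde_exists T_gt0 p_gt2 X_geometric S_signature M_antisym W_ucont W_mono
      kap_ge0 kap_small S_le HB).
  + move=> Z solZ; exact: (coupled_rde_unique T_gt0 p_gt2 S_signature M_antisym W_ucont
      W_mono kap_ge0 kap_small S_le HB solZ).
  + move=> t tT; rewrite YE // /couple ifF; last first.
      by apply/negP => /eqP/(congr1 val) /= n_eq0; rewrite n_eq0 in n0.
    (* Here [z^n Y] is [U_n U_0^T U_0], which is [U_n] by orthogonality. Both [U_n] and the [n]-th
       derivative are sums of the power series differentiated [n] times. *)
    rewrite -mulmxA (mulmx1C (derivative_flow_orthogonal T_gt0 p_gt2 X_geometric S_signature
      M_antisym W_ucont W_mono kap_ge0 kap_small S_le HB tT)) mulmx1.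
    apply/matrixP => a b.
    have H := derive1n_entire (A := fun q => mx_tensor idfun M (level q (S 0 t)))
      (fun a b => eS t a b tT) (fun z => Y_series z t tT) (m := n) (z := lambda) (i := a) (j := b).
    apply: (cvg_unique _ H); first exact: norm_hausdorff.
    exact: (derivative_flow_series p_gt2 S_signature W_mono kap_ge0 kap_small S_le HB
      (j := ord_max) (a := a) (b := b) tT).
Qed.
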